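(* Let $V$ be a Zygmund vector field on $\hat{\mathbb{R}}$ normalized to vanish at $0,1,\infty$, and let $\dot{s}:\mathcal{F}\to\mathbb{R}$ be its infinitesimal shear function on the Farey tesselation $\mathcal{F}$ of the upper half-plane. Then the infinitesimal shear function $H(\dot{s}):\mathcal{F}\to\mathbb{R}$ of the Hilbert transform $H(V)$ is given, for every edge $(b,d)\in\mathcal{F}$ which is the common side of the complementary triangles of $\mathcal{F}$ with vertices $a,b,d$ and $b,c,d$ ($a,b,c,d$ in counterclockwise order), by $$H(\dot{s})((b,d))=\sum_{p\in\hat{\mathbb{Q}}}\sum_{n\in\mathbb{Z}}\dot{s}_p(e_n^p)\Big[\tfrac{H(V_{e_n^p})(c)-H(V_{e_n^p})(b)}{c-b}+\tfrac{H(V_{e_n^p})(d)-H(V_{e_n^p})(a)}{d-a}-\tfrac{H(V_{e_n^p})(b)-H(V_{e_n^p})(a)}{b-a}-\tfrac{H(V_{e_n^p})(d)-H(V_{e_n^p})(c)}{d-c}\Big],$$ where $\mathcal{F}_p=\{e_n^p\}_{n\in\mathbb{Z}}$ is the fan with tip $p$ and $\dot s_p(e_n^p)=\frac12\dot s(e_n^p)$.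
   Context: The Farey tesselation $\mathcal{F}$ of $\mathbb{H}$ is the set of geodesics with endpoints $\frac ab,\frac cd\in\hat{\mathbb{Q}}=\mathbb{Q}\cup\{\infty\}$ (lowest terms, $\infty=\frac10$) with $|ad-bc|=1$. The fan $\mathcal{F}_p$ is the set of edges with endpoint $p$, enumerated $\{e_n^p\}_{n\in\mathbb{Z}}$ with $e_n^p$ adjacent to $e_{n+1}^p$; edges are oriented with the triangle $\Delta_0$ of vertices $0,1,\infty$ on their left, and $p$ is the initial point of $e_0^p$ and the terminal point of $e_1^p$. The inner sum is the limit of the sums over $-N\le n\le N$; the outer sum is the limit as $N\to\infty$ of the sums over $p$ of Farey order at most $N$, where $0,\infty$ have order $1$, $1,-1$ have order $2$, and if $a/b,c/d$ are neighbours on $\hat{\mathbb{R}}$ among all numbers of order $\le n$ and the maximum of their orders is $n$, then $(a+c)/(b+d)$ has order $n+1$. A vector field on $\hat{\mathbb{R}}$ is a continuous $V:\mathbb{R}\to\mathbb{R}$ such that $\lim_{x\to\pm\infty}V(x)/x^2$ exist, are equal and finite; it is Zygmund if for some $C$ both $V(x)$ and $x^2V(1/x)$ satisfy $|V(x+t)+V(x-t)-2V(x)|\le Ct$ for $x\in[-2,2]$, $t\in[0,1]$. Vanishing at $\infty$ means $V(x)=O(|x|\log|x|)$. Infinitesimal shear of a vector field $W$ on $(b,d)$: $\frac{W(c)-W(b)}{c-b}+\frac{W(d)-W(a)}{d-a}-\frac{W(b)-W(a)}{b-a}-\frac{W(d)-W(c)}{d-c}$; if one of $a,b,c,d$ is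 $\infty$ (and $W(x)=o(x^2)$) the two terms containing $\infty$ are omitted, here and in the claim. Counterclockwise order on $\hat{\mathbb{R}}$ is the cyclic order of increasing reals. Elementary shear fields: for $e$ with finite endpoints $u<v$, $V_e(x)=\frac{(x-u)(x-v)}{u-v}$ for $u<x<v$ and $0$ otherwise; for $e$ with endpoints $u\ge1$ and $\infty$, $V_e(x)=x-u$ for $x>u$ and $0$ otherwise; for $e$ with endpoints $\infty$ and $u\le0$, $V_e(x)=-(x-u)$ for $x<u$ and $0$ otherwise. Hilbert transform: $H(W)(x)=-\frac1\pi\,\mathrm{p.v.}\int_{\mathbb{R}}\frac{x(x-1)}{\xi(\xi-1)(\xi-x)}W(\xi)\,d\xi$ with principal values at $\xi=0,1,x$, and $H(W)(0)=H(W)(1)=0$. *)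

(* Defs.v *)
From mathcomp Require Import all_boot all_order all_algebra.
From mathcomp Require Import all_classical all_reals all_analysis.
Set Implicit Arguments.
Unset Strict Implicit.
Unset Printing Implicit Defensive.
Import Order.TTheory GRing.Theory Num.Theory.
Import numFieldNormedType.Exports.
Local Open Scope classical_set_scope.
Local Open Scope ring_scope.

(* [None] is the point at infinity, written 1/0 in lowest terms. *)
Definition Qhat := option rat.
Definition Qinf : Qhat := None.
Definition Qnum (x : Qhat) : int := if x is Some q then numq q else 1.
Definition Qden (x : Qhat) : int := if x is Some q then denq q else 0.

(* Linear order on Q u {oo} with oo as greatest element; the counterclockwise
   cyclic order is the cyclic order it induces. *)
Definition Qlt (x y : Qhat) : bool :=
  match x, y with
  | Some p, Some q => p < q
  | Some _, None => true
  | None, _ => false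
  end.

Definition ccw3 (x y z : Qhat) : bool :=
  [|| Qlt x y && Qlt y z, Qlt y z && Qlt z x | Qlt z x && Qlt x y].

Definition ccw4 (a b c d : Qhat) : bool :=
  [|| [&& Qlt a b, Qlt b c & Qlt c d], [&& Qlt b c, Qlt c d & Qlt d a],
      [&& Qlt c d, Qlt d a & Qlt a b] | [&& Qlt d a, Qlt a b & Qlt b c]].

Definition farey_neighbours (x y : Qhat) : bool :=
  `|Qnum x * Qden y - Qnum y * Qden x| == 1.

(* The left side of the geodesic from u to v is bounded by the closed arc going
   counterclockwise from v to u; the vertices of Delta_0 have to lie there. *)
Definition Delta0_on_left (u v : Qhat) : bool :=
  all (fun t => [|| t == u, t == v | ccw3 v t u]) [:: Some 0; Some 1; Qinf].

(* An edge of the Farey tesselation is the pair (initial point, terminal point)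
   for the orientation that has Delta_0 on the left. Thus u < v for an edge
   (u, v) with finite endpoints, u >= 1 for (u, oo) and u <= 0 for (oo, u). *)
Definition edge :=
  {e : Qhat * Qhat | farey_neighbours e.1 e.2 && Delta0_on_left e.1 e.2}.
Definition init_pt (e : edge) : Qhat := (val e).1.
Definition term_pt (e : edge) : Qhat := (val e).2.

Definition has_endpoints (e : edge) (x y : Qhat) : Prop :=
  (init_pt e = x /\ term_pt e = y) \/ (init_pt e = y /\ term_pt e = x).

Definition farey_triangle (x y z : Qhat) : bool :=
  [&& farey_neighbours x y, farey_neighbours y z & farey_neighbours x z].

Definition common_side (e : edge) (a b c d : Qhat) : Prop :=
  [/\ has_endpoints e b d, farey_triangle a b d, farey_triangle b c d
    & ccw4 a b c d].

Definition fan (p : Qhat) : set edge :=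
  [set e | init_pt e = p \/ term_pt e = p].

Definition adjacent (e f : edge) : Prop :=
  exists x y z, [/\ has_endpoints e x y, has_endpoints f x z
                  & farey_triangle x y z].

Definition fan_enumeration (E : Qhat -> int -> edge) : Prop :=
  forall p, [/\ set_bij setT (fan p) (E p),
                (forall n : int, adjacent (E p n) (E p (n + 1))),
                init_pt (E p 0) = p
              & term_pt (E p 1) = p].

(* The point (a+c)/(b+d) of the counterclockwise arc from x = a/b to y = c/d;
   oo is 1/0 as the end of such an arc and -1/0 as its beginning. *)
Definition mediant (x y : Qhat) : Qhat :=
  match x, y with
  | Some p, Some q => Some ((numq p + numq q)%:Q / (denq p + denq q)%:Q)
  | Some p, None => Some ((numq p + 1)%:Q / (denq p)%:Q)
  | None, Some q => Some ((-1 + numq q)%:Q / (denq q)%:Q)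
  | None, None => Qinf
  end.

Definition consecutive (s : seq Qhat) (x y : Qhat) : bool :=
  (x != y) && all (fun z => ~~ ccw3 x z y) s.

(* If [prev] and [cur] list the points of Farey order <= n - 1 and <= n, these
   are the points of order <= n + 1. *)
Definition farey_next (prev cur : seq Qhat) : seq Qhat :=
  undup (cur ++
    [seq mediant xy.1 xy.2 |
       xy <- [seq (x, y) | x <- cur, y <- cur] &
       consecutive cur xy.1 xy.2 && ((xy.1 \notin prev) || (xy.2 \notin prev))]).

(* The points of Farey order at most n. *)
Fixpoint farey_upto (n : nat) : seq Qhat :=
  match n with
  | 0 => [::]
  | 1 => [:: Some 0; Qinf]
  | 2 => [:: Some 0; Some 1; Qinf; Some (-1)]
  | (m.+1 as k).+1 => farey_next (farey_upto m) (farey_upto k)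
  end.

Section VectorFields.
Variable R : realType.
Implicit Types (V W : R -> R) (s : edge -> R).

Definition vector_field V : Prop :=
  continuous V /\
  exists l : R, V x / x ^+ 2 @[x --> +oo] --> l /\
                V x / x ^+ 2 @[x --> -oo] --> l.

(* x^2 V(1/x), with the continuous extension at x = 0. *)
Definition chart_at_oo V (x : R) : R :=
  if x == 0 then lim (V y / y ^+ 2 @[y --> +oo]) else x ^+ 2 * V x^-1.

Definition zygmund V : Prop :=
  exists C : R, forall x t : R, -2 <= x <= 2 -> 0 <= t <= 1 ->
    `|V (x + t) + V (x - t) - 2 * V x| <= C * t /\
    `|chart_at_oo V (x + t) + chart_at_oo V (x - t) - 2 * chart_at_oo V x|
      <= C * t.

Definition vanishes_at_oo V : Prop :=
  exists C M : R, forall x : R, M <= `|x| -> `|V x| <= C * (`|x| * ln `|x|).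

Definition diff_quotient W (x y : Qhat) : R :=
  match x, y with
  | Some p, Some q => (W (ratr p) - W (ratr q)) / (ratr p - ratr q)
  | _, _ => 0
  end.

Definition inf_shear W (a b c d : Qhat) : R :=
  diff_quotient W c b + diff_quotient W d a
  - diff_quotient W b a - diff_quotient W d c.

(* The right-hand side is invariant under (a, b, c, d) -> (c, d, a, b), so this
   determines s on every edge. *)
Definition shear_function W s : Prop :=
  forall e a b c d, common_side e a b c d -> s e = inf_shear W a b c d.

Definition elementary_field (e : edge) : R -> R := fun x =>
  match init_pt e, term_pt e with
  | Some u, Some v =>
      if ratr u < x < ratr v
      then (x - ratr u) * (x - ratr v) / (ratr u - ratr v) else 0
  | Some u, None => if ratr u < x then x - ratr u else 0
  | None, Some u => if x < ratr u then - (x - ratr u) else 0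
  | None, None => 0
  end.

Definition truncated_hilbert W (x eps : R) : R :=
  (\int[lebesgue_measure]_(xi in
      [set xi : R | [/\ eps < `|xi|, eps < `|xi - 1| & eps < `|xi - x|]])
    (x * (x - 1) / (xi * (xi - 1) * (xi - x)) * W xi))%R.

Definition hilbert W : R -> R := fun x =>
  if (x == 0) || (x == 1) then 0
  else - pi^-1 * lim (truncated_hilbert W x eps @[eps --> 0^'+]).

Definition symmetric_sum (f : int -> R) (N : nat) : R :=
  \sum_(0 <= k < N.*2.+1) f (k%:Z - N%:Z).

Definition farey_sum (f : Qhat -> R) (N : nat) : R :=
  \sum_(p <- farey_upto N) f p.

End VectorFields.

(* Main.v *)
Require Import Defs.
From mathcomp Require Import all_boot all_order all_algebra.
From mathcomp Require Import all_classical all_reals all_analysis.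
From mathcomp Require Import measurable_realfun.
From mathcomp Require Import ring lra zify.
Import Order.TTheory GRing.Theory Num.Theory.
Import numFieldNormedType.Exports.
Local Open Scope classical_set_scope.
Local Open Scope ring_scope.

(* Write an edge e = (u, v) as a pair of integer vectors of determinant 1. Then V_e is
   the product of two linear forms and, on the arc cut off by e, s(e) V_e is the
   difference of the two quadratic vector fields that agree with V at u, v and at the
   third vertex of the triangle on the right, resp. left, of e. Hence the partial sums
   over a fan telescope, and the sum S_N over the fans of order at most N agrees with V
   at the points of order at most N, while on a Farey interval of level N it is the mean
   of two quadratic interpolants of V attached to edges below that interval.
   A Zygmund field is Hoelder of exponent 3/4, so at xi such an interpolant differs from
   V by O((1 + |xi|)^(3/2) min(1, |xi - a|)^(1/2)) for every a outside its interval.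
   Taking for a a rational close to xi gives S_N -> V pointwise; taking a = 0, 1, x gives
   a majorant that is integrable against the kernel of the Hilbert transform at x, since
   a rational x lies outside all intervals of level N for N large. By dominated
   convergence the double series of the values at x of s(e) H(V_e) / 2 converges to
   H(V)(x), and the infinitesimal shear is a linear combination of such values. *)

(** * Edges and fans *)

(** Telescoping yields majorants that do not depend on the number of terms, so the order of
    summation prescribed for the double series is exactly what makes it converge under the integral.
    The exponent 3/4 fits the square root in the majorant. For an edge from u = a/b to v = c/d with
    mediant m, the error of an interpolant contains (b/d) |V(u) - V(m)| with |u - m| <= b^-2. A
    Hoelder exponent alpha turns this into b^(1 - 2 alpha) / d, and alpha = 3/4 gives b^(-1/2) / d,
    at most the root of the length 1/(b d). The power (1 + |xi|)^(3/2) dominates |xi| log |xi| and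
    still leaves |xi|^(-3/2) against a kernel of order |xi|^-3. V vanishes at the poles 0 and 1 of
    the kernel, but V(x) need not be 0. A multiple of a local field whose principal value is 0 is
    therefore subtracted. Its coefficient is the value at x, and from some level on S_N(x) = V(x),
    so that these corrections cancel in the error. *)

(* As the initial point of an edge, oo is -1/0; then every edge ((a, b), (c, d))
   satisfies b c - a d = 1. *)
Definition lnum (x : Qhat) : int := if x is Some q then numq q else -1.
Definition ea (e : edge) : int := lnum (init_pt e).
Definition eb (e : edge) : int := Qden (init_pt e).
Definition ec (e : edge) : int := Qnum (term_pt e).
Definition ed (e : edge) : int := Qden (term_pt e).

Lemma Qden_ge0 x : 0 <= Qden x.
Proof. by case: x => [q|] //=; exact: ltW. Qed.

Lemma Qden_eq0 x : Qden x = 0 -> x = None.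
Proof. by case: x => [q|] //= /eqP; rewrite denq_eq0. Qed.

Lemma QltE (x y : rat) : Qlt (Some x) (Some y) = (numq x * denq y < numq y * denq x).
Proof.
rewrite /Qlt -[in LHS](divq_num_den x) -[in LHS](divq_num_den y).
rewrite ltr_pdivrMr ?ltr0z // mulrAC ltr_pdivlMr ?ltr0z //.
by rewrite -!rmorphM /= ltr_int.
Qed.

Lemma SomeE (x y : rat) : (Some x == Some y) = (numq x * denq y == numq y * denq x).
Proof.
rewrite -[LHS]/(x == y).
rewrite -[in LHS](divq_num_den x) -[in LHS](divq_num_den y).
by rewrite eqr_div ?intr_eq0 // -!rmorphM /= eqr_int.
Qed.

Lemma rat01 : ((numq 0 = 0) * (denq 0 = 1) * (numq 1 = 1) * (denq 1 = 1))%type.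
Proof. by []. Qed.

Lemma ltratE (x y : rat) : (x < y) = (numq x * denq y < numq y * denq x).
Proof. exact: QltE. Qed.

(** Having Delta_0 on the left fixes the sign of the Farey determinant; the two implications choose
    the side on which an edge at oo may lie. For finite endpoints the determinant alone decides,
    since an interval of determinant 1 has neither 0 nor 1 in its interior. *)
Lemma edge_condP (u v : Qhat) :
  reflect [/\ Qden u * Qnum v - lnum u * Qden v = 1, (Qden v = 0 -> 1 <= lnum u)
            & (Qden u = 0 -> Qnum v <= 0)]
  (farey_neighbours u v && Delta0_on_left u v).
Proof.
apply: (iffP andP).
- rewrite /farey_neighbours /Delta0_on_left /ccw3 /= andbT.
  case: u v => [u|] [v|] //=; rewrite ?SomeE ?QltE ?andbF ?andbT ?orbF ?orFb //= ?ltratE ?rat01.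
  + have := denq_gt0 u; have := denq_gt0 v.
    move: (numq u) (denq u) (numq v) (denq v) => a b c d hd hb [/eqP h1 /and3P[_ _ h2]].
    split; [|move=> h; exfalso; lia|move=> h; exfalso; lia].
    move: h1 h2; rewrite [b * c]mulrC; move: (c * b) (a * d) => p q; lia.
  + have := denq_gt0 u.
    move: (numq u) (denq u) => a b hb [/eqP h1 /andP[h2 h3]].
    split; lia.
  + have := denq_gt0 v.
    move: (numq v) (denq v) => a b hb [/eqP h1 /andP[h2 h3]].
    split; lia.
  + by move=> [].
- rewrite /farey_neighbours /Delta0_on_left /ccw3 /= andbT.
  case: u v => [u|] [v|] //=; rewrite ?SomeE ?QltE ?andbF ?andbT ?orbF ?orFb //=.
  + have := denq_gt0 u; have := denq_gt0 v.
    rewrite ?ltratE ?rat01.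
    move: (numq u) (denq u) (numq v) (denq v) => a b c d hd hb [h1 _ _].
    (* If a < 0 < c, or a < b and d < c in the next line, then b c - a d >= b + d >= 2. *)
    have h2 : 0 <= a \/ c <= 0 by case: (lerP 0 a); case: (lerP c 0) => *; [left|left|right|]; nia.
    have h3 : b <= a \/ c <= d by case: (lerP b a); case: (lerP c d) => *; [left|left|right|]; nia.
    split; first by rewrite [c * b]mulrC; move: h1; move: (b * c) (a * d) => p q; lia.
    have -> : a * d < c * b by rewrite [c * b]mulrC; move: h1; move: (b * c) (a * d) => p q; lia.
    rewrite !andbT; apply/andP; split; lia.
  + have := denq_gt0 u.
    rewrite ?ltratE ?rat01.
    move: (numq u) (denq u) => a b hb [h1 h2 h3].
    have := h2 erefl => h4.
    split; first lia. apply/andP; split; lia.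
  + have := denq_gt0 v.
    rewrite ?ltratE ?rat01.
    move: (numq v) (denq v) => a b hb [h1 h2 h3].
    have := h3 erefl => h4.
    split; first lia. apply/andP; split; lia.
  + by move=> [].
Qed.

Section EdgeFacts.
Implicit Types (e f g : edge) (p z : Qhat).

Lemma edge_det e : eb e * ec e - ea e * ed e = 1.
Proof. by case/edge_condP: (valP e). Qed.

Lemma edge_oo_r e : ed e = 0 -> 1 <= ea e.
Proof. by case/edge_condP: (valP e). Qed.

Lemma edge_oo_l e : eb e = 0 -> ec e <= 0.
Proof. by case/edge_condP: (valP e). Qed.

Lemma eb_ge0 e : 0 <= eb e. Proof. exact: Qden_ge0. Qed.
Lemma ed_ge0 e : 0 <= ed e. Proof. exact: Qden_ge0. Qed.

Lemma mid_den_gt0 e : 0 < eb e + ed e.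
Proof.
have := eb_ge0 e; have := ed_ge0 e; have := edge_det e.
move: (ea e) (eb e) (ec e) (ed e) => a b c d h hd hb.
case: (ltrP 0 b) => [|b0]; first lia.
case: (ltrP 0 d) => [|d0]; first lia.
have b1 : b = 0 by lia. have d1 : d = 0 by lia. by subst; lia.
Qed.

Lemma ea_oo e : eb e = 0 -> ea e = -1.
Proof. by rewrite /eb /ea => /Qden_eq0 ->. Qed.

Lemma ec_oo e : ed e = 0 -> ec e = 1.
Proof. by rewrite /ed /ec => /Qden_eq0 ->. Qed.

Lemma edge_inj e f : init_pt e = init_pt f -> term_pt e = term_pt f -> e = f.
Proof.
rewrite /init_pt /term_pt => h1 h2; apply: val_inj.
by move: (val e) (val f) h1 h2 => [a b] [c d] /= -> ->.
Qed.

Definition mid e : rat := (ea e + ec e)%:Q / (eb e + ed e)%:Q.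

(** Bezout: c (b + d) - d (a + c) = b c - a d = 1. *)
Lemma coprime_mid e : coprime `|(ea e + ec e)%R|%N `|(eb e + ed e)%R|%N.
Proof.
suff : coprimez (ea e + ec e) (eb e + ed e) by [].
apply/coprimezP; exists (- ed e, ec e) => /=.
have := edge_det e; move: (ea e) (eb e) (ec e) (ed e) => a b c d h.
by rewrite -h; ring.
Qed.

Lemma numq_mid e : numq (mid e) = ea e + ec e.
Proof. by rewrite /mid coprimeq_num ?coprime_mid // gtr0_sg ?mid_den_gt0 // mul1r. Qed.

Lemma denq_mid e : denq (mid e) = eb e + ed e.
Proof.
rewrite /mid coprimeq_den ?coprime_mid //.
have := mid_den_gt0 e; case: eqP => [->//|_ h]; by rewrite gtr0_norm.
Qed.

Lemma mediant_edge e : mediant (init_pt e) (term_pt e) = Some (mid e).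
Proof.
have := mid_den_gt0 e.
rewrite /mid /ea /eb /ec /ed /mediant; case: (init_pt e) (term_pt e) => [u|] [v|] //=.
- by rewrite addr0.
- by rewrite add0r.
Qed.

Lemma childL_cond e : farey_neighbours (init_pt e) (Some (mid e))
  && Delta0_on_left (init_pt e) (Some (mid e)).
Proof.
apply/edge_condP; rewrite /= numq_mid denq_mid -/(ea e) -/(eb e).
split.
- by rewrite -(edge_det e); ring.
- by have := mid_den_gt0 e; lia.
- by move=> h; have := edge_oo_l e h; have := ea_oo e h; lia.
Qed.

Lemma childR_cond e : farey_neighbours (Some (mid e)) (term_pt e)
  && Delta0_on_left (Some (mid e)) (term_pt e).
Proof.
apply/edge_condP; rewrite /= numq_mid denq_mid -/(ec e) -/(ed e).
split.
- by rewrite -(edge_det e); ring.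
- by move=> h; have := edge_oo_r e h; have := ec_oo e h; lia.
- by have := mid_den_gt0 e; lia.
Qed.

(* The two other sides of the triangle on the right of e. *)
Definition childL e : edge := exist _ (init_pt e, Some (mid e)) (childL_cond e).
Definition childR e : edge := exist _ (Some (mid e), term_pt e) (childR_cond e).

Lemma childLE e : (ea (childL e) = ea e) * (eb (childL e) = eb e) *
  (ec (childL e) = ea e + ec e) * (ed (childL e) = eb e + ed e).
Proof. by rewrite /ea /eb /ec /ed /= numq_mid denq_mid. Qed.

Lemma childRE e : (ea (childR e) = ea e + ec e) * (eb (childR e) = eb e + ed e) *
  (ec (childR e) = ec e) * (ed (childR e) = ed e).
Proof. by rewrite /ea /eb /ec /ed /= numq_mid denq_mid. Qed.

Lemma Qhat_vec_inj x y : Qnum x = Qnum y -> Qden x = Qden y -> x = y.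
Proof.
case: x y => [x|] [y|] //=.
- by move=> h1 h2; rewrite -(divq_num_den x) -(divq_num_den y) h1 h2.
- by move=> _ h; have := denq_gt0 x; rewrite h.
- by move=> _ h; have := denq_gt0 y; rewrite -h.
Qed.

Lemma Qnum_oo x : Qden x = 0 -> Qnum x = 1.
Proof. by move/Qden_eq0 ->. Qed.

(** The third vertex on the left has the difference of the endpoint vectors as its vector. The sign
    k is left open because [Qden] is nonnegative and [Qnum] reads oo as 1/0, whereas [ea e] is -1
    when e begins at oo. *)
Definition left_third e z := exists2 k : int, k ^+ 2 = 1 &
  Qnum z = k * (ea e - ec e) /\ Qden z = k * (eb e - ed e).

Lemma left_third_inj e z z' : left_third e z -> left_third e z' -> z = z'.
Proof.
move=> [k hk [h1 h2]] [k' hk' [h1' h2']].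
have kE (l : int) : l ^+ 2 = 1 -> l = 1 \/ l = -1.
  by move/eqP; rewrite sqrf_eq1 => /orP[] /eqP; auto.
have := Qden_ge0 z; have := Qden_ge0 z'; have := @Qnum_oo z; have := @Qnum_oo z'.
by move=> *; apply: Qhat_vec_inj; case: (kE k hk) => ?; case: (kE k' hk') => ?; subst; lia.
Qed.

Lemma farey_lnum x y : farey_neighbours x y =
  (`|lnum x * Qden y - Qnum y * Qden x| == 1).
Proof. by rewrite /farey_neighbours; case: x => [x|] //=; congr (_ == _); lia. Qed.

(** The endpoint vectors form a basis of determinant 1, and the two neighbour conditions say that
    both coordinates of z in it are 1 or -1. This leaves the sum and the difference up to sign, and
    minus the sum has a negative denominator. *)
Lemma thirdP e z : farey_triangle (init_pt e) (term_pt e) z ->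
  z = Some (mid e) \/ left_third e z.
Proof.
rewrite /farey_triangle [X in [&& _, _ & X]]farey_lnum /farey_neighbours.
case/and3P => _.
rewrite -/(ea e) -/(eb e) -/(ec e) -/(ed e).
have := edge_det e; have := mid_den_gt0 e; have := Qden_ge0 z.
have hn := numq_mid e; have hd := denq_mid e.
move: hn hd; rewrite /left_third; move: (ea e) (eb e) (ec e) (ed e) => a b c d hn hd z0 m0 h.
set n := Qnum z; set q := Qden z => /eqP h1 /eqP h2.
set p := c * q - n * d in h1; set r := a * q - n * b in h2.
have nE : n = p * a - r * c.
  by rewrite -[LHS]mulr1 -h /p /r; ring.
have qE : q = p * b - r * d.
  by rewrite -[LHS]mulr1 -h /p /r; ring.
have pE : p = 1 \/ p = -1 by lia.
have rE : r = 1 \/ r = -1 by lia.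
case: pE rE nE qE => -> [->|->] nE qE.
- by right; exists 1 => //; rewrite -/n -/q nE qE; split; ring.
- by left; apply: Qhat_vec_inj; rewrite /= ?hn ?hd -/n -/q ?nE ?qE; ring.
- exfalso; move: z0; rewrite -/q qE; lia.
- by right; exists (-1) => //; rewrite -/n -/q nE qE; split; ring.
Qed.

Lemma edge_asym e f : init_pt e = term_pt f -> term_pt e = init_pt f -> False.
Proof.
move=> h1 h2; have := edge_det e; have := edge_det f.
have := edge_oo_r e; have := edge_oo_l e; have := edge_oo_r f; have := edge_oo_l f.
have := eb_ge0 e; have := ed_ge0 e.
have := ea_oo e; have := ec_oo e; have := ea_oo f; have := ec_oo f.
rewrite /ea /eb /ec /ed -h1 -h2; case: (init_pt e) (term_pt e) => [u|] [v|] //=; try lia.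
Qed.

Lemma edge_eq e f x y : has_endpoints e x y -> has_endpoints f x y -> e = f.
Proof.
case=> [[h1 h2]|[h1 h2]] [[h3 h4]|[h3 h4]].
- by apply: edge_inj; rewrite ?h1 ?h2.
- by exfalso; apply: (edge_asym e f); rewrite ?h1 ?h2.
- by exfalso; apply: (edge_asym e f); rewrite ?h1 ?h2.
- by apply: edge_inj; rewrite ?h1 ?h2.
Qed.

Lemma farey_sym x y : farey_neighbours x y = farey_neighbours y x.
Proof. by rewrite /farey_neighbours distrC. Qed.

Lemma farey_irr x : farey_neighbours x x = false.
Proof. by rewrite /farey_neighbours subrr normr0. Qed.

(** Adjacency does not name the shared endpoint. For two edges at p it must be p, since otherwise
    two vertices of the triangle would coincide. *)
Lemma fan_adjacent p e f y : has_endpoints e p y -> fan p f -> e <> f -> Defs.adjacent e f ->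
  exists2 z, has_endpoints f p z & farey_triangle p y z.
Proof.
move=> he hf nef [x [y' [z [h1 h2 tri]]]].
have xy : farey_neighbours x y' by case/and3P: tri.
have yz : farey_neighbours y' z by case/and3P: tri.
have xz : farey_neighbours x z by case/and3P: tri.
have pf : p = x \/ p = z by case: hf => hf; case: h2 => -[a b]; rewrite -hf ?a ?b; auto.
have pe : (p = x /\ y = y') \/ (p = y' /\ y = x).
  by case: he => -[a b]; case: h1 => -[c d]; rewrite -a -b -c -d; auto.
case: pe => -[? ?]; subst.
- by exists z.
- case: pf => ?; subst; first by rewrite farey_irr in xy.
  by rewrite farey_irr in yz.
Qed.

End EdgeFacts.

(** * The numbering of the edges of a fan *)

Section Fans.
Implicit Types (e f g : edge) (p z : Qhat).

Lemma adjacent_sym e f : Defs.adjacent e f -> Defs.adjacent f e.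
Proof.
move=> [x [y [z [h1 h2 /and3P[h3 h4 h5]]]]]; exists x, z, y; split=> //.
by rewrite /farey_triangle h5 h3 farey_sym h4.
Qed.

Lemma fan_third p e f : fan p e -> fan p f -> e <> f -> Defs.adjacent e f ->
  exists2 z, has_endpoints f p z & z = Some (mid e) \/ left_third e z.
Proof.
case=> he hf ne ad.
- have [|z hz tri] := fan_adjacent p e f (term_pt e) _ hf ne ad; first by left.
  by exists z => //; apply: thirdP; rewrite he.
- have [|z hz tri] := fan_adjacent p e f (init_pt e) _ hf ne ad; first by right.
  exists z => //; apply: thirdP; rewrite he; case/and3P: tri => h1 h2 h3.
  by rewrite /farey_triangle farey_sym h1 h2 h3.
Qed.

Lemma left_third_childR e : left_third (childR e) (init_pt e).
Proof.
rewrite /left_third !childRE.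
have := @ea_oo e; rewrite /ea /eb; case: (init_pt e) => [u|] /= H.
- by exists 1 => //; split; ring.
- by exists (-1) => //; have := H erefl; split; ring.
Qed.

Lemma left_third_childL e : left_third (childL e) (term_pt e).
Proof.
rewrite /left_third !childLE.
by exists (-1) => //; rewrite /ec /ed; split; ring.
Qed.

Lemma edge_neq e : init_pt e <> term_pt e.
Proof. by move=> h; apply: (edge_asym e e). Qed.

Variables (E : Qhat -> int -> edge).
Hypothesis E_enum : fan_enumeration E.

Lemma E_fan p n : fan p (E p n).
Proof. by case: (E_enum p) => [[h _ _] _ _ _]; apply: h. Qed.

Lemma E_inj p m n : E p m = E p n -> m = n.
Proof. by case: (E_enum p) => [[_ h _] _ _ _] /h; apply; rewrite inE. Qed.

Lemma E_surj p e : fan p e -> exists n, E p n = e.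
Proof. by case: (E_enum p) => [[_ _ h] _ _ _] /h[n _ <-]; exists n. Qed.

Lemma E_adj p (n : int) : Defs.adjacent (E p n) (E p (n + 1)).
Proof. by case: (E_enum p). Qed.

(** The numbering is prescribed only at 0 and 1; this invariant propagates it. From e_{n+1} the next
    edge of the fan is reached through the mediant or through the left third vertex. The latter
    leads back to e_n, so injectivity leaves the mediant. At the start, e_0 cannot lie across the
    mediant of e_1, for then it would end at p, where it begins. *)
Lemma E_pos p (n : nat) : term_pt (E p n.+1%:Z) = p /\
  exists2 z, has_endpoints (E p n%:Z) p z & left_third (E p n.+1%:Z) z.
Proof.
elim: n => [|n [IH1 [y hy ly]]].
  case: (E_enum p) => _ _ h0 h1; split => //.
  have [||z hz [hm|]] := fan_third p (E p 1) (E p 0) (E_fan _ _) (E_fan _ _).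
  - by move/E_inj.
  - by apply: adjacent_sym; exact: (E_adj p 0).
  - exfalso; have e0 : E p 0 = childR (E p 1).
      by apply: (edge_eq _ _ _ _ hz); rewrite hm; right.
    by apply: (edge_neq (E p 0)); rewrite h0 e0; exact: (esym h1).
  - by exists z.
set e := E p n.+1%:Z in IH1 ly *.
have [||z hz [hm|hl]] := fan_third p e (E p n.+2%:Z) (E_fan _ _) (E_fan _ _).
- by move/E_inj; lia.
- by have := E_adj p n.+1%:Z; rewrite (_ : n.+1%:Z + 1 = n.+2%:Z) //; lia.
- have -> : E p n.+2%:Z = childR e.
    by apply: (edge_eq _ _ _ _ hz); rewrite hm; right.
  split => //; exists (init_pt e); last exact: left_third_childR.
  by right.
- have : E p n.+2%:Z = E p n%:Z.
    by apply: (edge_eq _ _ _ _ hz); rewrite (left_third_inj e z y).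
  by move/E_inj; lia.
Qed.

Lemma E_childR p (n : nat) : E p n.+2%:Z = childR (E p n.+1%:Z).
Proof.
have [h1 [y hy ly]] := E_pos p n.
have [||z hz [hm|hl]] := fan_third p (E p n.+1%:Z) (E p n.+2%:Z) (E_fan _ _) (E_fan _ _).
- by move/E_inj; lia.
- by have := E_adj p n.+1%:Z; rewrite (_ : n.+1%:Z + 1 = n.+2%:Z) //; lia.
- by apply: (edge_eq _ _ _ _ hz); rewrite hm; right.
- have : E p n.+2%:Z = E p n%:Z.
    by apply: (edge_eq _ _ _ _ hz); rewrite (left_third_inj _ z y hl ly).
  by move/E_inj; lia.
Qed.

Lemma E_neg p (n : nat) : init_pt (E p (- n%:Z)) = p /\
  exists2 z, has_endpoints (E p (1 - n%:Z)) p z & left_third (E p (- n%:Z)) z.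
Proof.
elim: n => [|n [IH1 [y hy ly]]].
  rewrite oppr0 subr0.
  case: (E_enum p) => _ _ h0 h1; split => //.
  have [||z hz [hm|]] := fan_third p (E p 0) (E p 1) (E_fan _ _) (E_fan _ _).
  - by move/E_inj.
  - exact: (E_adj p 0).
  - exfalso; have e0 : E p 1 = childL (E p 0).
      by apply: (edge_eq _ _ _ _ hz); rewrite hm; left.
    by apply: (edge_neq (E p 1)); rewrite h1 e0; exact: h0.
  - by exists z.
set e := E p (- n%:Z) in IH1 ly *.
have [||z hz [hm|hl]] := fan_third p e (E p (- n.+1%:Z)) (E_fan _ _) (E_fan _ _).
- by move/E_inj; lia.
- by apply: adjacent_sym; have := E_adj p (- n.+1%:Z);
    rewrite (_ : - n.+1%:Z + 1 = - n%:Z) //; lia.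
- have -> : E p (- n.+1%:Z) = childL e.
    by apply: (edge_eq _ _ _ _ hz); rewrite hm; left.
  rewrite (_ : 1 - n.+1%:Z = - n%:Z); last lia.
  split => //; exists (term_pt e); last exact: left_third_childL.
  by left.
- have : E p (- n.+1%:Z) = E p (1 - n%:Z).
    by apply: (edge_eq _ _ _ _ hz); rewrite (left_third_inj e z y).
  by move/E_inj; lia.
Qed.

Lemma E_childL p (n : nat) : E p (- n.+1%:Z) = childL (E p (- n%:Z)).
Proof.
have [h1 [y hy ly]] := E_neg p n.
have [||z hz [hm|hl]] := fan_third p (E p (- n%:Z)) (E p (- n.+1%:Z)) (E_fan _ _) (E_fan _ _).
- by move/E_inj; lia.
- by apply: adjacent_sym; have := E_adj p (- n.+1%:Z);
    rewrite (_ : - n.+1%:Z + 1 = - n%:Z) //; lia.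
- by apply: (edge_eq _ _ _ _ hz); rewrite hm; left.
- have : E p (- n.+1%:Z) = E p (1 - n%:Z).
    by apply: (edge_eq _ _ _ _ hz); rewrite (left_third_inj _ z y hl ly).
  by move/E_inj; lia.
Qed.

Lemma E_iterR p (n : nat) : E p n.+1%:Z = iter n childR (E p 1).
Proof. by elim: n => [//|n IH]; rewrite E_childR IH. Qed.

Lemma E_iterL p (n : nat) : E p (- n%:Z) = iter n childL (E p 0).
Proof. by elim: n => [//|n IH]; rewrite E_childL IH. Qed.

(** The numbers from 2 on belong to right children and the numbers up to 0 to edges that begin at p,
    which leaves the number 1. *)
Lemma E1_eq p e : term_pt e = p -> (forall f, e <> childR f) -> E p 1 = e.
Proof.
move=> h ne; have [[n|n] hn] := @E_surj p e (or_intror h).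
- case: n hn => [|[|n]] hn //.
  + exfalso; apply: (edge_neq e); rewrite h -hn.
    by case: (E_enum p).
  + by exfalso; apply: (ne (E p n.+1%:Z)); rewrite -E_childR.
- exfalso; apply: (edge_neq e); rewrite h -hn NegzE.
  by case: (E_neg p n.+1).
Qed.

Lemma E0_eq p e : init_pt e = p -> (forall f, e <> childL f) -> E p 0 = e.
Proof.
move=> h ne; have [[n|n] hn] := @E_surj p e (or_introl h).
- case: n hn => [|n] hn //.
  exfalso; apply: (edge_neq e); rewrite h -hn.
  by case: (E_pos p n).
- by exfalso; apply: (ne (E p (- n%:Z))); rewrite -hn NegzE E_childL.
Qed.

(* In the fan of the mediant of e the orientation changes between the two sides
   of the triangle below e, which therefore carry the numbers 0 and 1. *)
Lemma E1_mid e : E (Some (mid e)) 1 = childL e.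
Proof.
apply: E1_eq => // f hf.
have := f_equal ea hf; have := f_equal eb hf; have := f_equal ec hf; have := f_equal ed hf.
rewrite !childLE !childRE.
have := edge_det e; have := edge_det f; have := edge_oo_r e; have := edge_oo_l f.
have := eb_ge0 e; have := ed_ge0 e; have := eb_ge0 f; have := ed_ge0 f.
have := ec_oo e; have := ea_oo f.
move: (ea e) (eb e) (ec e) (ed e) (ea f) (eb f) (ec f) (ed f) => a b c d a' b' c' d'.
move=> hc' hc h1 h2 h3 h4 h5 h6 h7 h8 h9 h10 h11 h12.
(* Comparing denominators gives b' + d = 0. So e ends and f begins at oo; then [edge_oo_r] asks for
   a >= 1 and [edge_oo_l] for a <= -1. *)
have d0 : d = 0 by lia. have b0 : b' = 0 by lia.
have := hc d0; have := hc' b0; have := h5 b0; have := h6 d0. lia.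
Qed.

Lemma E0_mid e : E (Some (mid e)) 0 = childR e.
Proof.
apply: E0_eq => // f hf.
have := f_equal ea hf; have := f_equal eb hf; have := f_equal ec hf; have := f_equal ed hf.
rewrite !childLE !childRE.
have := edge_det e; have := edge_det f; have := edge_oo_l e; have := edge_oo_r f.
have := eb_ge0 e; have := ed_ge0 e; have := eb_ge0 f; have := ed_ge0 f.
have := ea_oo e; have := ec_oo f.
move: (ea e) (eb e) (ec e) (ed e) (ea f) (eb f) (ec f) (ed f) => a b c d a' b' c' d'.
move=> hc' hc h1 h2 h3 h4 h5 h6 h7 h8 h9 h10 h11 h12.
have d0 : b = 0 by lia. have b0 : d' = 0 by lia.
have := hc d0; have := hc' b0; have := h5 b0; have := h6 d0. lia.
Qed.

Lemma edge_oo0_cond : farey_neighbours None (Some 0) && Delta0_on_left None (Some 0).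
Proof. by []. Qed.
Lemma edge_01_cond : farey_neighbours (Some 0) (Some 1) && Delta0_on_left (Some 0) (Some 1).
Proof. by []. Qed.
Lemma edge_1oo_cond : farey_neighbours (Some 1) None && Delta0_on_left (Some 1) None.
Proof. by []. Qed.
Definition edge_oo0 : edge := exist _ (None, Some 0) edge_oo0_cond.
Definition edge_01 : edge := exist _ (Some 0, Some 1) edge_01_cond.
Definition edge_1oo : edge := exist _ (Some 1, None) edge_1oo_cond.

(** The sides of Delta_0 are the roots of the forest of edges under [childL] and [childR]; hence
    they carry the numbers 0 and 1 in the fans of 0, 1 and oo. *)
Lemma Delta0_edge_root e f : e \in [:: edge_oo0; edge_01; edge_1oo] ->
   e <> childL f /\ e <> childR f.
Proof.
move=> he.
have := edge_det f; have := edge_oo_l f; have := edge_oo_r f.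
have := eb_ge0 f; have := ed_ge0 f.
have := ea_oo f; have := ec_oo f.
rewrite !inE in he => h1 h2 h3 h4 h5 h6 h7.
split=> hf; move: (f_equal ea hf) (f_equal eb hf) (f_equal ec hf) (f_equal ed hf);
  rewrite ?childLE ?childRE {hf};
  case/or3P: he => /eqP ->; rewrite /ea /eb /ec /ed /= ?rat01 -/(ea f) -/(eb f) -/(ec f) -/(ed f);
  lia.
Qed.

Lemma E0_Delta0 e : e \in [:: edge_oo0; edge_01; edge_1oo] -> E (init_pt e) 0 = e.
Proof. by move=> he; apply: E0_eq => // f; case: (Delta0_edge_root e f he). Qed.

Lemma E1_Delta0 e : e \in [:: edge_oo0; edge_01; edge_1oo] -> E (term_pt e) 1 = e.
Proof. by move=> he; apply: E1_eq => // f; case: (Delta0_edge_root e f he). Qed.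

End Fans.

(** The third vertex on the left. With equal denominators the difference of the endpoint vectors has
    denominator 0, which means oo. *)
Definition opp_vertex (e : edge) : Qhat :=
  if eb e == ed e then None else Some ((ea e - ec e)%:Q / (eb e - ed e)%:Q).

Lemma numden_opp e : eb e != ed e ->
  (numq ((ea e - ec e)%:Q / (eb e - ed e)%:Q) = sgz (eb e - ed e) * (ea e - ec e)) *
  (denq ((ea e - ec e)%:Q / (eb e - ed e)%:Q) = `|eb e - ed e|).
Proof.
move=> ne; have cop : coprime `|(ea e - ec e)%R|%N `|(eb e - ed e)%R|%N.
  suff : coprimez (ea e - ec e) (eb e - ed e) by [].
  apply/coprimezP; exists (- ed e, ec e) => /=.
  have := edge_det e; move: (ea e) (eb e) (ec e) (ed e) => a b c d h.
  by rewrite -h; ring.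
split; first by rewrite coprimeq_num // sgr_id.
by rewrite coprimeq_den // subr_eq0 (negbTE ne).
Qed.

(** Makes [shear_function] usable: it supplies a concrete quadrilateral around every edge and
    thereby the value of s there. *)
Lemma common_side_opp e :
  common_side e (opp_vertex e) (init_pt e) (Some (mid e)) (term_pt e).
Proof.
have hm := numq_mid e; have hd := denq_mid e.
have hu := childL_cond e; have hv := childR_cond e.
have m0 := mid_den_gt0 e.
split; first by left.
- case/andP: (valP e); rewrite -/(init_pt e) -/(term_pt e) => h _.
  rewrite /farey_triangle h andTb; clear h.
  rewrite farey_sym farey_lnum -/(ea e) -/(eb e).
  rewrite [X in _ && X]farey_sym /farey_neighbours -/(ec e) -/(ed e).
  rewrite /opp_vertex; case: ifP => [/eqP|/negbT] bd /=.
    move: (edge_det e) m0; rewrite bd.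
    move: (ea e) (eb e) (ec e) (ed e) => a b c d h h'. have d0 : 0 < d by lia. have ca : 1 <= c - a by nia. have d1 : d = 1 by nia. by subst d; apply/andP; split; lia.
  rewrite !(numden_opp e bd).
  move: bd; have := edge_det e; clear.
  move: (ea e) (eb e) (ec e) (ed e) => a b c d h bd.
  case: (ltrgtP (b - d) 0) => hs; last by lia.
    rewrite (ltr0_sgz hs) (ltr0_norm hs); apply/andP; split; lia.
  rewrite (gtr0_sgz hs) (gtr0_norm hs); apply/andP; split; lia.
- case/andP: hu => hu _; case/andP: hv => hv _.
  case/andP: (valP e); rewrite -/(init_pt e) -/(term_pt e) => h _.
  by rewrite /farey_triangle hu hv h.
(* With oo read as 1/0 the order is a single comparison of cross products, also at oo. *)
have Lt (x y : Qhat) : Qlt x y = (Qnum x * Qden y < Qnum y * Qden x).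
  case: x y => [x|] [y|]; rewrite ?QltE //=; have := denq_gt0.
  - by move=> /(_ x); lia.
  - by move=> /(_ y); lia.
have a1 := ea_oo e; have c1 := ec_oo e; have D := edge_det e.
have ge := eb_ge0 e; have gd := ed_ge0 e.
have Rr := edge_oo_r e; have Ll := edge_oo_l e.
rewrite /ccw4 !Lt /= hm hd -/(ec e) -/(ed e) -/(eb e).
rewrite /opp_vertex; case: ifP => [/eqP|/negbT] bd /=.
- have un : Qnum (init_pt e) = ea e.
    have : 0 < eb e by lia.
    by rewrite /ea /eb; case: (init_pt e).
  rewrite un; move: bd a1 c1 D ge gd m0; clear.
  move: (ea e) (eb e) (ec e) (ed e) => a b c d bd a1 c1 D h h' h''.
  have b0 : 0 < b by lia. have ca : 1 <= c - a by nia. have b1 : b = 1 by nia.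
  by subst d b; apply/or4P; apply: Or42; apply/and3P; split; lia.
- rewrite !(numden_opp e bd).
  have un : eb e = 0 /\ Qnum (init_pt e) = 1 \/ 0 < eb e /\ Qnum (init_pt e) = ea e.
    move: ge; rewrite /ea /eb; case: (init_pt e) => [u|] //= h; last by left.
    by right.
  move: un bd a1 c1 D ge gd m0 Rr Ll; clear.
  move: (ea e) (eb e) (ec e) (ed e) (Qnum _) => a b c d n un bd a1 c1 D h h' h'' Rr Ll.
  case: un => [[b0 ->]|[b0 ->]].
    have := a1 b0; have := Ll b0; subst b => ? ?; subst a.
    have d1 : d = 1 by lia. subst d.
    by apply/or4P; apply: Or43; rewrite ?ltr0_sgz //; apply/and3P; split; lia.
  case: (ltrgtP (b - d) 0) => hs; last by lia.
    rewrite (ltr0_sgz hs) ltr0_norm //.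
    by apply/or4P; apply: Or42; apply/and3P; split; lia.
  rewrite (gtr0_sgz hs) gtr0_norm //.
  by apply/or4P; apply: Or41; apply/and3P; split; lia.
Qed.

(** * Quadratic interpolation along chains of edges *)

Section Interpolation.
Variable R : realType.
Implicit Types (e f g : edge) (V W : R -> R) (x xi : R).

(** Up to sign, [al] and [be] are the determinants of the vector (xi, 1) with the terminal and the
    initial vector of e. They vanish at these endpoints and satisfy
    [eb e * al e xi + ed e * be e xi = 1]. *)
Definition al e xi : R := (ec e)%:~R - (ed e)%:~R * xi.
Definition be e xi : R := (eb e)%:~R * xi - (ea e)%:~R.
(* The open arc of R cut off by e on the side away from Delta_0. *)
Definition gap e xi : bool := (0 < al e xi) && (0 < be e xi).

(* The homogeneous form of degree 2 of V at the vector (n, d); it is 0 at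
   (n, 0) because division by 0 gives 0. *)
Definition lam V (n d : int) : R := d%:~R ^+ 2 * V (n%:~R / d%:~R).

(* The quadratic vector fields that agree with V at the endpoints of e and at the
   third vertex of the triangle on the right, resp. left, of e. *)
Definition Qr V e xi : R :=
  let (u, v) := (lam V (ea e) (eb e), lam V (ec e) (ed e)) in
  u * al e xi ^+ 2 + v * be e xi ^+ 2
  + (lam V (ea e + ec e) (eb e + ed e) - u - v) * (al e xi * be e xi).

Definition Ql V e xi : R :=
  let (u, v) := (lam V (ea e) (eb e), lam V (ec e) (ed e)) in
  u * al e xi ^+ 2 + v * be e xi ^+ 2
  - (lam V (ea e - ec e) (eb e - ed e) - u - v) * (al e xi * be e xi).

Lemma lamN V n d : lam V (- n) (- d) = lam V n d.
Proof. by rewrite /lam !rmorphN /= sqrrN invrN mulrNN. Qed.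

Lemma ratrE (q : rat) : ratr q = (numq q)%:~R / (denq q)%:~R :> R.
Proof. by []. Qed.

Lemma edge_oo_r1 e : ed e = 0 -> eb e = 1.
Proof.
move=> d0; have := edge_det e; rewrite d0 (ec_oo e d0); lia.
Qed.

Lemma edge_oo_l1 e : eb e = 0 -> ed e = 1.
Proof.
move=> d0; have := edge_det e; rewrite d0 (ea_oo e d0); lia.
Qed.

Lemma edge_detR e : (eb e)%:~R * (ec e)%:~R - (ea e)%:~R * (ed e)%:~R = 1 :> R.
Proof. by rewrite -!rmorphM -rmorphB /= edge_det. Qed.

(** A finite edge has length 1/(b d), so dividing by u - v just clears the denominators of (x - u)(x
    - v). The resulting product also covers the edges at oo. *)
Lemma elementary_fieldE e xi :
  elementary_field e xi = if gap e xi then al e xi * be e xi else 0.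
Proof.
have := edge_detR e; have := edge_oo_r1 e; have := edge_oo_l1 e.
rewrite /elementary_field /gap /al /be /ea /eb /ec /ed.
case: (init_pt e) (term_pt e) => [u|] [v|] /=.
- move=> _ _; rewrite !ratrE; have := denq_gt0 u; have := denq_gt0 v.
  rewrite -!(ltr0z R).
  move: (numq u)%:~R (denq u)%:~R (numq v)%:~R (denq v)%:~R => a b c d hd hb h.
  have b0 : b != 0 by rewrite gt_eqF. have d0 : d != 0 by rewrite gt_eqF.
  rewrite ltr_pdivrMr // ltr_pdivlMr // !subr_gt0 [xi * b]mulrC [xi * d]mulrC andbC.
  case: ifP => // _.
  have -> : a / b - c / d = - (b * d)^-1.
    have -> : a / b - c / d = - (b * c - a * d) / (b * d) by field; rewrite b0 d0.
    by rewrite h; field; rewrite ?b0 ?d0.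
  by field; rewrite ?b0 ?d0.
- move=> _ /(_ erefl) b1 _.
  by rewrite mul0r subr0 ltr01 /= ratrE b1 divr1 !mul1r subr_gt0.
- move=> /(_ erefl) b1 _ _.
  rewrite mul0r rmorphN /= opprK add0r ltr01 andbT /= ratrE b1 divr1 !mul1r mulr1 subr_gt0.
  by rewrite opprB.
- by move=> /(_ erefl).
Qed.

(** Farey neighbours differ by 1/(b d) up to sign, so the division becomes a multiplication by both
    denominators. At oo a denominator 0 reproduces the omitted term. *)
Lemma diff_quotient_nbr V (x y : Qhat) : farey_neighbours x y ->
  diff_quotient V x y = ((Qnum x * Qden y - Qnum y * Qden x) * Qden x * Qden y)%:~R *
    (V ((Qnum x)%:~R / (Qden x)%:~R) - V ((Qnum y)%:~R / (Qden y)%:~R)) :> R.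
Proof.
rewrite /farey_neighbours /diff_quotient; case: x y => [x|] [y|] /=; last first.
- by rewrite !mulr0 mul0r.
- by rewrite !mulr0 !mul0r.
- by rewrite !mulr0 mul0r.
rewrite -!ratrE => h; move: (V _) (V _) => A B; rewrite !ratrE.
have hx : (denq x)%:~R != 0 :> R by rewrite intr_eq0 denq_eq0.
have hy : (denq y)%:~R != 0 :> R by rewrite intr_eq0 denq_eq0.
rewrite (_ : (numq x)%:~R / _ - _ =
  (numq x * denq y - numq y * denq x)%:~R / ((denq x)%:~R * (denq y)%:~R)); last first.
  by rewrite rmorphB !rmorphM /=; field; rewrite hx hy.
set D := numq x * denq y - _ in h *.
have [->|->] : D = 1 \/ D = -1 by move: h; move: D => D; lia.
all: rewrite !rmorphM /=; by field; rewrite hx hy.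
Qed.

Definition lam_shear V e : R :=
  lam V (ea e + ec e) (eb e + ed e) + lam V (ea e - ec e) (eb e - ed e)
  - 2 * lam V (ea e) (eb e) - 2 * lam V (ec e) (ed e).

(** Collecting the four values of V gives the coefficients (b + d)^2, (b - d)^2, -2 b^2 and -2 d^2.
    A vertex at oo gets the coefficient 0, in agreement with the omission of its terms. *)
Lemma inf_shear_opp V e :
  inf_shear V (opp_vertex e) (init_pt e) (Some (mid e)) (term_pt e) = lam_shear V e.
Proof.
have [_ tri1 tri2 _] := common_side_opp e.
case/and3P: tri1 => n1 n2 n3; case/and3P: tri2 => n4 n5 n6.
rewrite farey_sym in n1; rewrite farey_sym in n3.
rewrite farey_sym in n4; rewrite farey_sym in n5.
rewrite /inf_shear !diff_quotient_nbr // /lam_shear.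
rewrite -/(ec e) -/(eb e) -/(ed e) /= numq_mid denq_mid.
have [k k1 [wn wd]] : exists2 k : int, k ^+ 2 = 1 &
  Qnum (opp_vertex e) = k * (ea e - ec e) /\ Qden (opp_vertex e) = k * (eb e - ed e).
  rewrite /opp_vertex; case: ifP => [/eqP|/negbT] bd /=.
    have b0 : 0 < eb e by have := mid_den_gt0 e; lia.
    have := edge_det e; rewrite -bd => D.
    have ca : 1 <= ec e - ea e by nia. have b1 : eb e = 1 by nia.
    by exists (-1) => //; rewrite b1 in D *; split; lia.
  exists (sgz (eb e - ed e)); first by rewrite sqr_sg subr_eq0 bd.
  by rewrite !(numden_opp e bd) -normrEsg.
have DR := edge_detR e.
have -> : V ((Qnum (opp_vertex e))%:~R / (Qden (opp_vertex e))%:~R) =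
   V ((ea e - ec e)%:~R / (eb e - ed e)%:~R).
  rewrite wn wd !rmorphM /= -mulf_div divff ?mul1r // intr_eq0.
  by apply/eqP => k0; rewrite k0 in k1.
have kk : k%:~R ^+ 2 = 1 :> R by rewrite -rmorphXn /= k1.
(* If e begins at oo, [Qnum] and [ea] are 1 and -1, but the quotients at that point carry the factor
   [eb e = 0]. *)
have un : Qnum (init_pt e) = ea e \/ eb e = 0.
  by rewrite /ea /eb; case: (init_pt e); auto.
rewrite /lam wn wd.
case: un => un.
  rewrite un; move: kk DR; rewrite !(rmorphM, rmorphB, rmorphD) /=.
  move: (V _) (V _) (V _) (V _) => A B C D.
  move: (ea e)%:~R (eb e)%:~R (ec e)%:~R (ed e)%:~R k%:~R => a b c d k' kk DR.
  transitivity ((b * c - a * d) * ((b + d) * b * (D - C) + k' ^+ 2 * (d * (b - d) * (B - A))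
    - k' ^+ 2 * (b * (b - d) * (C - A)) - (b + d) * d * (B - D))); first by ring.
  by rewrite DR kk; ring.
move: kk DR; rewrite un !(rmorphM, rmorphB, rmorphD) /= mulr0z.
move: (V _) (V _) (V _) (V _) (V _) => A0 A B C D.
move: (ea e)%:~R (ec e)%:~R (ed e)%:~R k%:~R (Qnum _)%:~R => a c d k' n kk DR.
transitivity ((0 * c - a * d) * (k' ^+ 2 * (d * (0 - d) * (B - A)) - d * d * (B - D)));
  first by ring.
by rewrite DR kk; ring.
Qed.

Lemma gap_childL e xi : gap (childL e) xi = (be e xi < al e xi) && (0 < be e xi).
Proof.
rewrite /gap /al /be !childLE; congr andb.
by rewrite !rmorphD /= -[RHS]subr_gt0; congr (_ < _); ring.
Qed.

Lemma gap_childR e xi : gap (childR e) xi = (al e xi < be e xi) && (0 < al e xi).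
Proof.
rewrite /gap andbC /al /be !childRE; congr andb.
by rewrite !rmorphD /= -[RHS]subr_gt0; congr (_ < _); ring.
Qed.

Lemma gap_childL_sub e xi : gap (childL e) xi -> gap e xi.
Proof. by rewrite gap_childL /gap => /andP[h1 h2]; rewrite h2 (lt_trans h2 h1). Qed.

Lemma gap_childR_sub e xi : gap (childR e) xi -> gap e xi.
Proof. by rewrite gap_childR /gap => /andP[h1 h2]; rewrite h2 (lt_trans h2 h1). Qed.

(** The triangle on the left of a child is the triangle on the right of its parent, so both
    quadratics interpolate at the same three points. *)
Lemma Ql_childL V e xi : Ql V (childL e) xi = Qr V e xi.
Proof.
rewrite /Ql /Qr /al /be !childLE.
have -> : ea e - (ea e + ec e) = - ec e by lia.
have -> : eb e - (eb e + ed e) = - ed e by lia.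
rewrite lamN; move: (lam _ _ _) (lam _ _ _) (lam _ _ _) => p q r.
by rewrite !rmorphD /=; ring.
Qed.

Lemma Ql_childR V e xi : Ql V (childR e) xi = Qr V e xi.
Proof.
rewrite /Ql /Qr /al /be !childRE.
have -> : ea e + ec e - ec e = ea e by lia.
have -> : eb e + ed e - ed e = eb e by lia.
move: (lam _ _ _) (lam _ _ _) (lam _ _ _) => p q r.
by rewrite !rmorphD /=; ring.
Qed.

End Interpolation.

(** The terms 1 to N run along the chain of right children of a fan, the N + 1 terms 0 to -N along
    the chain of left children. *)
Lemma symmetric_sumE (R : realType) (f : int -> R) N :
  symmetric_sum f N = \sum_(k < N) f k.+1%:Z + \sum_(k < N.+1) f (- k%:Z).
Proof.
elim: N => [|N IH].
  by rewrite /symmetric_sum double0 big_nat1 big_ord0 big_ord_recl big_ord0 !add0r addr0.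
rewrite [in RHS]big_ord_recr [X in _ + X]big_ord_recr /= addrACA -IH.
rewrite /symmetric_sum doubleS big_nat_recl // big_nat_recr //=.
rewrite (_ : _.+1%:Z - N.+1%:Z = N.+1%:Z); last by lia.
rewrite (_ : 0%:Z - N.+1%:Z = - N.+1%:Z) ?sub0r // [LHS]addrC -[LHS]addrA; congr (_ + _).
by apply: eq_bigr => i _; congr f; lia.
Qed.

(** * Telescoping along one half of a fan *)

Section Chains.
Variable R : realType.
Variables (V : R -> R) (s : edge -> R).
Hypothesis s_shear : shear_function V s.
Implicit Types (e f g : edge) (xi : R) (c : edge -> edge).

Definition bend e xi : R := s e * elementary_field e xi.

(** [Qr] and [Ql] share their square terms; their difference is [lam_shear V e] times the product of
    [al] and [be]. *)
Lemma bendE e xi : bend e xi = if gap R e xi then Qr R V e xi - Ql R V e xi else 0.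
Proof.
rewrite /bend elementary_fieldE; case: ifP => _; last by rewrite mulr0.
rewrite (s_shear _ _ _ _ _ (common_side_opp e)) inf_shear_opp /lam_shear /Qr /Ql.
ring.
Qed.

Definition is_child c := c = childL \/ c = childR.

Lemma gap_child c e xi : is_child c -> gap R (c e) xi -> gap R e xi.
Proof. by case=> ->; [exact: gap_childL_sub|exact: gap_childR_sub]. Qed.

Lemma Ql_child c e xi : is_child c -> Ql R V (c e) xi = Qr R V e xi.
Proof. by case=> ->; [exact: Ql_childL|exact: Ql_childR]. Qed.

Lemma gap_iter_sub c e xi i j : is_child c -> (i <= j)%N ->
  gap R (iter j c e) xi -> gap R (iter i c e) xi.
Proof.
move=> hc /subnK <-; elim: (j - i)%N => [//|k IH]; rewrite addSn /= => h.
by apply: IH; apply: gap_child h.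
Qed.

Lemma iter_childR e xi k :
  (al R (iter k childR e) xi = al R e xi) *
  (be R (iter k childR e) xi = be R e xi - k%:R * al R e xi).
Proof.
elim: k => [|k [IH1 IH2]]; first by rewrite mul0r subr0.
rewrite /=; set f := iter k childR e in IH1 IH2 *.
rewrite -IH1; split; first by rewrite /al !childRE.
transitivity (be R f xi - al R f xi).
  by rewrite /be /al !childRE !rmorphD /=; ring.
by rewrite IH2 -IH1 -natr1; ring.
Qed.

Lemma iter_childL e xi k :
  (be R (iter k childL e) xi = be R e xi) *
  (al R (iter k childL e) xi = al R e xi - k%:R * be R e xi).
Proof.
elim: k => [|k [IH1 IH2]]; first by rewrite mul0r subr0.
rewrite /=; set f := iter k childL e in IH1 IH2 *.
rewrite -IH1; split; first by rewrite /be !childLE.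
transitivity (al R f xi - be R f xi).
  by rewrite /be /al !childLE !rmorphD /=; ring.
by rewrite IH2 -IH1 -natr1; ring.
Qed.

(** Each right child lowers [be] by the fixed amount [al e xi], each left child lowers [al] by
    [be e xi]; as R is archimedean, the lowered form becomes nonpositive. *)
Lemma chain_escape c e xi : is_child c -> exists j, ~~ gap R (iter j c e) xi.
Proof.
have arch (x y : R) : 0 < y -> exists j : nat, x - j%:R * y <= 0.
  move=> y0; exists (Num.truncn (x / y)).+1; rewrite subr_le0 -ler_pdivrMr //.
  by apply: ltW; exact: truncnS_gt.
case=> ->; rewrite /gap.
- have [b0|b0] := ltP 0 (be R e xi); last first.
    by exists 0%N; rewrite /= andbC ltNge b0.
  have [j hj] := arch (al R e xi) _ b0; exists j.
  by rewrite !iter_childL ltNge hj.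
- have [b0|b0] := ltP 0 (al R e xi); last first.
    by exists 0%N; rewrite /= ltNge b0.
  have [j hj] := arch (be R e xi) _ b0; exists j.
  by rewrite !iter_childR [X in _ && X]ltNge hj andbF.
Qed.

Definition is_last c e xi f :=
  exists j, [/\ f = iter j c e, gap R f xi & ~~ gap R (c f) xi].

Lemma chain_last c e xi : is_child c -> gap R e xi -> exists f, is_last c e xi f.
Proof.
move=> hc he; have [j hj] := chain_escape c e xi hc.
elim: j hj => [|j IH] hj; first by rewrite he in hj.
case: (boolP (gap R (iter j c e) xi)) => [h|]; last exact: IH.
by exists (iter j c e), j.
Qed.

Lemma chain_sum_out c e xi K : is_child c -> ~~ gap R e xi ->
  \sum_(k < K) bend (iter k c e) xi = 0.
Proof.
move=> hc he; apply: big1 => k _; rewrite bendE ifN //.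
by apply: contra he => /(gap_iter_sub c e xi 0 k hc); exact.
Qed.

(* Telescoping: [bend (c f)] is [Qr (c f) - Qr f] by [Ql_child]. *)
Lemma chain_sum_in c e xi K : is_child c -> gap R (iter K c e) xi ->
  \sum_(k < K.+1) bend (iter k c e) xi = Qr R V (iter K c e) xi - Ql R V e xi.
Proof.
move=> hc; elim: K => [|K IH] h; rewrite big_ord_recr /=.
  by rewrite big_ord0 add0r bendE h.
rewrite IH; last exact: (gap_child c).
by rewrite bendE h Ql_child // ; ring.
Qed.

(** Once xi has left the chain, after step j, no term contributes and the sum stays frozen; hence
    [minn j K]. *)
Lemma chain_sum_last c e xi j K : is_child c ->
  gap R (iter j c e) xi -> ~~ gap R (iter j.+1 c e) xi ->
  \sum_(k < K.+1) bend (iter k c e) xi = Qr R V (iter (minn j K) c e) xi - Ql R V e xi.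
Proof.
move=> hc h1 h2; case: (leqP j K) => jK; last first.
  apply: chain_sum_in => //; exact: (gap_iter_sub c e xi K j hc (ltnW jK)).
rewrite -(subnK jK) addnC; elim: (K - j)%N => [|i IH].
  by rewrite addn0; exact: chain_sum_in.
rewrite addnS big_ord_recr /= IH bendE ifN ?addr0 //.
apply: contra h2; apply: (gap_iter_sub c e xi j.+1 (j + i).+1 hc).
by rewrite ltnS leq_addr.
Qed.

Definition side c e xi : R := limn (fun K => \sum_(k < K) bend (iter k c e) xi).

Lemma eventually_const_cvg (u : nat -> R) M l :
  (forall K, (M <= K)%N -> u K = l) -> u @ \oo --> l.
Proof.
move=> h; apply/(@cvgrPdist_le _ R); move=> eps eps0.
near=> K; rewrite h ?subrr ?normr0 ?ltW //.
by near: K; exact: nbhs_infty_ge.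
Unshelve. all: by end_near.
Qed.

Lemma side_cvg_out c e xi : is_child c -> ~~ gap R e xi ->
  side c e xi = 0 /\ (fun K => \sum_(k < K) bend (iter k c e) xi) @ \oo --> side c e xi.
Proof.
move=> hc he.
have H : (fun K => \sum_(k < K) bend (iter k c e) xi) @ \oo --> (0 : R).
  by apply: (@eventually_const_cvg _ 0%N) => K _; exact: chain_sum_out.
by rewrite /side (cvg_lim _ H).
Qed.

Lemma side_cvg_last c e xi f : is_child c -> is_last c e xi f ->
  side c e xi = Qr R V f xi - Ql R V e xi /\
  (fun K => \sum_(k < K) bend (iter k c e) xi) @ \oo --> side c e xi.
Proof.
move=> hc hf.
have H : (fun K => \sum_(k < K) bend (iter k c e) xi) @ \oo -->
    Qr R V f xi - Ql R V e xi.
  have [j [-> h1 h2]] := hf.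
  apply: (@eventually_const_cvg _ j.+1) => -[//|K] jK.
  by rewrite (chain_sum_last c e xi j K hc h1 h2) (minn_idPl _).
by rewrite /side (cvg_lim _ H).
Qed.

End Chains.

(** * Farey levels *)

Section Levels.
Variable R : realType.
Implicit Types (e f g : edge) (x y z p : Qhat) (xi : R) (l : seq Qhat).

Definition farey_arc x xi y : bool :=
  (if x is Some q then ratr q < xi else true) && (if y is Some q then xi < ratr q else true).

Lemma gapE e xi : gap R e xi = farey_arc (init_pt e) xi (term_pt e).
Proof.
have := edge_oo_r1 e; have := edge_oo_l1 e.
rewrite /gap /farey_arc andbC /al /be /ea /eb /ec /ed.
case: (init_pt e) (term_pt e) => [u|] [v|] /=.
- by move=> _ _; rewrite !ratrE ltr_pdivrMr ?ltr_pdivlMr ?ltr0z // !subr_gt0 ![xi * _]mulrC.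
- move=> _ /(_ erefl) b1.
  by rewrite mul0r subr0 ltr01 /= ratrE b1 divr1 !mul1r subr_gt0.
- move=> /(_ erefl) b1 _.
  by rewrite mul0r rmorphN /= opprK add0r ltr01 /= ratrE b1 divr1 !mul1r subr_gt0.
- by move=> /(_ erefl).
Qed.

(** As oo belongs to l, no arc between consecutive points runs through oo, and the cyclic condition
    becomes one on an open interval of the line. *)
Lemma consecutive_arcN l x y (z : rat) : None \in l -> consecutive l x y -> Some z \in l ->
  ~~ farey_arc x (ratr z) y.
Proof.
move=> oo /andP[nxy /allP h] zl.
have := h _ zl; have := h _ oo; rewrite /ccw3 /farey_arc.
case: x y nxy {h zl} => [x|] [y|] nxy //=; rewrite ?ltr_rat ?andbT ?andbF ?orbF ?orFb //.
by rewrite negb_or => _ /andP[].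
Qed.

Lemma consecutive_arc l x y : None \in l -> consecutive l x y -> exists xi, farey_arc x xi y.
Proof.
move=> oo /andP[nxy /allP h].
have := h _ oo; rewrite /ccw3 /farey_arc.
case: x y nxy {h} => [x|] [y|] nxy //=; rewrite ?andbT ?andbF ?orbF ?orFb.
- rewrite -leNgt => xy; exists (ratr ((x + y) / 2)); rewrite !ltr_rat.
  have : x < y by rewrite lt_neqAle xy andbT.
  by move=> ?; apply/andP; split; lra.
- by move=> _; exists (ratr x + 1); rewrite ltrDl ltr01.
- by move=> _; exists (ratr y - 1); rewrite gtrDl oppr_lt0 ltr01.
Qed.

(** If two such arcs share a point but differ at an end, one of these ends lies inside the other
    arc. *)
Lemma consecutive_uniq l x y x' y' xi : None \in l ->
  [/\ x \in l, y \in l, x' \in l & y' \in l] ->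
  consecutive l x y -> consecutive l x' y' -> farey_arc x xi y -> farey_arc x' xi y' ->
  x = x' /\ y = y'.
Proof.
move=> oo [lx ly lx' ly'] h h'.
have L (z : rat) zl := consecutive_arcN l x y z oo h zl.
have L' (z : rat) zl := consecutive_arcN l x' y' z oo h' zl.
rewrite /farey_arc => /andP[a1 a2] /andP[a1' a2']; split.
- case: x x' lx lx' h h' L L' a1 a1' => [x|] [x'|] lx lx' h h' L L' a1 a1' //.
  + case: (ltgtP x x') => [xx|xx|->//].
    * have := L x' lx'; rewrite /farey_arc ltr_rat xx /=.
      by case: y a2 {ly h L} => [y|//] a2; rewrite (lt_trans a1' a2).
    * have := L' x lx; rewrite /farey_arc ltr_rat xx /=.
      by case: y' a2' {ly' h' L'} => [y'|//] a2'; rewrite (lt_trans a1 a2').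
  + have := L' x lx; rewrite /farey_arc /=.
    by case: y' a2' {ly' h' L'} => [y'|//] a2'; rewrite (lt_trans a1 a2').
  + have := L x' lx'; rewrite /farey_arc /=.
    by case: y a2 {ly h L} => [y|//] a2; rewrite (lt_trans a1' a2).
- case: y y' ly ly' h h' L L' a2 a2' => [y|] [y'|] ly ly' h h' L L' a2 a2' //.
  + case: (ltgtP y y') => [xx|xx|->//].
    * have := L' y ly; rewrite /farey_arc ltr_rat xx andbT.
      by case: x' a1' {lx' h' L'} => [x'|//] a1'; rewrite (lt_trans a1' a2).
    * have := L y' ly'; rewrite /farey_arc ltr_rat xx andbT.
      by case: x a1 {lx h L} => [x|//] a1; rewrite (lt_trans a1 a2').
  + have := L' y ly; rewrite /farey_arc andbT.
    by case: x' a1' {lx' h' L'} => [x'|//] a1'; rewrite (lt_trans a1' a2).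
  + have := L y' ly'; rewrite /farey_arc andbT.
    by case: x a1 {lx h L} => [x|//] a1; rewrite (lt_trans a1 a2').
Qed.

Lemma uptoS n : farey_upto n.+3 = farey_next (farey_upto n.+1) (farey_upto n.+2).
Proof. by []. Qed.

Lemma upto_uniq n : uniq (farey_upto n).
Proof. by case: n => [|[|[|n]]] //; rewrite uptoS undup_uniq. Qed.

Lemma upto_subS n : {subset farey_upto n <= farey_upto n.+1}.
Proof.
case: n => [|[|n]] // x; last by rewrite uptoS mem_undup mem_cat => ->.
by rewrite !inE => /orP[]/eqP->.
Qed.

Lemma upto_sub m n : (m <= n)%N -> {subset farey_upto m <= farey_upto n}.
Proof.
move/subnK <-; elim: (n - m)%N => [//|k IH] x hx.
by apply: upto_subS; apply: IH.
Qed.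

Lemma upto_oo n : None \in farey_upto n.+1.
Proof. by apply: (upto_sub 1). Qed.

Lemma upto_new n p : p \in farey_upto n.+3 -> p \notin farey_upto n.+2 ->
  exists x y, [/\ x \in farey_upto n.+2, y \in farey_upto n.+2,
    consecutive (farey_upto n.+2) x y & p = mediant x y].
Proof.
rewrite uptoS mem_undup mem_cat => /orP[->//|].
case/mapP => -[x y]; rewrite mem_filter => /andP[/andP[h _] /allpairsP[[x' y'] [h1 h2]]] [? ?] -> _.
by subst x' y'; exists x, y.
Qed.

Lemma upto_mediant n x y : x \in farey_upto n.+2 -> y \in farey_upto n.+2 ->
  consecutive (farey_upto n.+2) x y -> (x \notin farey_upto n.+1) || (y \notin farey_upto n.+1) ->
  mediant x y \in farey_upto n.+3.
Proof.
move=> hx hy h1 h2; rewrite uptoS mem_undup mem_cat; apply/orP; right.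
apply/mapP; exists (x, y) => //; rewrite mem_filter h1 h2 /=.
by apply/allpairsP; exists (x, y).
Qed.

(* The Farey intervals that are subdivided at the next level. *)
Definition level_gap n e := [/\ init_pt e \in farey_upto n, term_pt e \in farey_upto n,
  consecutive (farey_upto n) (init_pt e) (term_pt e) &
  (init_pt e \notin farey_upto n.-1) || (term_pt e \notin farey_upto n.-1)].

Definition in_level n xi := exists2 q : rat, Some q \in farey_upto n & ratr q = xi.

Definition covered n := forall xi, in_level n xi \/ exists2 e, level_gap n e & gap R e xi.

(** The recursion for the Farey order speaks of consecutive points and not of edges. By covering, a
    point of their arc lies in the gap of an edge of the level, and [consecutive_uniq] identifies
    the endpoints. *)
Lemma level_gap_edge n x y : covered n.+2 -> x \in farey_upto n.+2 -> y \in farey_upto n.+2 ->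
  consecutive (farey_upto n.+2) x y ->
  exists2 e, level_gap n.+2 e & init_pt e = x /\ term_pt e = y.
Proof.
move=> cov hx hy h; have [xi hxi] := consecutive_arc _ _ _ (upto_oo n.+1) h.
have [[q hq qE]|[e he ge]] := cov xi.
  by have := consecutive_arcN _ _ _ _ (upto_oo n.+1) h hq; rewrite qE hxi.
exists e => //; rewrite gapE in ge; have [h1 h2 h3 _] := he.
by have [-> ->] := consecutive_uniq _ _ _ _ _ _ (upto_oo n.+1) (And4 h1 h2 hx hy) h3 h ge hxi.
Qed.

Lemma level_gap_uniq n e f xi : level_gap n.+1 e -> level_gap n.+1 f ->
  gap R e xi -> gap R f xi -> e = f.
Proof.
move=> [h1 h2 h3 _] [h1' h2' h3' _]; rewrite !gapE => g1 g2.
have [] := consecutive_uniq _ _ _ _ _ _ (upto_oo n) (And4 h1 h2 h1' h2') h3 h3' g1 g2.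
exact: edge_inj.
Qed.

Lemma level_gap_out n e (q : rat) : level_gap n.+1 e -> Some q \in farey_upto n.+1 ->
  ~~ gap R e (ratr q).
Proof. by move=> [_ _ h _] hq; rewrite gapE; apply: consecutive_arcN h hq; exact: upto_oo. Qed.

Lemma ratr_mid e : ratr (mid e) = (ea e + ec e)%:~R / (eb e + ed e)%:~R :> R.
Proof. by rewrite ratrE numq_mid denq_mid. Qed.

Lemma al_be_mid e : al R e (ratr (mid e)) = (eb e + ed e)%:~R^-1 /\
  be R e (ratr (mid e)) = (eb e + ed e)%:~R^-1.
Proof.
have m0 : (eb e + ed e)%:~R != 0 :> R by rewrite intr_eq0 gt_eqF ?mid_den_gt0.
have D := edge_detR R e.
rewrite ratr_mid /al /be; move: m0 D; rewrite !rmorphD /=.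
move: (ea e)%:~R (eb e)%:~R (ec e)%:~R (ed e)%:~R => a b c d m0 D.
split; apply: (mulIf m0); rewrite mulVf // -D; by field.
Qed.

Lemma gap_mid e : gap R e (ratr (mid e)).
Proof.
have [h1 h2] := al_be_mid e.
by rewrite /gap h1 h2 invr_gt0 ltr0z mid_den_gt0.
Qed.

Lemma new_point n p : covered n.+2 -> p \in farey_upto n.+3 -> p \notin farey_upto n.+2 ->
  exists2 e, level_gap n.+2 e & p = Some (mid e).
Proof.
move=> cov h1 h2; have [x [y [hx hy hc ->]]] := upto_new n p h1 h2.
have [e he [<- <-]] := level_gap_edge n x y cov hx hy hc.
by exists e => //; rewrite mediant_edge.
Qed.

Lemma mid_new n e : level_gap n.+2 e ->
  Some (mid e) \in farey_upto n.+3 /\ Some (mid e) \notin farey_upto n.+2.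
Proof.
move=> he; split.
  by case: he => h1 h2 h3 h4; rewrite -mediant_edge; apply: upto_mediant.
by apply: contraT; rewrite negbK => h; have := level_gap_out _ _ _ he h; rewrite gap_mid.
Qed.

Lemma consecutive_arcP l x y : x <> y -> (forall z : rat, Some z \in l -> ~~ farey_arc x (ratr z) y) ->
  (if x is Some u then if y is Some v then u < v else true else true) ->
  consecutive l x y.
Proof.
move=> nxy h ord; rewrite /consecutive; apply/andP; split; first exact/eqP.
apply/allP => -[z|] zl; rewrite /ccw3.
- have := h z zl; rewrite /farey_arc; case: x y nxy ord {h} => [x|] [y|] nxy ord //=.
  + by rewrite !ltr_rat (lt_gtF ord) /= orbF andbF orbF.
  + by rewrite !ltr_rat !andbT !orbF.
  + by rewrite !ltr_rat ?andbT ?andbF ?orbF.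
- case: x y nxy ord {h} => [x|] [y|] nxy ord //=.
  by rewrite (lt_gtF ord).
Qed.

(** The only new point in the gap of e is its mediant, an endpoint of both children. So the children
    are consecutive at the next level, and their new endpoint marks them for the next
    subdivision. *)
Lemma level_gap_child n e c : covered n.+2 -> level_gap n.+2 e -> is_child c ->
  level_gap n.+3 (c e).
Proof.
move=> cov he hc.
have [m1 m2] := mid_new n e he; have [h1 h2 h3 h4] := he.
have out (z : rat) : Some z \in farey_upto n.+3 -> ~~ gap R (c e) (ratr z).
  move=> hz; apply/negP => gz; have gz' := gap_child R c e _ hc gz.
  case: (boolP (Some z \in farey_upto n.+2)) => hz2.
    by have := level_gap_out _ _ _ he hz2; rewrite gz'.
  have [f hf [zE]] := new_point n _ cov hz hz2.
  have gf := gap_mid f; rewrite -zE in gf.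
  have ef := level_gap_uniq _ _ _ _ he hf gz' gf; subst f z.
  have [h5 h6] := al_be_mid e.
  by case: hc gz => ->; rewrite ?gap_childL ?gap_childR h5 h6 ltxx.
have ord : if init_pt (c e) is Some u then if term_pt (c e) is Some v then u < v else true else true.
  case/andP: (valP (c e)) => _; rewrite -/(init_pt (c e)) -/(term_pt (c e)).
  have := @edge_det (c e); rewrite /ea /eb /ec /ed.
  case: (init_pt (c e)) (term_pt (c e)) => [u|//] [v|//] /= D _.
  by rewrite ltratE; lia.
split.
- by case: hc => -> //; exact: upto_subS.
- by case: hc => -> //; exact: upto_subS.
- apply: consecutive_arcP; [exact: edge_neq| |].
  by move=> z hz; rewrite -gapE; exact: out.
  by move: ord; case: (init_pt _) => // u; case: (term_pt _).
- by case: hc => ->; rewrite /= m2 ?orbT.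
Qed.

End Levels.

(** * Exhaustion of the rationals by the Farey levels *)

Section Covering.
Variable R : realType.
Implicit Types (e f g : edge) (x y z p : Qhat) (xi : R) (l : seq Qhat).

Lemma mid_oo0 : mid edge_oo0 = -1.
Proof. by []. Qed.

(** Since -1 has order 2, the interval from oo to 0 is already split at its mediant -1, unlike (0,
    1) and (1, oo). *)
Lemma level_gap2 e : e \in [:: childL edge_oo0; childR edge_oo0; edge_01; edge_1oo] ->
  level_gap 2 e.
Proof. by rewrite !inE => /or4P[] /eqP ->; split. Qed.

Lemma covered2 : covered R 2.
Proof.
move=> xi.
have r0 : ratr 0 = 0 :> R by rewrite rmorph0.
have r1 : ratr 1 = 1 :> R by rewrite rmorph1.
have rN1 : ratr (-1) = -1 :> R by rewrite rmorphN rmorph1.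
case: (ltgtP xi 0) => x0; last by left; exists 0; rewrite ?r0 // x0.
  case: (ltgtP xi (-1)) => x1; last by left; exists (-1); rewrite ?rN1 // x1.
    right; exists (childL edge_oo0); first by apply: level_gap2; rewrite !inE eqxx.
    by rewrite gapE /farey_arc /= mid_oo0 rN1.
  right; exists (childR edge_oo0); first by apply: level_gap2; rewrite !inE eqxx ?orbT.
  by rewrite gapE /farey_arc /= mid_oo0 rN1 r0 x1.
case: (ltgtP xi 1) => x1; last by left; exists 1; rewrite ?r1 // x1.
  right; exists edge_01; first by apply: level_gap2; rewrite !inE eqxx ?orbT.
  by rewrite gapE /farey_arc /= r0 r1 x0.
right; exists edge_1oo; first by apply: level_gap2; rewrite !inE eqxx ?orbT.
by rewrite gapE /farey_arc /= r1 x1.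
Qed.

Lemma gap_cases e xi : gap R e xi ->
  [\/ xi = ratr (mid e), gap R (childL e) xi | gap R (childR e) xi].
Proof.
move=> /andP[h1 h2]; rewrite gap_childL gap_childR h1 h2 !andbT.
case: (ltgtP (al R e xi) (be R e xi)) => h; [by apply: Or33|by apply: Or32|apply: Or31].
have m0 : (eb e + ed e)%:~R != 0 :> R by rewrite intr_eq0 gt_eqF // mid_den_gt0.
rewrite ratr_mid; apply: (mulIf m0); rewrite mulfVK //.
move: h; rewrite /al /be !rmorphD /= => h; rewrite mulrDr ![xi * _]mulrC; lra.
Qed.

Lemma in_level_sub m n xi : (m <= n)%N -> in_level R m xi -> in_level R n xi.
Proof. by move=> mn [q hq <-]; exists q => //; apply: upto_sub hq. Qed.

Lemma covered_all n : covered R n.+2.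
Proof.
elim: n => [|n IH]; first exact: covered2.
move=> xi; case: (IH xi) => [h|[e he ge]]; first by left; apply: in_level_sub h.
case: (gap_cases e xi ge) => h.
- by left; exists (mid e) => //; case: (mid_new R _ _ he).
- by right; exists (childL e) => //; apply: (level_gap_child R) => //; left.
- by right; exists (childR e) => //; apply: (level_gap_child R) => //; right.
Qed.

(** The mediant of e is the test point. No point of level n + 3 lies in the gap of e, so the mediant
    lies in a child of some gap f of level n + 2, and by uniqueness this child is e. *)
Lemma level_gap_parent n e : level_gap n.+3 e ->
  exists f c, [/\ level_gap n.+2 f, is_child c & e = c f].
Proof.
move=> he; have ge := gap_mid R e.
case: (covered_all n (ratr (mid e))) => [[q hq qE]|[f hf gf]].
  have := level_gap_out R _ _ _ he (upto_subS _ _ hq).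
  by rewrite qE ge.
have key c : is_child c -> gap R (c f) (ratr (mid e)) ->
    exists f c, [/\ level_gap n.+2 f, is_child c & e = c f].
  move=> hc gc; exists f, c; split=> //.
  exact: (level_gap_uniq R _ _ _ _ he (level_gap_child R _ _ _ (covered_all n) hf hc) ge gc).
case: (gap_cases f _ gf) => h.
- have [m1 _] := mid_new R n f hf.
  by have := level_gap_out R _ _ _ he m1; rewrite -h ge.
- by apply: key h; left.
- by apply: key h; right.
Qed.

(* It grows along the Farey tree and bounds the height of the rationals in [gap e]
   from below, whence every rational appears at a finite level. *)
Definition edge_size e : int := eb e + ed e + `|ea e| + `|ec e|.

Lemma edge_sign e : (0 <= ea e /\ 0 <= ec e) \/ (ea e <= 0 /\ ec e <= 0).
Proof.
have := edge_det e; have := edge_oo_r e; have := edge_oo_l e.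
have := eb_ge0 e; have := ed_ge0 e; have := ea_oo e; have := ec_oo e.
move: (ea e) (eb e) (ec e) (ed e) => a b c d c1 a1 d0 b0 cl ar D.
case: (ltrgtP b 0) => hb; [lia| |]; last by right; have := a1 hb; have := cl hb; lia.
case: (ltrgtP d 0) => hd; [lia| |]; last by left; have := c1 hd; have := ar hd; lia.
case: (lerP 0 a) => ha; case: (lerP 0 c) => hc; [by left| | |right; lia].
- right; split; last lia. nia.
- case: (lerP c 0) => hc'; [right; lia|]. nia.
Qed.

(** The two numerators of an edge have the same sign, so sizes add like vectors, and a child gains
    the size of a nonzero endpoint vector. *)
Lemma edge_size_child e c : is_child c -> edge_size e + 1 <= edge_size (c e).
Proof.
have := edge_det e; have := eb_ge0 e; have := ed_ge0 e; have := edge_sign e.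
rewrite /edge_size => sg d0 b0 D.
by case=> ->; rewrite ?childLE ?childRE; move: sg d0 b0 D;
  move: (ea e) (eb e) (ec e) (ed e) => a b c' d sg d0 b0 D;
  [have : (0 < b) || (a != 0)|have : (0 < d) || (c' != 0)]; lia.
Qed.

Lemma level_gap_size n e : level_gap n.+2 e -> n%:Z <= edge_size e.
Proof.
elim: n e => [|n IH] e he.
  have := eb_ge0 e; have := ed_ge0 e; rewrite /edge_size; lia.
have [f [c [hf hc ->]]] := level_gap_parent n e he.
have := IH f hf; have := edge_size_child f c hc; lia.
Qed.

(** The vector of q is p u + r v with integers p, r >= 1, hence at least as large as u + v. *)
Lemma gap_rat_size e (q : rat) : gap R e (ratr q) -> edge_size e <= denq q + `|numq q|.
Proof.
have q0 : 0 < (denq q)%:~R :> R by rewrite ltr0z denq_gt0.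
rewrite /gap -(pmulr_lgt0 _ q0) -[X in _ && X](pmulr_lgt0 _ q0) /al /be ratrE !mulrBl.
rewrite -!mulrA mulVf ?gt_eqF // mulr1 -!rmorphM -!rmorphB /= !ltr0z.
have := edge_det e; have := eb_ge0 e; have := ed_ge0 e; have := edge_sign e.
rewrite /edge_size.
move: (ea e) (eb e) (ec e) (ed e) (numq q) (denq q) => a b c d n m sg d0 b0 D /andP[h1 h2].
set p := c * m - d * n in h1; set r := b * n - a * m in h2.
have -> : m = p * b + r * d by rewrite -[LHS]mulr1 -D /p /r; ring.
have -> : n = p * a + r * c by rewrite -[LHS]mulr1 -D /p /r; ring.
have h3 : b <= p * b by nia. have h4 : d <= r * d by nia.
case: sg => -[s1 s2].
- have h5 : a <= p * a by nia. have h6 : c <= r * c by nia. lia.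
- have h5 : p * a <= a by nia. have h6 : r * c <= c by nia. lia.
Qed.

Lemma upto_rat (q : rat) : exists k, forall n, (k <= n)%N -> Some q \in farey_upto n.+2.
Proof.
exists (absz (denq q + `|numq q|)).+1 => n hn.
case: (covered_all n (ratr q)) => [[q' hq' /fmorph_inj <-]|[e he ge]] //.
have := level_gap_size n e he; have := gap_rat_size e q ge; lia.
Qed.

End Covering.

Lemma sum_supp (R : realType) (I : eqType) (r t : seq I) (f : I -> R) : uniq r -> uniq t ->
  {subset t <= r} -> (forall x, x \in r -> x \notin t -> f x = 0) ->
  \sum_(x <- r) f x = \sum_(x <- t) f x.
Proof.
move=> ur ut sub h; rewrite (bigID (mem t)) /= [X in _ + X]big1_seq ?addr0; last first.
  by move=> x /andP[xt xr]; apply: h.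
rewrite -big_filter; apply: perm_big; apply: uniq_perm => //; first exact: filter_uniq.
move=> x; rewrite mem_filter andb_idr //; exact: sub.
Qed.

(** * Sums over the fans of bounded order *)

Section Sums.
Variable R : realType.
Variables (V : R -> R) (s : edge -> R).
Hypothesis s_shear : shear_function V s.
Hypotheses (V0 : V 0 = 0) (V1 : V 1 = 0).
Variable (E : Qhat -> int -> edge).
Hypothesis E_enum : fan_enumeration E.
Implicit Types (e f g : edge) (xi : R) (c : edge -> edge).

Let bend := bend R s.
Let side := side R s.
Let Q := Qr R V.

(* Twice the contribution of the fan of p, since [bend] uses [s] and not [s / 2]. *)
Definition fan_sum (p : Qhat) xi : R := side childR (E p 1) xi + side childL (E p 0) xi.

Lemma fan_sum_cvg p xi :
  symmetric_sum (fun n => bend (E p n) xi) @ \oo --> fan_sum p xi.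
Proof.
have side_cvg c e : is_child c -> (fun K => \sum_(k < K) bend (iter k c e) xi) @ \oo --> side c e xi.
  move=> hc; case: (boolP (gap R e xi)) => h.
    have [f hf] := chain_last R c e xi hc h.
    by have [] := side_cvg_last R V s s_shear c e xi f hc hf.
  by have [] := side_cvg_out R V s s_shear c e xi hc h.
rewrite (_ : symmetric_sum _ = fun M => \sum_(k < M) bend (iter k childR (E p 1)) xi
   + \sum_(k < M.+1) bend (iter k childL (E p 0)) xi).
  apply: cvgD; first by apply: side_cvg; right.
  by rewrite (cvg_shiftS (fun K => \sum_(k < K) bend (iter k childL (E p 0)) xi)); apply: side_cvg; left.
apply/funext => M; rewrite symmetric_sumE; congr (_ + _); apply: eq_bigr => k _.
  by rewrite (E_iterR _ E_enum).
by rewrite (E_iterL _ E_enum).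
Qed.

Definition level_sum n xi : R := farey_sum (fun p => fan_sum p xi) n.

Lemma side_out c e xi : is_child c -> ~~ gap R e xi -> side c e xi = 0.
Proof. by move=> hc h; have [] := side_cvg_out R V s s_shear c e xi hc h. Qed.

Lemma side_last c e xi f : is_child c -> is_last R c e xi f ->
  side c e xi = Q f xi - Ql R V e xi.
Proof. by move=> hc h; have [] := side_cvg_last R V s s_shear c e xi f hc h. Qed.

(** Both chains of this fan start at children of e, so the whole fan lives in the gap of e. *)
Lemma fan_sum_mid e xi :
  fan_sum (Some (mid e)) xi = side childR (childL e) xi + side childL (childR e) xi.
Proof. by rewrite /fan_sum E1_mid // E0_mid. Qed.

Lemma fan_sum_mid_out e xi : ~~ gap R e xi -> fan_sum (Some (mid e)) xi = 0.
Proof.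
move=> h; rewrite fan_sum_mid !side_out ?addr0 //; try by [left|right].
- by apply: contra h; exact: gap_childR_sub.
- by apply: contra h; exact: gap_childL_sub.
Qed.

Lemma level_sum_old n xi : in_level R n.+2 xi -> level_sum n.+3 xi = level_sum n.+2 xi.
Proof.
move=> [q hq qE]; apply: sum_supp; rewrite ?upto_uniq //; first exact: upto_subS.
move=> p h1 h2; have [e he ->] := new_point R n p (covered_all R n) h1 h2.
by apply: fan_sum_mid_out; rewrite -qE; exact: level_gap_out he hq.
Qed.

Lemma level_sum_new n e xi : level_gap n.+2 e -> gap R e xi ->
  level_sum n.+3 xi = level_sum n.+2 xi + fan_sum (Some (mid e)) xi.
Proof.
move=> he ge; have [m1 m2] := mid_new R n e he.
transitivity (\sum_(p <- Some (mid e) :: farey_upto n.+2) fan_sum p xi);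
  last by rewrite big_cons addrC.
apply: sum_supp; first exact: upto_uniq.
- by rewrite cons_uniq m2; exact: upto_uniq.
- by move=> p; rewrite inE => /orP[/eqP->//|]; exact: upto_subS.
move=> p h1; rewrite inE negb_or => /andP[pe h2].
have [f hf pE] := new_point R n p (covered_all R n) h1 h2; subst p.
apply: fan_sum_mid_out; apply: contra pe => gf.
by rewrite (level_gap_uniq R _ _ _ _ he hf ge gf).
Qed.

Lemma Qr_mid e : Q e (ratr (mid e)) = V (ratr (mid e)).
Proof.
rewrite /Q /Qr; have [-> ->] := al_be_mid R e.
have m0 : (eb e + ed e)%:~R != 0 :> R by rewrite intr_eq0 gt_eqF // mid_den_gt0.
rewrite [lam _ _ (ea e + ec e) _]/lam ratr_mid; move: (V _) (lam _ _ _ _) (lam _ _ _ _) => A B C.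
by move: m0; move: (_ + _)%:~R => m m0; field.
Qed.

Lemma is_last_self c e xi f : is_child c -> is_last R c e xi f -> ~~ gap R (c e) xi -> f = e.
Proof.
move=> hc [[|j] [-> h1 h2]] h //; exfalso; move/negP: h; apply.
exact: (gap_iter_sub R c e xi 1 j.+1 hc).
Qed.

Lemma is_last_child c e xi f : is_last R c e xi f -> gap R (c e) xi -> is_last R c (c e) xi f.
Proof.
move=> [[|j] [-> h1 h2]] h; first by rewrite h in h2.
by exists j; rewrite -iterSr.
Qed.

Lemma gapL_N e xi : gap R (childL e) xi -> ~~ gap R (childR e) xi.
Proof. by rewrite gap_childL gap_childR => /andP[h _]; rewrite (lt_gtF h). Qed.

Lemma gapR_N e xi : gap R (childR e) xi -> ~~ gap R (childL e) xi.
Proof. by rewrite gap_childL gap_childR => /andP[h _]; rewrite (lt_gtF h). Qed.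

Lemma is_last_gap c e xi f : is_child c -> is_last R c e xi f -> gap R e xi.
Proof. by move=> hc [j [-> h _]]; exact: (gap_iter_sub R c e xi 0 j hc). Qed.

(* Twice the sum over the fans of order at most n has this form on an interval e
   of level n; f and g end the chains of the fans of the two endpoints of e. *)
Definition interpolated xi e (X : R) := exists f g,
  [/\ is_last R childL e xi f, is_last R childR e xi g & X = Q f xi + Q g xi].

(** The exchange that drives the induction. If xi enters the left child, the left chain keeps its
    last edge f, whereas the right chain stops at e and contributes [Q e]; the right chain of the
    new fan adds [Q g' - Q e]. So [Q e] is replaced by [Q g']. The right child is symmetric. At the
    mediant both chains stop at e, whose interpolant equals V there. *)
Lemma interpolated_step e xi X : interpolated xi e X ->
  (xi = ratr (mid e) /\ X + fan_sum (Some (mid e)) xi = 2 * V xi) \/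
  exists2 c, is_child c & gap R (c e) xi /\
    interpolated xi (c e) (X + fan_sum (Some (mid e)) xi).
Proof.
have cL : is_child childL by left. have cR : is_child childR by right.
move=> [f [g [hf hg ->]]]; have ge := is_last_gap _ _ _ _ cL hf.
case: (gap_cases R e xi ge) => h.
- left; split => //; have [h1 h2] := al_be_mid R e; rewrite -h in h1 h2.
  have oL : ~~ gap R (childL e) xi by rewrite gap_childL h1 h2 ltxx.
  have oR : ~~ gap R (childR e) xi by rewrite gap_childR h1 h2 ltxx.
  rewrite fan_sum_mid !side_out // !addr0.
  rewrite (is_last_self _ _ _ _ cL hf oL) (is_last_self _ _ _ _ cR hg oR).
  by rewrite h Qr_mid; ring.
- right; exists childL => //; split => //.
  have oR := gapL_N _ _ h.
  have [g' hg'] := chain_last R childR _ xi cR h.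
  exists f, g'; split=> //; first exact: is_last_child.
  rewrite fan_sum_mid [X in _ + (_ + X)]side_out // addr0.
  rewrite (side_last _ _ _ _ cR hg') Ql_childL (is_last_self _ _ _ _ cR hg oR).
  by rewrite /Q; ring.
- right; exists childR => //; split => //.
  have oR := gapR_N _ _ h.
  have [g' hg'] := chain_last R childL _ xi cL h.
  exists g', g; split=> //; first exact: is_last_child.
  rewrite fan_sum_mid [X in _ + (X + _)]side_out // add0r.
  rewrite (side_last _ _ _ _ cL hg') Ql_childR (is_last_self _ _ _ _ cL hf oR).
  by rewrite /Q; ring.
Qed.

Definition side_sum e xi := side childL e xi + side childR e xi.

Lemma side_sum_out e xi : ~~ gap R e xi -> side_sum e xi = 0.
Proof. by move=> h; rewrite /side_sum !side_out ?addr0 //; [right|left]. Qed.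

(** The triangle on the left is Delta_0, and V vanishes at its three vertices; so the normalization
    makes the telescoping start from 0. *)
Lemma Ql_Delta0 e xi : e \in [:: edge_oo0; edge_01; edge_1oo] -> Ql R V e xi = 0.
Proof.
rewrite !inE => /or3P[] /eqP ->; rewrite /Ql /lam /ea /eb /ec /ed /= ?rat01;
 rewrite ?(expr0n, mul0r, mulr0, divr1, sub0r, addr0, add0r, subrr, V0, V1, subr0, oppr0) //.
by rewrite divff ?intr_eq0 // V1 mulr0 mul0r oppr0.
Qed.

Lemma side_sum_Delta0 e xi : e \in [:: edge_oo0; edge_01; edge_1oo] -> gap R e xi ->
  interpolated xi e (side_sum e xi).
Proof.
move=> he ge.
have cL : is_child childL by left. have cR : is_child childR by right.
have [f hf] := chain_last R childL e xi cL ge.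
have [g hg] := chain_last R childR e xi cR ge.
exists f, g; split=> //.
by rewrite /side_sum (side_last _ _ _ _ cL hf) (side_last _ _ _ _ cR hg) Ql_Delta0 // !subr0.
Qed.

(** The six chains at 0, 1 and oo are regrouped by the side of Delta_0 at which they start; -1
    contributes the fan of a mediant. *)
Lemma level_sum2 xi : level_sum 2 xi =
  side_sum edge_oo0 xi + side_sum edge_01 xi + side_sum edge_1oo xi
  + fan_sum (Some (mid edge_oo0)) xi.
Proof.
rewrite /level_sum /farey_sum /= !big_cons big_nil mid_oo0 addr0.
have E0 e : e \in [:: edge_oo0; edge_01; edge_1oo] -> E (init_pt e) 0 = e by exact: E0_Delta0.
have E1 e : e \in [:: edge_oo0; edge_01; edge_1oo] -> E (term_pt e) 1 = e by exact: E1_Delta0.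
rewrite {1 2 3}/fan_sum /side_sum.
rewrite (E1 edge_oo0) ?inE ?eqxx // (E0 edge_01) ?inE ?eqxx ?orbT //.
rewrite (E1 edge_01) ?inE ?eqxx ?orbT // (E0 edge_1oo) ?inE ?eqxx ?orbT //.
rewrite (E1 edge_1oo) ?inE ?eqxx ?orbT // (E0 edge_oo0) ?inE ?eqxx ?orbT //.
ring.
Qed.

Theorem level_sumP n xi : (in_level R n.+2 xi /\ level_sum n.+2 xi = 2 * V xi) \/
  exists e, [/\ level_gap n.+2 e, gap R e xi & interpolated xi e (level_sum n.+2 xi)].
Proof.
elim: n => [|n [[h1 h2]|[e [h1 h2 h3]]]].
- have gaps : gap R edge_01 xi = (0 < xi < 1) /\ gap R edge_1oo xi = (1 < xi) /\
     gap R edge_oo0 xi = (xi < 0).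
    by rewrite !gapE /farey_arc /= rmorph0 rmorph1 andbT.
  case: gaps => g1 [g2 g3].
  case: (ltgtP xi 0) => x0.
  + have h : gap R edge_oo0 xi by rewrite g3.
    rewrite level_sum2 [side_sum edge_01 xi]side_sum_out ?g1 ?(lt_gtF x0) //.
    rewrite [side_sum edge_1oo xi]side_sum_out ?g2 ?(lt_gtF (lt_trans x0 ltr01)) // !addr0.
    (* Left of 0 the fan of -1 is already present, so level 2 is one exchange beyond the side of
       Delta_0. *)
    have [|[xm ->]|[c hc [gc Hc]]] := interpolated_step edge_oo0 xi (side_sum edge_oo0 xi).
    * by apply: side_sum_Delta0 => //; rewrite !inE eqxx.
    * by left; split => //; exists (mid edge_oo0) => //; rewrite mid_oo0.
    * right; exists (c edge_oo0); split => //.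
      by apply: level_gap2; case: hc => ->; rewrite !inE eqxx ?orbT.
  + have o0 : ~~ gap R edge_oo0 xi by rewrite g3 (lt_gtF x0).
    rewrite level_sum2 (side_sum_out edge_oo0) // (fan_sum_mid_out edge_oo0) // add0r addr0.
    case: (ltgtP xi 1) => x1.
    * rewrite (side_sum_out edge_1oo) ?g2 ?(lt_gtF x1) // addr0.
      have ge : gap R edge_01 xi by rewrite g1 x0 x1.
      right; exists edge_01; split => //.
      by apply: side_sum_Delta0 => //; rewrite !inE eqxx ?orbT.
    * rewrite (side_sum_out edge_01) ?g1 ?(lt_gtF x1) ?andbF // add0r.
      have ge : gap R edge_1oo xi by rewrite g2.
      right; exists edge_1oo; split => //.
      by apply: side_sum_Delta0 => //; rewrite !inE eqxx ?orbT.
    * left; split; first by exists 1 => //; rewrite rmorph1.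
      by rewrite !side_sum_out ?g1 ?g2 x1 ?ltxx ?andbF // V1; ring.
  + left; split; first by exists 0 => //; rewrite rmorph0.
    have o0 : ~~ gap R edge_oo0 xi by rewrite g3 x0 ltxx.
    have o1 : ~~ gap R edge_01 xi by rewrite g1 x0 ltxx.
    have o2 : ~~ gap R edge_1oo xi by rewrite g2 x0 ltr10.
    rewrite level_sum2 (side_sum_out edge_oo0) // (side_sum_out edge_01) //.
    rewrite (side_sum_out edge_1oo) // (fan_sum_mid_out edge_oo0) // x0 V0.
    by ring.
- by left; split; [exact: in_level_sub h1|rewrite level_sum_old].
- rewrite (level_sum_new n e) //.
  have [[xm ->]|[c hc [gc Hc]]] := interpolated_step e xi _ h3.
  + left; split => //; exists (mid e) => //; by case: (mid_new R _ _ h1).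
  + right; exists (c e); split => //.
    exact: (level_gap_child R _ _ _ (covered_all R n)).
Qed.

End Sums.

(** * Hoelder estimates *)

Section Pow34.
Variable R : realType.
Implicit Types (x y t : R).

(* t ^ (3/4) *)
Definition pow34 t : R := Num.sqrt t * Num.sqrt (Num.sqrt t).

Lemma pow34_ge0 t : 0 <= pow34 t.
Proof. by rewrite mulr_ge0 ?sqrtr_ge0. Qed.

Lemma pow34_le x y : x <= y -> pow34 x <= pow34 y.
Proof. by move=> xy; rewrite ler_pM ?sqrtr_ge0 // !ler_wsqrtr. Qed.

Lemma pow34M x y : 0 <= x -> pow34 (x * y) = pow34 x * pow34 y.
Proof. by move=> x0; rewrite /pow34 sqrtrM // sqrtrM ?sqrtr_ge0 // mulrACA. Qed.

Lemma pow34_sqr t : 0 <= t -> pow34 (t ^+ 2) = t * Num.sqrt t.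
Proof. by move=> t0; rewrite /pow34 sqrtr_sqr ger0_norm. Qed.

Lemma sqrt_le1 t : t <= 1 -> Num.sqrt t <= 1.
Proof. by move=> t1; rewrite -[leRHS]sqrtr1 ler_wsqrtr. Qed.

Lemma sqrt_ge1 t : 1 <= t -> 1 <= Num.sqrt t.
Proof. by move=> t1; rewrite -[leLHS]sqrtr1 ler_wsqrtr. Qed.

Lemma pow34_le_sqrt t : t <= 1 -> pow34 t <= Num.sqrt t.
Proof. by move=> t1; rewrite ler_piMr ?sqrtr_ge0 // !sqrt_le1. Qed.

Lemma pow34_ge_id t : 0 <= t <= 1 -> t <= pow34 t.
Proof.
move=> /andP[t0 t1]; rewrite -[leLHS](sqr_sqrtr t0) expr2 ler_wpM2l ?sqrtr_ge0 //.
rewrite -[leLHS](@sqr_sqrtr _ (Num.sqrt t)) ?sqrtr_ge0 // expr2.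
by rewrite ler_piMr ?sqrtr_ge0 // !sqrt_le1.
Qed.

(** A bound below 2, so that halving contracts: half of 7/4 is 7/8. *)
Lemma pow34_2 : pow34 2 <= 7 / 4.
Proof.
rewrite -(ler_pXn2r (n := 4)) ?nnegrE ?pow34_ge0 // /pow34 exprMn.
have -> : Num.sqrt 2 ^+ 4 = 4 :> R.
  by rewrite (exprM _ 2 2) sqr_sqrtr //; ring.
have -> : Num.sqrt (Num.sqrt 2) ^+ 4 = 2 :> R.
  by rewrite (exprM _ 2 2) !sqr_sqrtr // sqrtr_ge0.
lra.
Qed.

(* dyadic induction: each halving of t costs a factor 2^(-1/4) < 1 *)
Lemma zygmund_holder (f : R -> R) (C B : R) :
  (forall x t, -2 <= x <= 2 -> 0 <= t <= 1 -> `|f (x + t) + f (x - t) - 2 * f x| <= C * t) ->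
  (forall x, -2 <= x <= 2 -> `|f x| <= B) ->
  exists2 A, 0 <= A &
    forall x y, -2 <= x <= 1 -> x <= y <= x + 1 -> `|f x - f y| <= A * pow34 (y - x).
Proof.
move=> zf bf.
have B0 : 0 <= B by apply: le_trans (bf 0 _); rewrite ?normr_ge0 //; lra.
exists (4 * B + 4 * `|C|) => [|x y hx hy]; first by rewrite addr_ge0 ?mulr_ge0.
(* [4 * B] settles t >= 1/2, where the difference is at most 2 B and t^(3/4) >= 1/2. In the
   induction the factor 7/8 leaves A/8, which pays for |C|/2 because 4 |C| <= A. *)
set A := 4 * B + _.
have A0 : 0 <= A by rewrite addr_ge0 ?mulr_ge0.
suff key : forall (n : nat) t, 2 ^- n.+1 <= t <= 1 -> `|f x - f (x + t)| <= A * pow34 t.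
  have [->|nxy] := eqVneq x y; first by rewrite !subrr normr0 mulr_ge0 ?pow34_ge0.
  have t0 : 0 < y - x by rewrite subr_gt0 lt_neqAle nxy; case/andP: hy.
  have [n hn] : exists n, 2 ^- n.+1 <= y - x.
    exists (Num.truncn (y - x)^-1); rewrite invf_ple ?posrE ?exprn_gt0 //.
    apply: ltW; apply: lt_le_trans (truncnS_gt _) _.
    by rewrite -natrX ler_nat ltnW // ltn_expl.
  have := key n (y - x); rewrite subrKC; apply; rewrite hn; lra.
have half : 2^-1 <= pow34 2^-1 by apply: pow34_ge_id; lra.
have big t : 2^-1 <= t <= 1 -> `|f x - f (x + t)| <= A * pow34 t.
  move=> ht; have h1 : `|f x - f (x + t)| <= 2 * B.
    apply: le_trans (ler_normB _ _) _; have := bf x; have := bf (x + t); lra.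
  have p2 : 2^-1 <= pow34 t by apply: le_trans half _; apply: pow34_le; lra.
  have h2 : (4 * B) * 2^-1 <= (4 * B) * pow34 t by rewrite ler_wpM2l // mulr_ge0.
  have h3 : 0 <= (4 * `|C|) * pow34 t by rewrite !mulr_ge0 ?pow34_ge0.
  by rewrite /A mulrDl; lra.
elim=> [|n IH] t ht; first by apply: big; rewrite expr1 in ht.
have [t2|t2] := lerP 2^-1 t; first by apply: big; rewrite t2; case/andP: ht.
have h2 : 2 ^- n.+1 <= 2 * t <= 1.
  case/andP: ht => ht _; apply/andP; split; last lra.
  by rewrite exprS invfM in ht; lra.
have t0 : 0 <= t by case/andP: ht => ht _; apply: le_trans ht; rewrite invr_ge0 exprn_ge0.
have := IH _ h2; rewrite pow34M // => h3.
have := zf (x + t) t; rewrite addrK (_ : x + t + t = x + 2 * t); last by ring.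
move=> h4; have {}h4 := h4 ltac:(lra) ltac:(lra).
(* The second difference centred at x + t replaces the increment over t by half of the increment
   over 2 t. *)
have h5 : `|f x - f (x + t)| <= (`|f x - f (x + 2 * t)| + `|C| * t) / 2.
  have -> : f x - f (x + t) = ((f x - f (x + 2 * t)) + (f (x + 2 * t) + f x - 2 * f (x + t))) / 2.
    by field.
  rewrite normrM [X in _ * X]ger0_norm // ler_wpM2r //.
  apply: le_trans (ler_normD _ _) _; rewrite lerD2l; apply: le_trans h4 _.
  by rewrite ler_wpM2r // ler_norm.
have h6 : t <= pow34 t by apply: pow34_ge_id; lra.
apply: le_trans h5 _.
have := pow34_2; have := pow34_ge0 t; have : 0 <= `|C| by [].
have : 4 * `|C| <= A by rewrite /A; lra.
move: h3 h6 A0; clear big IH; move: (pow34 t) (pow34 2) `|C| A => p q c A' h3 h6 A0 hA c0 p0 hq.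
have : A' * (q * p) <= A' * (7/4 * p) by rewrite ler_wpM2l // ler_wpM2r.
have : c * t <= c * p by rewrite ler_wpM2l.
have : 4 * c * p <= A' * p by rewrite ler_wpM2r.
nra.
Qed.

End Pow34.

Section GlobalHolder.
Variable R : realType.
Implicit Types (x y t : R).
Local Notation pow34 := (pow34 R).
Local Notation sqrt := (@Num.sqrt R).

Lemma continuous_bounded_itv (f : R -> R) M : continuous f ->
  exists2 B, 0 <= B & forall x, `|x| <= M -> `|f x| <= B.
Proof.
move=> cf; have [M0|M0] := ltP M 0.
  by exists 0 => // x hx; have := le_lt_trans hx M0; rewrite normr_lt0.
have [] := @EVT_max R (fun x => `|f x|) (- M) M _ _.
- by lra.
- by apply: continuous_subspaceT => x; apply: cvg_norm; exact: cf.
move=> c hc h; exists `|f c| => // x hx; apply: h.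
by rewrite in_itv /= -ler_norml.
Qed.

(** Turns |x| log |x| into the power |x|^(5/4), which stays below the exponent 3/2 allowed later. *)
Lemma ln_le_quarter x : 1 <= x -> ln x <= 4 * sqrt (sqrt x).
Proof.
move=> x1; have x0 : 0 < x by lra.
set r := sqrt (sqrt x); have r0 : 0 < r by rewrite !sqrtr_gt0.
have rE : r ^+ 4 = x by rewrite (exprM _ 2 2) !sqr_sqrtr ?sqrtr_ge0 // ltW.
by rewrite -rE lnXn // -[_ *+ 4]mulr_natl; have := ln_sublinear r0; lra.
Qed.

Lemma vanishes_growth V : continuous V -> vanishes_at_oo V ->
  exists2 G, 0 <= G & forall x, 1 <= `|x| -> `|V x| <= G * (`|x| * sqrt (sqrt `|x|)).
Proof.
move=> cV [C [M h]].
have [B B0 hB] := continuous_bounded_itv V M cV.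
exists (B + 4 * `|C|) => [|x x1]; first by rewrite addr_ge0 ?mulr_ge0.
have s1 : 1 <= sqrt (sqrt `|x|) by rewrite !sqrt_ge1.
have p1 : 1 <= `|x| * sqrt (sqrt `|x|) by rewrite -[leLHS]mulr1 ler_pM.
rewrite mulrDl; have [xM|Mx] := leP `|x| M.
  apply: le_trans (hB x xM) _; rewrite -[leLHS]addr0; apply: lerD; last by rewrite !mulr_ge0 ?sqrtr_ge0.
  by rewrite -[leLHS]mulr1 ler_wpM2l.
apply: le_trans (h x (ltW Mx)) _.
apply: (@le_trans _ _ (`|C| * (`|x| * ln `|x|))).
  by rewrite ler_wpM2r ?ler_norm // mulr_ge0 // ln_ge0.
rewrite -[leLHS]add0r; apply: lerD; first by rewrite !mulr_ge0 ?sqrtr_ge0.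
rewrite [leRHS](_ : _ = `|C| * (`|x| * (4 * sqrt (sqrt `|x|)))); last by ring.
by rewrite !ler_wpM2l // ln_le_quarter.
Qed.

(** The bound that [zygmund_holder] needs in the chart at oo. At 0 there is a single value; for |x|
    >= 1 the bound of V on [-1, 1] applies; for 0 < |x| < 1 the growth of V gives x^2 |x|^(-5/4). *)
Lemma chart_bounded V : continuous V -> vanishes_at_oo V ->
  exists B, forall x, -2 <= x <= 2 -> `|chart_at_oo V x| <= B.
Proof.
move=> cV hV; have [G G0 hG] := vanishes_growth V cV hV.
have [B B0 hB] := continuous_bounded_itv V 1 cV.
set l := lim (V y / y ^+ 2 @[y --> +oo]).
exists (`|l| + 4 * B + 4 * G) => x hx; rewrite /chart_at_oo -/l.
have l0 : 0 <= `|l| by [].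
have x4 : x ^+ 2 <= 4 by nra.
have xx0 : 0 <= x ^+ 2 by exact: sqr_ge0.
have [x0|x0] := eqVneq x 0; first by lra.
rewrite normrM (ger0_norm xx0).
have [x1|x1] := leP `|x^-1| 1.
  have := hB _ x1; have := normr_ge0 (V x^-1); move: `|V _| => v v0 hv.
  have : x ^+ 2 * v <= 4 * B; last by lra.
  by rewrite ler_pM.
have := hG _ (ltW x1); move: `|V _| => v hv.
have : x ^+ 2 * v <= 4 * G; last by lra.
apply: le_trans (ler_wpM2l xx0 hv) _.
rewrite mulrCA [leRHS]mulrC ler_wpM2l //.
have nx : 0 < `|x| by rewrite normr_gt0.
rewrite normfV -real_normK ?num_real // in x1 *.
have xi0 : 0 < `|x|^-1 by rewrite invr_gt0.
set z := `|x|^-1 in x1 xi0 *.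
have : sqrt (sqrt z) <= z.
  rewrite -[leRHS](sqr_sqrtr (ltW xi0)) expr2 -[leLHS]mul1r ler_pM ?sqrtr_ge0 //.
    by rewrite sqrt_ge1 // ltW.
  rewrite -[leRHS](@sqr_sqrtr _ (sqrt z)) ?sqrtr_ge0 // expr2 ler_peMl ?sqrtr_ge0 //.
  by rewrite !sqrt_ge1 // ltW.
move=> h; apply: (@le_trans _ _ (`|x| ^+ 2 * (z * z))).
  by rewrite ler_wpM2l ?sqr_ge0 // ler_wpM2l // ltW.
rewrite (_ : _ * _ = 1) //; last by rewrite /z; field; rewrite gt_eqF.
by lra.
Qed.

(* transport of the Hoelder estimate near 0 through the chart x -> 1/x *)
Lemma chart_holder (W T : R -> R) (A G : R) : 0 <= A -> 0 <= G ->
  (forall u v, 0 < u -> u <= v -> v <= 1 -> `|T u - T v| <= A * pow34 (v - u)) ->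
  (forall x, 1 <= x -> W x = x ^+ 2 * T x^-1) ->
  (forall x, 1 <= x -> `|W x| <= G * (x * sqrt (sqrt x))) ->
  forall x y, 1 <= x -> x <= y <= x + 1 ->
    `|W x - W y| <= (A + 4 * G) * (sqrt x * pow34 (y - x)).
Proof.
move=> A0 G0 hT hW gW x y x1 /andP[xy yx].
have x0 : 0 < x by lra. have y0 : 0 < y by lra. have y1 : 1 <= y by lra.
(* As 1/x - 1/y <= (y - x) / x^2, the first term is at most A x^2 (x^-2 (y - x))^(3/4) = A sqrt x (y
   - x)^(3/4). The second is at most 2 y (y - x) |W y| / y^2 and is absorbed by the growth bound. *)
have -> : W x - W y = x ^+ 2 * (T x^-1 - T y^-1) + (x ^+ 2 - y ^+ 2) * T y^-1.
  by rewrite !hW //; ring.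
apply: le_trans (ler_normD _ _) _; rewrite [leRHS]mulrDl; apply: lerD.
  rewrite normrM ger0_norm ?sqr_ge0 // distrC.
  apply: (@le_trans _ _ (x ^+ 2 * (A * pow34 (x^-1 - y^-1)))).
    rewrite ler_wpM2l ?sqr_ge0 // hT ?invr_gt0 // ?lef_pV2 ?posrE //.
    by rewrite invf_le1.
  rewrite mulrCA ler_wpM2l //.
  apply: (@le_trans _ _ (x ^+ 2 * pow34 (x^-1 ^+ 2 * (y - x)))).
    rewrite ler_wpM2l ?sqr_ge0 // pow34_le //.
    have -> : x^-1 - y^-1 = x^-1 * (y^-1 * (y - x)) by field; rewrite !gt_eqF.
    rewrite expr2 -mulrA ler_wpM2l ?invr_ge0 ?(ltW x0) // ler_wpM2r ?subr_ge0 //.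
    by rewrite lef_pV2 ?posrE.
  rewrite pow34M ?sqr_ge0 // pow34_sqr ?invr_ge0 ?(ltW x0) //.
  rewrite !mulrA ler_wpM2r ?pow34_ge0 //.
  rewrite expr2 mulfK ?gt_eqF //.
  have ss : sqrt x * sqrt x^-1 = 1 by rewrite -sqrtrM ?ltW // divff ?gt_eqF // sqrtr1.
  have sx : sqrt x * sqrt x = x by rewrite -expr2 sqr_sqrtr // ltW.
  have -> : x * sqrt x^-1 = sqrt x by transitivity (sqrt x * sqrt x * sqrt x^-1); [by rewrite sx|by rewrite -mulrA ss mulr1].
  by [].
have Ty : `|T y^-1| = `|W y| / y ^+ 2.
  by rewrite hW // normrM ger0_norm ?sqr_ge0 // mulrC mulKf // expf_neq0 // gt_eqF.
rewrite normrM Ty.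
have -> : `|x ^+ 2 - y ^+ 2| = (y - x) * (x + y).
  by rewrite distrC ger0_norm; [ring|nra].
have s0 : 0 <= sqrt (sqrt y) by rewrite sqrtr_ge0.
have h1 : `|W y| / y ^+ 2 <= G * (sqrt (sqrt y) / y).
  rewrite ler_pdivrMr ?exprn_gt0 //; apply: le_trans (gW y y1) _.
  by rewrite expr2 -mulrA ler_wpM2l // mulrA mulfVK ?gt_eqF // mulrC.
have h2 : (x + y) * (`|W y| / y ^+ 2) <= 2 * G * sqrt (sqrt y).
  apply: (@le_trans _ _ ((2 * y) * (G * (sqrt (sqrt y) / y)))).
    by rewrite ler_pM ?divr_ge0 ?sqr_ge0 //; lra.
  rewrite le_eqVlt; apply/orP; left; apply/eqP; field; by rewrite gt_eqF.
apply: (@le_trans _ _ ((y - x) * (2 * G * sqrt (sqrt y)))).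
  by rewrite -[leLHS]mulrA ler_wpM2l // subr_ge0.
have h3 : sqrt (sqrt y) <= 2 * sqrt x.
  apply: (@le_trans _ _ (sqrt y)).
    rewrite -[leRHS](@sqr_sqrtr _ (sqrt y)) ?sqrtr_ge0 // expr2 ler_peMl //.
    by rewrite !sqrt_ge1.
  rewrite -(ler_pXn2r (n := 2)) ?nnegrE ?mulr_ge0 ?sqrtr_ge0 //.
  by rewrite exprMn !sqr_sqrtr ?ltW //; lra.
have h4 : y - x <= pow34 (y - x) by apply: pow34_ge_id; lra.
have h5 : 0 <= y - x by lra.
apply: (@le_trans _ _ (pow34 (y - x) * (2 * G * (2 * sqrt x)))).
  rewrite ler_pM ?mulr_ge0 //.
  by rewrite ler_wpM2l ?mulr_ge0.
by rewrite le_eqVlt; apply/orP; left; apply/eqP; ring.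
Qed.

End GlobalHolder.

Section TameFields.
Variable R : realType.
Implicit Types (x y t : R) (W V : R -> R).
Local Notation pow34 := (pow34 R).
Local Notation sqrt := (@Num.sqrt R).

(* What remains of the Zygmund condition, in both charts, and of V(oo) = 0. *)
Definition tame H W := [/\ 0 <= H,
  forall x y, `|x - y| <= 1 -> `|W x - W y| <= H * (sqrt (1 + `|x|) * pow34 `|x - y|) &
  forall x, `|W x| <= H * ((1 + `|x|) * sqrt (1 + `|x|))].

Lemma zygmund_tame V : vector_field V -> zygmund V -> vanishes_at_oo V ->
  exists H, tame H V.
Proof.
move=> [cV _] [C zV] vV.
have [B1 B10 hB1] := continuous_bounded_itv R V 2 cV.
have [B2 hB2] := chart_bounded R V cV vV.
have [G G0 hG] := vanishes_growth R V cV vV.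
have [A1 A10 hA1] : exists2 A, 0 <= A & forall x y, -2 <= x <= 1 -> x <= y <= x + 1 ->
    `|V x - V y| <= A * pow34 (y - x).
  apply: (zygmund_holder R V C B1).
  - by move=> x t hx ht; case: (zV x t hx ht).
  - by move=> x hx; apply: hB1; rewrite ler_norml.
have [A2 A20 hA2] : exists2 A, 0 <= A & forall x y, -2 <= x <= 1 -> x <= y <= x + 1 ->
    `|chart_at_oo V x - chart_at_oo V y| <= A * pow34 (y - x).
  apply: (zygmund_holder R _ C B2) => //.
  by move=> x t hx ht; case: (zV x t hx ht).
have cE x : 1 <= `|x| -> V x = x ^+ 2 * chart_at_oo V x^-1.
  move=> x1; have x0 : x != 0 by rewrite -normr_gt0; lra.
  by rewrite /chart_at_oo invr_eq0 (negbTE x0) invrK; field.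
pose L := A2 + 4 * G.
have L0 : 0 <= L by rewrite addr_ge0 ?mulr_ge0.
have pos x y : 1 <= x -> x <= y <= x + 1 -> `|V x - V y| <= L * (sqrt x * pow34 (y - x)).
  apply: (chart_holder R V (chart_at_oo V)) => //.
  - by move=> u v u0 uv v1; apply: hA2; lra.
  - by move=> z z1; apply: cE; rewrite ger0_norm //; lra.
  - by move=> z z1; have := hG z; rewrite ger0_norm ?(le_trans ler01) //; exact.
have neg x y : 1 <= x -> x <= y <= x + 1 ->
    `|V (- x) - V (- y)| <= L * (sqrt x * pow34 (y - x)).
  apply: (chart_holder R (fun z => V (- z)) (fun z => chart_at_oo V (- z))) => //.
  - move=> u v u0 uv v1; rewrite distrC (_ : v - u = - u - - v); last by ring.
    by apply: hA2; lra.
  - by move=> z z1; rewrite cE ?normrN ?ger0_norm ?sqrrN ?invrN //; lra.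
  - move=> z z1; have := hG (- z); rewrite normrN ger0_norm ?(le_trans ler01) //; exact.
(* The factors 2 pay for exchanging x and y, where sqrt (1 + |y|) <= 2 sqrt (1 + |x|); B1 and G
   bound V itself. *)
pose H := 2 * A1 + 2 * L + B1 + G.
have s1 x : 1 <= sqrt (1 + `|x|) by rewrite sqrt_ge1 // lerDl.
(* The chart at oo serves x > 1, the direct estimate -2 <= x <= 1, and the reflected chart x <
   -2. *)
have main x y : x <= y <= x + 1 -> `|V x - V y| <= (A1 + L) * (sqrt (1 + `|x|) * pow34 (y - x)).
  move=> hxy; have p0 := pow34_ge0 R (y - x).
  have [x1|x1] := lerP x 1; last first.
    apply: le_trans (pos x y (ltW x1) hxy) _.
    apply: ler_pM => //; rewrite ?mulr_ge0 ?sqrtr_ge0 //; first by rewrite lerDr.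
    by rewrite ler_wpM2r // ler_wsqrtr // (le_trans (ler_norm x)) // lerDr.
  have [x2|x2] := lerP (-2) x.
    apply: le_trans (hA1 x y _ hxy) _; first by rewrite x2.
    apply: ler_pM => //; first by rewrite lerDl.
    by rewrite ler_peMl.
  have := neg (- y) (- x); rewrite !opprK (_ : - x + y = y - x); last by ring.
  rewrite distrC => h; apply: le_trans (h _ _) _; [lra|lra|].
  apply: ler_pM => //; rewrite ?mulr_ge0 ?sqrtr_ge0 //; first by rewrite lerDr.
  rewrite ler_wpM2r // ler_wsqrtr // ltr0_norm; lra.
exists H; split.
- by rewrite /H !addr_ge0 // mulr_ge0.
- move=> x y xy; have [hxy|hxy] := lerP x y.
    have := main x y; rewrite [`|x - y|]distrC ger0_norm ?subr_ge0 // in xy *.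
    move=> /(_ ltac:(lra)) h; apply: le_trans h _.
    apply: ler_wpM2r; first by rewrite mulr_ge0 ?sqrtr_ge0 ?pow34_ge0.
    rewrite /H; lra.
  have := main y x; rewrite ger0_norm ?subr_ge0 ?(ltW hxy) // in xy *.
  move=> /(_ ltac:(lra)); rewrite distrC => h; apply: le_trans h _.
  have h1 : sqrt (1 + `|y|) <= 2 * sqrt (1 + `|x|).
    rewrite -(ler_pXn2r (n := 2)) ?nnegrE ?mulr_ge0 ?sqrtr_ge0 //.
    rewrite exprMn !sqr_sqrtr ?addr_ge0 //.
    have := ler_normD x (y - x); rewrite subrKC distrC [`|x - y|]ger0_norm ?subr_ge0 ?(ltW hxy) //.
    by have := normr_ge0 x; lra.
  have h2 : (A1 + L) * (sqrt (1 + `|y|) * pow34 (x - y)) <=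
            (A1 + L) * ((2 * sqrt (1 + `|x|)) * pow34 (x - y)).
    apply: ler_wpM2l; first by rewrite addr_ge0.
    by apply: ler_wpM2r; first exact: pow34_ge0.
  apply: le_trans h2 _.
  rewrite [leLHS](_ : _ = (2 * (A1 + L)) * (sqrt (1 + `|x|) * pow34 (x - y))); last by ring.
  apply: ler_wpM2r; first by rewrite mulr_ge0 ?sqrtr_ge0 ?pow34_ge0.
  by rewrite /H; lra.
- move=> x; have x0 := normr_ge0 x.
  have m1 : 1 <= (1 + `|x|) * sqrt (1 + `|x|) by rewrite -[leLHS]mulr1 ler_pM // lerDl.
  have m0 : 0 <= (1 + `|x|) * sqrt (1 + `|x|) by lra.
  have [x1|x1] := leP `|x| 1.
    apply: (@le_trans _ _ (B1 * 1)); first by rewrite mulr1 hB1 //; lra.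
    by rewrite ler_pM // /H; lra.
  apply: le_trans (hG x (ltW x1)) _.
  apply: ler_pM => //; rewrite ?mulr_ge0 ?sqrtr_ge0 //; first by rewrite /H; lra.
  apply: ler_pM => //; rewrite ?sqrtr_ge0 //; first by rewrite lerDr.
  apply: (@le_trans _ _ (sqrt `|x|)); last by rewrite ler_wsqrtr // lerDr.
  by rewrite ler_wsqrtr // -{2}[`|x|]sqr_sqrtr // expr2 ler_peMl ?sqrtr_ge0 // sqrt_ge1 // ltW.
Qed.

End TameFields.

Section HalfLines.
Variable R : realType.
Implicit Types (x y t xi : R) (W V : R -> R) (e : edge).
Local Notation pow34 := (pow34 R).
Local Notation sqrt := (@Num.sqrt R).

Definition growth xi : R := (1 + `|xi|) * sqrt (1 + `|xi|).

Lemma growth_ge0 xi : 0 <= growth xi.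
Proof. by rewrite mulr_ge0 ?sqrtr_ge0 // addr_ge0. Qed.

Lemma growth_le x y : `|x| <= `|y| -> growth x <= growth y.
Proof.
move=> xy; have := normr_ge0 x => x0.
by apply: ler_pM; rewrite ?sqrtr_ge0 ?ler_wsqrtr ?addr_ge0 // lerD2l.
Qed.

Lemma sqrt_le_growth x y : `|x| <= `|y| -> sqrt (1 + `|x|) <= growth y.
Proof.
move=> xy; rewrite -[leLHS]mul1r; apply: ler_pM; rewrite ?sqrtr_ge0 //.
  by rewrite lerDl.
by rewrite ler_wsqrtr // lerD2l.
Qed.

(** For an edge from n to oo the quadratic form vanishes at oo, so the interpolant is the affine
    function through the values at n and n + 1. *)
Lemma tame_halfline H W n xi : tame R H W -> 0 <= n -> n < xi ->
  `|W xi - (W n + (W (n + 1) - W n) * (xi - n))|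
    <= 4 * H * (growth xi * sqrt (Num.min 1 (xi - n))).
Proof.
move=> [H0 hW gW] n0 nxi.
have nx : `|n| <= `|xi| by rewrite !ger0_norm //; lra.
have d0 : 0 < xi - n by lra.
have h1 : `|W (n + 1) - W n| <= H * growth xi.
  rewrite distrC; apply: le_trans (hW _ _ _) _; first by rewrite opprD addNKr normrN1.
  rewrite opprD addNKr normrN1 ler_wpM2l //.
  have -> : pow34 1 = 1 by rewrite /pow34 !sqrtr1 mulr1.
  by rewrite mulr1 sqrt_le_growth.
have g0 := growth_ge0 xi.
have [x1|x1] := leP 1 (xi - n).
  rewrite sqrtr1 mulr1.
  apply: le_trans (ler_normB _ _) _; apply: (@le_trans _ _ (H * growth xi + (H * growth xi + H * growth xi))); last first.
    by have := mulr_ge0 H0 g0; lra.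
  apply: lerD; first exact: gW.
  apply: le_trans (ler_normD _ _) _; apply: lerD.
    by apply: le_trans (gW _) _; rewrite ler_wpM2l // growth_le.
  rewrite normrM; apply: (@le_trans _ _ (H * sqrt (1 + `|n|) * (1 + `|xi|))).
    apply: ler_pM => //.
      rewrite distrC; apply: le_trans (hW _ _ _) _; first by rewrite opprD addNKr normrN1.
      rewrite opprD addNKr normrN1.
      have -> : pow34 1 = 1 by rewrite /pow34 !sqrtr1 mulr1.
      by rewrite mulr1.
    by rewrite gtr0_norm // ger0_norm; lra.
  rewrite -mulrA ler_wpM2l // mulrC /growth ler_wpM2l ?addr_ge0 //.
  by rewrite ler_wsqrtr // lerD2l.
have -> : W xi - (W n + (W (n + 1) - W n) * (xi - n)) =
  (W xi - W n) - (W (n + 1) - W n) * (xi - n) by ring.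
apply: le_trans (ler_normB _ _) _.
have s0 := sqrtr_ge0 (xi - n).
have hs : xi - n <= sqrt (xi - n).
  apply: (@le_trans _ _ (pow34 (xi - n))); first by apply: pow34_ge_id; lra.
  by apply: pow34_le_sqrt; lra.
apply: (@le_trans _ _ (H * (growth xi * sqrt (xi - n)) + H * growth xi * sqrt (xi - n))); last first.
  by have := mulr_ge0 H0 (mulr_ge0 g0 s0); lra.
apply: lerD.
  rewrite distrC; apply: le_trans (hW _ _ _) _; rewrite distrC (gtr0_norm d0); first lra.
  rewrite ler_wpM2l //; apply: ler_pM; [exact: sqrtr_ge0|exact: pow34_ge0|exact: sqrt_le_growth|].
  by apply: pow34_le_sqrt; lra.
by rewrite normrM; apply: ler_pM => //; rewrite gtr0_norm.
Qed.

Lemma tameN H W : tame R H W -> tame R H (fun x => W (- x)).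
Proof.
move=> [H0 h1 h2]; split=> // [x y xy|x].
  have := h1 (- x) (- y); rewrite normrN (_ : - x - - y = - (x - y)); last by ring.
  by rewrite normrN; exact.
by have := h2 (- x); rewrite normrN.
Qed.

End HalfLines.

Section FiniteArcs.
Variable R : realType.
Implicit Types (x y t xi : R) (W V : R -> R) (e : edge).
Local Notation pow34 := (pow34 R).
Local Notation sqrt := (@Num.sqrt R).

Local Notation growth := (growth R).

(** tau and sg are the barycentric coordinates of xi in an interval of length h. Multiplying V xi by
    (tau + sg)^2 = 1 writes the error as five weighted differences of V, and their bounds add up to
    2 + 2 + 4 + 2 + 2 = 12. *)
Lemma key_finite H V e xi : tame R H V -> 0 < eb e -> 0 < ed e -> gap R e xi ->
  let tau := (eb e)%:~R * al R e xi in let sg := (ed e)%:~R * be R e xi in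
  let h := (eb e)%:~R^-1 * (ed e)%:~R^-1 in
  tau + sg = 1 /\ [/\ 0 < tau, 0 < sg,
      xi - (ea e)%:~R / (eb e)%:~R = sg * h, (ec e)%:~R / (ed e)%:~R - xi = tau * h &
  `|V xi - Qr R V e xi| <= 12 * H * (growth xi * sqrt (tau * sg * h))].
Proof.
move=> tV b0 d0 /andP[]; have [H0 hV _] := tV.
have := edge_detR R e; have ratm := erefl ((ea e + ec e)%:~R / (eb e + ed e)%:~R : R).
rewrite /Qr /lam /al /be.
have bZ : 1 <= (eb e)%:~R :> R by rewrite ler1z.
have dZ : 1 <= (ed e)%:~R :> R by rewrite ler1z.
rewrite !rmorphD /=.
move: (ea e)%:~R (eb e)%:~R (ec e)%:~R (ed e)%:~R bZ dZ {b0 d0 ratm} => a b c d b1 d1 D.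
have b0 : 0 < b by lra. have d0 : 0 < d by lra.
have bn0 : b != 0 by rewrite gt_eqF. have dn0 : d != 0 by rewrite gt_eqF.
have bdn0 : b + d != 0 by rewrite gt_eqF // addr_gt0.
move Ealpha : (c - d * xi) => alpha al0; move Ebeta : (b * xi - a) => beta be0.
set tau := b * alpha; set sg := d * beta; set h := b^-1 * d^-1.
have ts1 : tau + sg = 1 by rewrite /tau /sg -Ealpha -Ebeta -D; ring.
have tau0 : 0 < tau by rewrite mulr_gt0.
have sg0 : 0 < sg by rewrite mulr_gt0.
have h0 : 0 < h by rewrite mulr_gt0 ?invr_gt0.
have hu : xi - a / b = sg * h by rewrite /sg /h -Ebeta; field; rewrite bn0 dn0.
have hv : c / d - xi = tau * h by rewrite /tau /h -Ealpha; field; rewrite bn0 dn0.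
split=> //; split => //.
set m := (a + c) / (b + d).
have mu : m - a / b = b^-1 * (b + d)^-1.
  apply: (@eq_trans _ _ ((b * c - a * d) * (b^-1 * (b + d)^-1))); last by rewrite D mul1r.
  by rewrite /m; field; rewrite bn0 bdn0.
have mv : c / d - m = d^-1 * (b + d)^-1.
  apply: (@eq_trans _ _ ((b * c - a * d) * (d^-1 * (b + d)^-1))); last by rewrite D mul1r.
  by rewrite /m; field; rewrite dn0 bdn0.
move: (hV) => hV'.
set Vu := V (a / b); set Vv := V (c / d); set Vm := V m.
have -> : V xi - (b ^+ 2 * Vu * alpha ^+ 2 + d ^+ 2 * Vv * beta ^+ 2 +
   ((b + d) ^+ 2 * Vm - b ^+ 2 * Vu - d ^+ 2 * Vv) * (alpha * beta)) =
  tau ^+ 2 * (V xi - Vu) + sg ^+ 2 * (V xi - Vv) + 2 * (tau * sg) * (V xi - Vm)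
  + tau * sg * (b / d * (Vu - Vm)) + tau * sg * (d / b * (Vv - Vm)).
  set P := _ + _ + _ * (alpha * beta).
  transitivity ((tau + sg) ^+ 2 * V xi - P); first by rewrite ts1 expr1n mul1r.
  by rewrite /P /tau /sg; field; rewrite bn0 dn0.
have t1 : tau <= 1 by clear -ts1 sg0; lra.
have s1 : sg <= 1 by clear -ts1 tau0; lra.
have h1 : h <= 1 by rewrite /h -invfM invf_le1 ?mulr_gt0 // mulr_ege1.
have mh : b^-1 * (b + d)^-1 + d^-1 * (b + d)^-1 = h by rewrite /h; field; rewrite bn0 dn0 bdn0.
have hE : h = b^-1 * d^-1 by [].
clearbody tau sg h.
have [tau0' sg0' h0'] := And3 (ltW tau0) (ltW sg0) (ltW h0).
have L0 : 0 <= H * growth xi by rewrite mulr_ge0 ?growth_ge0.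
have L20 : 0 <= 2 * (H * growth xi) by rewrite mulr_ge0.
set q := sqrt (tau * sg * h).
have q0 : 0 <= q by rewrite sqrtr_ge0.
have sgh : 0 < sg * h by rewrite mulr_gt0. have tauh : 0 < tau * h by rewrite mulr_gt0.
have sgh1 : sg * h <= h by rewrite ler_piMl.
have tauh1 : tau * h <= h by rewrite ler_piMl.
have sgh2 := le_trans sgh1 h1. have tauh2 := le_trans tauh1 h1.
have hsum : sg * h + tau * h = h by rewrite -mulrDl addrC ts1 mul1r.
(* [tame] yields the factor sqrt (1 + |y|); as |y| <= |xi| + 1, it is at most 2 sqrt (1 + |xi|),
   hence at most twice the growth at xi. *)
have hB y z : `|y| <= `|xi| + 1 -> `|y - z| <= 1 -> `|V y - V z| <= 2 * (H * growth xi) * pow34 `|y - z|.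
  clear -hV H0; move=> yx yz; apply: le_trans (hV _ _ yz) _.
  rewrite [leRHS](_ : _ = H * ((2 * growth xi) * pow34 `|y - z|)); last by ring.
  rewrite ler_wpM2l //; apply: ler_wpM2r; first exact: pow34_ge0.
  rewrite -[leLHS]mul1r; apply: (@le_trans _ _ ((1 + `|xi|) * (2 * sqrt (1 + `|xi|)))); last first.
    by rewrite /growth le_eqVlt; apply/orP; left; apply/eqP; ring.
  apply: ler_pM; rewrite ?sqrtr_ge0 ?lerDl //.
  rewrite -(ler_pXn2r (n := 2)) ?nnegrE ?mulr_ge0 ?sqrtr_ge0 //.
  rewrite exprMn !sqr_sqrtr ?addr_ge0 //; have := normr_ge0 xi; lra.
have bm0 : 0 < b^-1 * (b + d)^-1 by rewrite mulr_gt0 ?invr_gt0 ?addr_gt0.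
have dm0 : 0 < d^-1 * (b + d)^-1 by rewrite mulr_gt0 ?invr_gt0 ?addr_gt0.
have ux : a / b <= xi by rewrite -subr_ge0 hu ltW.
have xv : xi <= c / d by rewrite -subr_ge0 hv ltW.
have um : a / b <= m by rewrite -subr_ge0 mu ltW.
have mv' : m <= c / d by rewrite -subr_ge0 mv ltW.
have vu : c / d - a / b = h by rewrite -hsum -hu -hv; ring.
have near y : a / b <= y -> y <= c / d -> `|y| <= `|xi| + 1.
  clear -ux xv vu h1; move=> y1 y2; have -> : y = xi + (y - xi) by ring.
  apply: le_trans (ler_normD _ _) _; rewrite lerD2l ler_norml; apply/andP; split; lra.
have xx : `|xi| <= `|xi| + 1 by rewrite lerDl.
have T0 (x y z w : R) : 0 < x -> x <= 1 -> 0 < y -> y <= 1 -> `|xi - z| = y * h -> w = V z ->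
    `|x ^+ 2 * (V xi - w)| <= 2 * (H * growth xi) * sqrt (x * y * h).
  move=> x0 x1 y0 y1 zE ->; rewrite normrM (ger0_norm (sqr_ge0 _)).
  have yh : y * h <= 1 by rewrite mulr_ile1 // ltW.
  apply: (@le_trans _ _ (x ^+ 2 * (2 * (H * growth xi) * pow34 (y * h)))).
    by rewrite ler_wpM2l ?sqr_ge0 // -zE; apply: hB; rewrite ?zE.
  rewrite mulrCA; apply: ler_wpM2l => //.
  apply: (@le_trans _ _ (sqrt x * sqrt (y * h))).
    apply: ler_pM; rewrite ?sqr_ge0 ?pow34_ge0 //; last exact: pow34_le_sqrt.
    rewrite -(ler_pXn2r (n := 2)) ?nnegrE ?sqr_ge0 ?sqrtr_ge0 // (sqr_sqrtr (ltW x0)).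
    by rewrite -exprM -[leRHS]expr1; apply: ler_wiXn2l => //; exact: ltW.
  by rewrite -sqrtrM ?(ltW x0) // mulrA.
have T1 : `|tau ^+ 2 * (V xi - Vu)| <= 2 * (H * growth xi) * q.
  by apply: (T0 tau sg (a / b)) => //; rewrite hu gtr0_norm.
have T2 : `|sg ^+ 2 * (V xi - Vv)| <= 2 * (H * growth xi) * q.
  rewrite /q [tau * sg]mulrC.
  by apply: (T0 sg tau (c / d)) => //; rewrite distrC hv gtr0_norm.
have ts0 : 0 < tau * sg by rewrite mulr_gt0.
have ts0' := ltW ts0.
have tsq : tau * sg * sqrt h <= q.
  rewrite /q (sqrtrM _ ts0'); apply: ler_wpM2r; first exact: sqrtr_ge0.
  rewrite -(ler_pXn2r (n := 2)) ?nnegrE ?sqrtr_ge0 // (sqr_sqrtr ts0').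
  by rewrite expr2; apply: ler_piMr => //; rewrite mulr_ile1.
have T3 : `|2 * (tau * sg) * (V xi - Vm)| <= 4 * (H * growth xi) * q.
  have ts2 : 0 < 2 * (tau * sg) by rewrite mulr_gt0.
  rewrite normrM (gtr0_norm ts2).
  have dm : `|xi - m| <= h.
    by clear -ux xv um mv' vu; rewrite ler_norml; apply/andP; split; lra.
  have dm1 := le_trans dm h1.
  apply: (@le_trans _ _ (2 * (tau * sg) * (2 * (H * growth xi) * sqrt h))).
    apply: ler_wpM2l; first exact: ltW.
    apply: le_trans (hB _ _ xx dm1) _; apply: ler_wpM2l => //.
    by apply: le_trans (pow34_le_sqrt _ _ dm1) _; rewrite ler_wsqrtr.
  rewrite [leLHS](_ : _ = 4 * (H * growth xi) * (tau * sg * sqrt h)); last by ring.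
  by apply: ler_wpM2l => //; rewrite mulr_ge0.
(* The critical terms, since b/d is unbounded. The endpoint is within x^-2 of the mediant, and (x/y)
   (x^-2)^(3/4) = x^(-1/2) / y is at most sqrt h; here the exponent 3/4 is fully used. *)
have side x y z : 0 < x -> 0 < y -> 1 <= x -> 1 <= y -> h = x^-1 * y^-1 ->
    a / b <= z -> z <= c / d -> `|z - m| = x^-1 * (x + y)^-1 ->
    `|tau * sg * (x / y * (V z - Vm))| <= 2 * (H * growth xi) * q.
  move=> x0 y0 x1 y1 hE' z1 z2 zm.
  rewrite normrM (gtr0_norm ts0).
  apply: (@le_trans _ _ (tau * sg * (2 * (H * growth xi) * sqrt h))); last first.
    by rewrite mulrCA; apply: ler_wpM2l.
  apply: ler_wpM2l => //; rewrite normrM (gtr0_norm (divr_gt0 x0 y0)).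
  have xi0 : 0 < x^-1 by rewrite invr_gt0.
  have yi0 : 0 < y^-1 by rewrite invr_gt0.
  have [xi0' yi0'] := conj (ltW xi0) (ltW yi0).
  have xi1 : x^-1 <= 1 by rewrite invf_le1.
  have zm1 : `|z - m| <= x^-1 ^+ 2.
    rewrite zm expr2; apply: ler_wpM2l => //.
    by rewrite lef_pV2 ?posrE ?addr_gt0 // lerDl ltW.
  have zm2 : `|z - m| <= 1 by apply: le_trans zm1 _; rewrite expr2 mulr_ile1.
  apply: (@le_trans _ _ (x / y * (2 * (H * growth xi) * pow34 (x^-1 ^+ 2)))).
    apply: ler_wpM2l; first by rewrite mulr_ge0 // ltW.
    apply: le_trans (hB _ _ (near _ z1 z2) zm2) _.
    by apply: ler_wpM2l => //; exact: pow34_le.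
  rewrite mulrCA; apply: ler_wpM2l => //; rewrite pow34_sqr //.
  rewrite [leLHS](_ : _ = y^-1 * sqrt x^-1); last by field; rewrite !gt_eqF.
  rewrite hE' sqrtrM // mulrC; apply: ler_wpM2l; first exact: sqrtr_ge0.
  rewrite -[leLHS](sqr_sqrtr yi0') expr2; apply: ler_piMr; first exact: sqrtr_ge0.
  by apply: sqrt_le1; rewrite invf_le1.
have T4 : `|tau * sg * (b / d * (Vu - Vm))| <= 2 * (H * growth xi) * q.
  apply: side => //; first exact: le_trans ux xv.
  by rewrite distrC mu gtr0_norm.
have T5 : `|tau * sg * (d / b * (Vv - Vm))| <= 2 * (H * growth xi) * q.
  apply: side => //; [by rewrite hE mulrC|exact: le_trans ux xv|].
  by rewrite mv gtr0_norm // [d + b]addrC.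
rewrite [leRHS](_ : _ = 2 * (H * growth xi) * q + 2 * (H * growth xi) * q +
  4 * (H * growth xi) * q + 2 * (H * growth xi) * q + 2 * (H * growth xi) * q); last by ring.
apply: le_trans (ler_normD _ _) _; apply: lerD => //.
apply: le_trans (ler_normD _ _) _; apply: lerD => //.
apply: le_trans (ler_normD _ _) _; apply: lerD => //.
by apply: le_trans (ler_normD _ _) _; apply: lerD.
Qed.

End FiniteArcs.

Section KeyEstimate.
Variable R : realType.
Implicit Types (x y t xi : R) (W V : R -> R) (e : edge).
Local Notation pow34 := (pow34 R).
Local Notation sqrt := (@Num.sqrt R).

Local Notation growth := (growth R).


(** The distances of xi to the endpoints are sg h and tau h; both are at least tau sg h, and a point
    a outside the gap is at least as far as one of the endpoints. Edges at oo are covered by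
    [tame_halfline], after a reflection if they begin there. *)
Lemma key_estimate H V : tame R H V -> forall e xi a, gap R e xi -> ~~ gap R e a ->
  `|V xi - Qr R V e xi| <= 12 * H * (growth xi * sqrt (Num.min 1 `|xi - a|)).
Proof.
move=> tV e xi a ge ga; have [H0 _ _] := tV.
have g0 : 0 <= growth xi by exact: growth_ge0.
have weaken (r : R) : r <= Num.min 1 `|xi - a| -> forall k, k <= 12 -> 0 <= k -> forall D,
    D <= k * H * (growth xi * sqrt r) ->
    D <= 12 * H * (growth xi * sqrt (Num.min 1 `|xi - a|)).
  move=> hr k k12 k0 D hD; apply: le_trans hD _; apply: ler_pM.
  - by rewrite mulr_ge0.
  - by rewrite mulr_ge0 ?sqrtr_ge0.
  - by rewrite ler_wpM2r.
  - by rewrite ler_wpM2l // ler_wsqrtr.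
have ge0 := ge; move: ge0 => /andP[].
have [d0|dn0] := eqVneq (ed e) 0.
  have b1 := edge_oo_r1 e d0; have c1 := ec_oo e d0; have n1 := edge_oo_r e d0.
  move: ga; rewrite /gap /Qr /lam /al /be d0 b1 c1 /= !(mul0r, mul1r, subr0) expr0n ltr01 /=.
  rewrite !(mul0r, mulr1, expr1n, mul1r, addr0, divr1) rmorphD /= subr_gt0 -leNgt => an _.
  set n := (ea e)%:~R; rewrite subr_gt0 => nxi.
  have n0 : 0 <= n by rewrite ler0z; lia.
  have := tame_halfline R H V n xi tV n0 nxi; rewrite subr0.
  apply: weaken; [| by rewrite ler_nat|by []].
  rewrite le_min !ge_min lexx /=; apply/orP; right.
  by rewrite ger0_norm; lra.
have [b0|bn0] := eqVneq (eb e) 0.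
  have d1 := edge_oo_l1 e b0; have c1 := ea_oo e b0; have n1 := edge_oo_l e b0.
  move: ga; rewrite /gap /Qr /lam /al /be b0 d1 c1 /=.
  rewrite !(mul0r, mul1r, rmorphN, opprK, add0r) /= expr0n ltr01 andbT /=.
  rewrite !(mul0r, mulr1, expr1n, mul1r, add0r, divr1, subr0) rmorphD rmorphN /=.
  rewrite subr_gt0 -leNgt => an; set n := (ec e)%:~R; rewrite subr_gt0 => nxi _.
  have n0 : 0 <= - n by rewrite oppr_ge0 lerz0.
  have nxi' : - n < - xi by rewrite ltrN2.
  have /= := tame_halfline R H _ (- n) (- xi) (tameN R H V tV) n0 nxi'.
  rewrite !opprK (_ : - (- n + 1) = -1 + n) ?[- xi + n]addrC; last by rewrite opprD opprK addrC.
  rewrite (_ : growth (- xi) = growth xi); last by rewrite /growth normrN.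
  apply: weaken; [| by rewrite ler_nat|by []].
  rewrite le_min !ge_min lexx /=; apply/orP; right.
  by rewrite distrC ger0_norm; lra.
have b0 : 0 < eb e by have := eb_ge0 e; lia.
have d0 : 0 < ed e by have := ed_ge0 e; lia.
have [ts1 [t0 s0 hu hv]] := key_finite R H V e xi tV b0 d0 ge.
move=> hK al0 be0; apply: weaken hK => //.
set tau := _ * al R e xi in ts1 t0 hv *; set sg := _ * be R e xi in ts1 s0 hu *.
have bR : 0 < (eb e)%:~R :> R by rewrite ltr0z.
have dR : 0 < (ed e)%:~R :> R by rewrite ltr0z.
set h := _^-1 * _^-1 in hu hv *.
have h0 : 0 < h by rewrite mulr_gt0 ?invr_gt0.
have h1 : h <= 1 by rewrite /h -invfM invf_le1 ?mulr_gt0 // mulr_ege1 // ler1z.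
have {al0 be0} ha : a <= (ea e)%:~R / (eb e)%:~R \/ (ec e)%:~R / (ed e)%:~R <= a.
  move: ga; rewrite /gap negb_and -!leNgt /al /be !subr_le0 => /orP[] hh; [right|left].
    by rewrite ler_pdivrMr // mulrC.
  by rewrite ler_pdivlMr // mulrC.
clearbody tau sg h.
have t1 : tau <= 1 by clear -ts1 s0; lra.
have s1 : sg <= 1 by clear -ts1 t0; lra.
have tn : tau * sg <= tau by rewrite ler_piMr // ltW.
have sn : tau * sg <= sg by rewrite ler_piMl // ltW.
rewrite le_min; apply/andP; split.
  by rewrite mulr_ile1 // ?(ltW h0) ?(le_trans tn) // ltW // mulr_gt0.
case: ha => ha.
  apply: (@le_trans _ _ (sg * h)); first by rewrite ler_wpM2r // ltW.
  by rewrite -hu; apply: le_trans (ler_norm _); rewrite lerD2l lerN2.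
apply: (@le_trans _ _ (tau * h)); first by rewrite ler_wpM2r // ltW.
by rewrite -hv distrC; apply: le_trans (ler_norm _); rewrite lerD2r.
Qed.

End KeyEstimate.

(** * The Hilbert transform as an absolutely convergent integral *)

Section SingularIntegral.
Variable R : realType.
Local Notation sqrt := (@Num.sqrt R).
Local Notation mu := (@lebesgue_measure R).
Implicit Types (a t xi eps : R).

(** What a simple pole times the root of the distance leaves, with decay |t|^(-3/2). Its value at 0
    is 0, since the inverse of 0 is 0. *)
Definition psi t : R := (sqrt `|t| * (1 + `|t|))^-1.
(* A regularization with a bounded integral by the primitive 2 arctan (sqrt (t + eps));
   Fatou's lemma passes the bound to [psi]. *)
Definition psi_reg eps t : R := (sqrt (`|t| + eps) * (1 + (`|t| + eps)))^-1.

Lemma psi_reg_gt0 eps t : 0 < eps -> 0 < psi_reg eps t.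
Proof.
move=> e0; have t0 : 0 < `|t| + eps by rewrite ltr_wpDl.
by rewrite invr_gt0 mulr_gt0 ?sqrtr_gt0 // addr_gt0.
Qed.

Lemma psi_reg_continuous eps : 0 < eps -> continuous (psi_reg eps).
Proof.
move=> e0 t; have t0 : 0 < `|t| + eps by rewrite ltr_wpDl.
have ce : {for t, continuous (fun t => `|t| + eps)}.
  by apply: cvgD; [exact: norm_continuous|exact: cvg_cst].
apply: cvgV; first by rewrite mulf_neq0 // gt_eqF ?sqrtr_gt0 // addr_gt0.
apply: cvgM.
  by apply: (continuous_comp ce); exact: sqrt_continuous.
by apply: cvgD; [exact: cvg_cst|exact: ce].
Qed.

Lemma sqrt_cvgy : sqrt x @[x --> +oo] --> +oo.
Proof.
apply/cvgryPge => A; near=> x.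
have A2 : A ^+ 2 <= x by near: x; apply: nbhs_pinfty_ge; exact: num_real.
by apply: le_trans (ler_norm A) _; rewrite -sqrtr_sqr ler_wsqrtr.
Unshelve. all: by end_near.
Qed.

Lemma integral_psi_reg_half eps : 0 < eps ->
  (\int[mu]_(x in `[0%R, +oo[) (psi_reg eps x)%:E <= (2 * pi)%:E)%E.
Proof.
move=> e0.
pose F t : R := 2 * (atan \o (sqrt \o (fun t => t + eps))) t.
have dF t : 0 <= t -> is_derive t 1 F (psi_reg eps t).
  move=> t0; have te : 0 < t + eps by rewrite ltr_wpDl.
  have h0 : is_derive t 1 (fun t => t + eps) 1.
    by apply: is_derive_eq; rewrite addr0.
  have h1 := @is_derive1_comp _ sqrt (fun t => t + eps) t _ _ (is_derive1_sqrt te) h0.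
  have h2 := @is_derive1_comp _ atan _ t _ _ (is_derive1_atan _) h1.
  have h3 := is_deriveZ 2 h2.
  apply: is_derive_eq h3 _; rewrite /psi_reg ger0_norm //= sqr_sqrtr ?(ltW te) //.
  rewrite /GRing.scale /= mulr1; field.
  by rewrite !gt_eqF ?sqrtr_gt0 // addr_gt0.
rewrite (@ge0_continuous_FTC2y _ (psi_reg eps) F 0 pi).
- rewrite -EFinB lee_fin /F /=; have := atan_gtNpi2 (sqrt (0 + eps)); lra.
- by move=> x _; rewrite ltW // psi_reg_gt0.
- by apply: continuous_subspaceT; exact: psi_reg_continuous.
- rewrite [X in _ --> X](_ : _ = 2 * (pi / 2)); last by field.
  apply: cvgM; first exact: cvg_cst.
  apply: (@cvg_comp _ _ _ (sqrt \o (fun t => t + eps)) atan _ +oo); last exact: cvgy_atan.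
  apply: (@cvg_comp _ _ _ (fun x => x + eps) sqrt _ +oo); last exact: sqrt_cvgy.
  exact: cvg_addrr.
- by move=> x x0; have [] := dF x (ltW x0).
- apply: cvg_at_right_filter; apply: differentiable_continuous; apply/derivable1_diffP.
  by have [] := dF 0 (lexx _).
- move=> x; rewrite in_itv/= andbT => x0; rewrite derive1E.
  by have [_] := dF x (ltW x0).
Qed.

Lemma integral_psi_reg eps a : 0 < eps ->
  (\int[mu]_x (psi_reg eps (x - a))%:E <= (4 * pi)%:E)%E.
Proof.
move=> e0; have c := psi_reg_continuous eps e0.
have g0 x : 0 <= psi_reg eps x by rewrite ltW // psi_reg_gt0.
have dI (x : R) : is_derive x 1 (fun x : R => x - a) 1.
  by apply: is_derive_eq; rewrite subr0.
have dE : derive1 (fun x : R => x - a) = cst 1.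
  by apply/funext => x; rewrite derive1E; have [] := dI x.
have := @increasing_ge0_integration_by_substitutionT R (fun x => x - a) (psi_reg eps).
rewrite dE => /(_ _ _ _ _ _ _ _ c g0) H.
have {}H : (\int[mu]_x (psi_reg eps (x - a))%:E = \int[mu]_x (psi_reg eps x)%:E)%E.
  rewrite H.
  - by apply: eq_integral => x _; rewrite /= fctE /= mulr1.
  - by move=> x y xy; rewrite ltrD2r.
  - by move=> x; exact: cvg_cst.
  - by apply: is_cvg_cst.
  - by apply: is_cvg_cst.
  - by move=> x; apply: ex_derive.
  - exact: cvg_addrr_Ny.
  - exact: cvg_addrr.
rewrite H ge0_symfun_integralT //; last by move=> x; rewrite /psi_reg /= normrN.
rewrite (_ : [set x | 0 <= x] = `[0, +oo[%classic); last first.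
  by apply/seteqP; split => x /=; rewrite in_itv /= andbT.
rewrite (_ : 4 * pi = 2 * (2 * pi)); last by ring.
by rewrite [leRHS]EFinM lee_pmul2l //; exact: integral_psi_reg_half.
Qed.

(** The inverse is the pointwise limit of the continuous functions t / (t^2 + 1/(n + 1)), also at 0,
    where both sides are 0. *)
Lemma inv_measurable : measurable_fun setT (@GRing.inv R).
Proof.
pose f (n : nat) (t : R) := t / (t ^+ 2 + n.+1%:R^-1).
have n0 (n : nat) : 0 < n.+1%:R^-1 :> R by rewrite invr_gt0.
apply/measurable_EFinP; apply: (@emeasurable_fun_cvg _ _ _ _ (fun n t => (f n t)%:E)).
- move=> n; apply/measurable_EFinP; apply: continuous_measurable_fun => t.
  apply: cvgM; first exact: cvg_id.
  apply: cvgV; first by rewrite gt_eqF // ltr_wpDl ?sqr_ge0.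
  by apply: cvgD; [exact: exprn_continuous|exact: cvg_cst].
- move=> t _; apply: cvg_EFin; first exact: nearW.
  have [->|t0] := eqVneq t 0.
    by rewrite invr0 /f; under eq_fun do rewrite mul0r; exact: cvg_cst.
  have -> : t^-1 = t / (t ^+ 2 + 0) by rewrite addr0; field.
  apply: cvgM; first exact: cvg_cst.
  apply: cvgV; first by rewrite addr0 sqrf_eq0.
  by apply: cvgD; [exact: cvg_cst|exact: cvg_harmonic].
Qed.

Lemma psi_measurable a : measurable_fun setT (fun x : R => psi (x - a)).
Proof.
have m1 : measurable_fun setT (fun x : R => `|x - a|).
  by apply: continuous_measurable_fun => x; apply: cvg_norm; apply: cvgB; [exact: cvg_id|exact: cvg_cst].
apply: (measurableT_comp inv_measurable); apply: measurable_funM.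
  apply: (@measurableT_comp _ _ _ _ _ _ sqrt) => //.
  by apply: continuous_measurable_fun; exact: sqrt_continuous.
exact: measurable_funD.
Qed.

Lemma psi_integrable a : mu.-integrable setT (EFin \o (fun x : R => psi (x - a))).
Proof.
apply/integrableP; split; first by apply/measurable_EFinP; exact: psi_measurable.
pose g (n : nat) x := (psi_reg n.+1%:R^-1 (x - a))%:E.
have e0 (n : nat) : 0 < n.+1%:R^-1 :> R by rewrite invr_gt0.
have g0 n x : (0 <= g n x)%E by rewrite lee_fin ltW // psi_reg_gt0.
have mg n : measurable_fun setT (g n).
  apply/measurable_EFinP; apply: continuous_measurable_fun => x.
  apply: (@continuous_comp _ _ _ (fun x => x - a) (psi_reg n.+1%:R^-1)).
    by apply: cvgB; [exact: cvg_id|exact: cvg_cst].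
  exact: psi_reg_continuous.
have := @fatou _ _ _ mu setT measurableT g mg (fun n x _ => g0 n x).
move=> fat; apply: (@le_lt_trans _ _ (4 * pi)%:E); last by rewrite ltry.
have einfs_le (u : nat -> \bar R) n : (einfs u n <= u n)%E.
  by apply: ereal_inf_lbound; exists n => //=.
apply: (@le_trans _ _ (\int[mu]_x limn_einf (g ^~ x))%E); last first.
  apply: le_trans fat _; rewrite limn_einf_lim.
  apply: lime_le; first exact: is_cvg_einfs.
  by apply: nearW => n; apply: le_trans (einfs_le _ n) _; exact: integral_psi_reg.
apply: ge0_le_integral => //.
- by apply/measurable_EFinP; apply: measurableT_comp => //; exact: psi_measurable.
- have mh n : measurable_fun setT (fun x => - g n x)%E.
    by have := measurableT_comp (@oppe_measurable R setT) (mg n).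
  have := @measurable_fun_limn_esup _ _ R setT (fun n x => - g n x)%E mh.
  by move/(measurableT_comp (@oppe_measurable R setT)).
move=> x _ /=.
rewrite ger0_norm; last by rewrite invr_ge0 mulr_ge0 ?sqrtr_ge0 // addr_ge0.
(* At the singularity the regularizations diverge, but [psi] is 0 there and only an inequality is
   required. *)
have [->|xa] := eqVneq x a.
  rewrite /psi subrr normr0 sqrtr0 mul0r invr0 limn_einf_lim.
  apply: lime_ge; first exact: is_cvg_einfs.
  by apply: nearW => n; apply: le_ereal_inf_tmp => _ [k _ <-].
suff : g ^~ x @ \oo --> (psi (x - a))%:E by move=> /cvg_limn_einf_sup[-> _].
apply: cvg_EFin; first exact: nearW.
have xa0 : 0 < `|x - a| by rewrite normr_gt0 subr_eq0.
have h : (fun n => `|x - a| + n.+1%:R^-1) @ \oo --> `|x - a|.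
  by rewrite -[X in _ --> X]addr0; apply: cvgD; [exact: cvg_cst|exact: cvg_harmonic].
apply: cvgV; first by rewrite gt_eqF // mulr_gt0 ?sqrtr_gt0 // addr_gt0.
apply: cvgM.
  by apply: continuous_cvg h; exact: sqrt_continuous.
by apply: cvgD; [exact: cvg_cst|exact: h].
Qed.

End SingularIntegral.

(** * The kernel against the weight *)

Section Kernel.
Variable R : realType.
Local Notation sqrt := (@Num.sqrt R).
Local Notation mu := (@lebesgue_measure R).
Local Notation psi := (psi R).
Local Notation growth := (growth R).
Implicit Types (t xi eps : R).
Variable x : R.
Hypotheses (x0 : x != 0) (x1 : x != 1).

Definition hker xi : R := x * (x - 1) / (xi * (xi - 1) * (xi - x)).
Definition pole_dist xi : R := Num.min 1 (Num.min `|xi| (Num.min `|xi - 1| `|xi - x|)).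
(** The common majorant of the remainders: it vanishes like a root at the three poles, and the cap 1
    in [pole_dist] leaves the plain growth elsewhere. *)
Definition weight xi : R := growth xi * sqrt (pole_dist xi).

Lemma weight_ge0 xi : 0 <= weight xi.
Proof. by rewrite mulr_ge0 ?sqrtr_ge0 ?growth_ge0. Qed.

Lemma sqrt_div_psi t D : t != 0 -> `|t| <= D -> sqrt `|t| / `|t| <= (1 + D) * psi t.
Proof.
move=> t0 tD; have nt : 0 < `|t| by rewrite normr_gt0.
have st : 0 < sqrt `|t| by rewrite sqrtr_gt0.
have -> : sqrt `|t| / `|t| = (sqrt `|t|)^-1.
  by rewrite -[X in _ / X](sqr_sqrtr (ltW nt)); field; rewrite gt_eqF.
rewrite /psi invfM mulrCA ler_peMr ?invr_ge0 ?(ltW st) //.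
rewrite ler_pdivlMr ?addr_gt0 // mul1r lerD2l //.
Qed.

(** By partial fractions the kernel is a sum of three simple poles, and [pole_dist] is at most the
    distance to each of them. At a pole the kernel is 0, by the convention for inverses. *)
Lemma hker_weight_near M xi : 0 <= M -> `|xi| <= M ->
  `|hker xi| * weight xi <= growth M * (`|x - 1| + `|x| + 1) * (1 + (M + `|x| + 1)) *
     (psi (xi - 0) + psi (xi - 1) + psi (xi - x)).
Proof.
move=> M0 xiM.
have psi0 t : 0 <= psi t by rewrite invr_ge0 mulr_ge0 ?sqrtr_ge0 // addr_ge0.
set K := M + `|x| + 1.
have K0 : 0 <= K by rewrite !addr_ge0.
have C0 : 0 <= growth M * (`|x - 1| + `|x| + 1) * (1 + K).
  by rewrite !mulr_ge0 ?growth_ge0 ?addr_ge0.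
have [xi0|xi0] := eqVneq xi 0.
  by rewrite /hker xi0 !mul0r invr0 mulr0 normr0 mul0r mulr_ge0 // !addr_ge0.
have [xi1|xi1] := eqVneq xi 1.
  by rewrite /hker xi1 subrr mulr0 mul0r invr0 mulr0 normr0 mul0r mulr_ge0 // !addr_ge0.
have [xix|xix] := eqVneq xi x.
  by rewrite /hker xix subrr mulr0 invr0 mulr0 normr0 mul0r mulr_ge0 // !addr_ge0.
have d1 : xi - 1 != 0 by rewrite subr_eq0.
have dx : xi - x != 0 by rewrite subr_eq0.
have hE : hker xi = (x - 1) / xi - x / (xi - 1) + 1 / (xi - x).
  by rewrite /hker; field; rewrite xi0 d1 dx.
have s0 : 0 <= sqrt (pole_dist xi) by rewrite sqrtr_ge0.
have part A t : t != 0 -> `|t| <= K -> pole_dist xi <= `|t| ->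
    `|A / t| * sqrt (pole_dist xi) <= `|A| * ((1 + K) * psi t).
  move=> t0 tK pt; rewrite normrM -mulrA ler_wpM2l //; apply: le_trans (sqrt_div_psi _ _ t0 tK).
  by rewrite normfV mulrC ler_wpM2r ?invr_ge0 // ler_wsqrtr.
have p0 : pole_dist xi <= `|xi| by rewrite /pole_dist !ge_min lexx orbT.
have p1 : pole_dist xi <= `|xi - 1| by rewrite /pole_dist !ge_min lexx !orbT.
have p2 : pole_dist xi <= `|xi - x| by rewrite /pole_dist !ge_min lexx !orbT.
have n0 : `|xi| <= K by rewrite /K; have := normr_ge0 x; lra.
have n1 : `|xi - 1| <= K by apply: le_trans (ler_normB _ _) _; rewrite normr1 /K; have := normr_ge0 x; lra.
have n2 : `|xi - x| <= K by apply: le_trans (ler_normB _ _) _; rewrite /K; lra.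
have h0 := part (x - 1) xi xi0 n0 p0.
have h1 := part x (xi - 1) d1 n1 p1.
have h2 := part 1 (xi - x) dx n2 p2.
rewrite /weight mulrCA -[leRHS]mulrA -[leRHS]mulrA; apply: ler_pM; rewrite ?growth_ge0 ?mulr_ge0 //.
  by apply: growth_le; rewrite (ger0_norm M0).
apply: (@le_trans _ _ ((`|(x - 1) / xi| + `|x / (xi - 1)| + `|1 / (xi - x)|) * sqrt (pole_dist xi))).
  rewrite ler_wpM2r // hE; apply: le_trans (ler_normD _ _) _; rewrite lerD2r.
  exact: ler_normB.
rewrite normr1 in h2; rewrite subr0.
have q0 := psi0 xi. have q1 := psi0 (xi - 1). have q2 := psi0 (xi - x).
set T := (1 + K) in h0 h1 h2 *.
have T0 : 0 <= T by rewrite addr_ge0.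
rewrite [T * _]mulrDr [T * (_ + _)]mulrDr.
move: h0 h1 h2 (mulr_ge0 T0 q0) (mulr_ge0 T0 q1) (mulr_ge0 T0 q2) (normr_ge0 (x - 1)) (normr_ge0 x).
move: (T * psi xi) (T * psi (xi - 1)) (T * psi (xi - x)) => a b c.
move: `|x - 1| `|x| `|_ / xi| `|x / _| `|1 / _| (sqrt _) => d e k l m q.
clear; move=> h0 h1 h2 a0 b0 c0 d0 e0.
have := mulr_ge0 d0 b0; have := mulr_ge0 d0 c0.
have := mulr_ge0 e0 a0; have := mulr_ge0 e0 c0. lra.
Qed.

(** Here |xi - 1| and |xi - x| are at least |xi|/2, so the kernel is at most 4 |x (x - 1)| / |xi|^3
    and the weight at most 4 |xi|^(3/2). The last factor 2 of 32 comes from 1 + |xi| <= 2 |xi|. *)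
Lemma hker_weight_far xi : 2 * (`|x| + 1) <= `|xi| ->
  `|hker xi| * weight xi <= 32 * `|x * (x - 1)| * psi (xi - 0).
Proof.
move=> h; set z := `|xi| in h *; have nx := normr_ge0 x.
have z2 : 2 <= z by lra.
have z0 : 0 < z by lra.
have h1 : z / 2 <= `|xi - 1|.
  have := ler_normB (xi - 1) (- 1); rewrite opprK subrK normrN1 -/z; lra.
have hx : z / 2 <= `|xi - x|.
  have := ler_normB (xi - x) (- x); rewrite opprK subrK normrN -/z; lra.
have sz : 0 < sqrt z by rewrite sqrtr_gt0.
have s2 : sqrt 2 <= 2 :> R.
  rewrite -(ler_pXn2r (n := 2)) ?nnegrE ?sqrtr_ge0 // sqr_sqrtr //; lra.
have g : growth xi <= 4 * (z * sqrt z).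
  apply: (@le_trans _ _ ((2 * z) * (2 * sqrt z))); last by rewrite le_eqVlt; apply/orP; left; apply/eqP; ring.
  rewrite /growth -/z.
  apply: ler_pM; [lra|exact: sqrtr_ge0|lra|].
  apply: (@le_trans _ _ (sqrt (2 * z))); first by apply: ler_wsqrtr; lra.
  by rewrite sqrtrM // ler_wpM2r ?sqrtr_ge0.
have w : weight xi <= 4 * (z * sqrt z).
  rewrite /weight; apply: le_trans _ g; rewrite ler_piMr ?growth_ge0 //.
  by apply: sqrt_le1; rewrite /pole_dist ge_min lexx.
have k : `|hker xi| <= `|x * (x - 1)| * (4 / z ^+ 3).
  rewrite /hker normrM ler_wpM2l // normfV !normrM -/z.
  have -> : 4 / z ^+ 3 = (z * (z / 2) * (z / 2))^-1 by field; rewrite gt_eqF.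
  rewrite lef_pV2 ?posrE; last 2 first.
  - by rewrite !mulr_gt0 // ; lra.
  - by rewrite !mulr_gt0 // divr_gt0.
  have zh : 0 <= z / 2 by lra.
  apply: ler_pM; [by rewrite mulr_ge0 // ltW|by []| |exact: hx].
  by apply: ler_wpM2l => //; exact: ltW.
have wz : 0 <= z * sqrt z by rewrite ltW // mulr_gt0.
apply: (@le_trans _ _ (`|x * (x - 1)| * (4 / z ^+ 3) * (4 * (z * sqrt z)))).
  by apply: ler_pM; rewrite ?weight_ge0.
rewrite subr0 /psi -/z -!mulrA [leRHS]mulrCA ler_wpM2l //.
have -> : 4 * ((z ^+ 3)^-1 * (4 * (z * sqrt z))) = 16 * ((sqrt z)^-1 * z^-1).
  have E (q y : R) : 0 < q -> y = q ^+ 2 -> 4 * ((y ^+ 3)^-1 * (4 * (y * q))) = 16 * (q^-1 * y^-1).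
    by move=> q0 ->; field; rewrite gt_eqF.
  by apply: E => //; rewrite sqr_sqrtr // ltW.
rewrite (_ : 32 = 16 * 2 :> R); last by ring.
rewrite -mulrA ler_wpM2l // invfM mulrCA ler_wpM2l ?invr_ge0 ?(ltW sz) //.
rewrite -[X in _ <= X]invrK lef_pV2 ?posrE //; last by rewrite invr_gt0 divr_gt0 // addr_gt0.
rewrite invfM invrK; lra.
Qed.

Lemma hker_measurable : measurable_fun setT hker.
Proof.
apply: measurable_funM => //; apply: (measurableT_comp (inv_measurable R)).
by apply: measurable_funM; [apply: measurable_funM => //|]; apply: measurable_funB.
Qed.

Lemma weight_measurable : measurable_fun setT weight.
Proof.
have ms : measurable_fun setT sqrt by apply: continuous_measurable_fun; exact: sqrt_continuous.
have mn (a : R) : measurable_fun setT (fun xi : R => `|xi - a|).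
  by apply: measurableT_comp => //; exact: measurable_funB.
have mg : measurable_fun setT (fun xi : R => 1 + `|xi|) by exact: measurable_funD.
apply: measurable_funM.
  by apply: measurable_funM => //; exact: measurableT_comp.
apply: measurableT_comp => //.
apply: measurable_minr => //; apply: measurable_minr => //.
by apply: measurable_minr.
Qed.

Lemma hker_weight_integrable : mu.-integrable setT (EFin \o (fun xi => hker xi * weight xi)).
Proof.
set M := 2 * (`|x| + 1).
have M0 : 0 <= M by rewrite mulr_ge0 // addr_ge0.
set C1 := growth M * (`|x - 1| + `|x| + 1) * (1 + (M + `|x| + 1)).
set C2 := 32 * `|x * (x - 1)|.
have C10 : 0 <= C1 by rewrite !mulr_ge0 ?growth_ge0 ?addr_ge0.
have C20 : 0 <= C2 by rewrite mulr_ge0.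
have psi0 t : 0 <= psi t by rewrite invr_ge0 mulr_ge0 ?sqrtr_ge0 // addr_ge0.
pose f xi := (C1 + C2) * (psi (xi - 0) + psi (xi - 1) + psi (xi - x)).
have fi : mu.-integrable setT (EFin \o f).
  have := @integrableD _ _ _ mu setT measurableT _ _
    (integrableD measurableT (psi_integrable R 0) (psi_integrable R 1)) (psi_integrable R x).
  by move/(integrableZl measurableT (C1 + C2)).
apply: le_integrable fi => //.
  by apply/measurable_EFinP/measurable_funM; [exact: hker_measurable|exact: weight_measurable].
move=> xi _ /=; rewrite lee_fin normrM (ger0_norm (weight_ge0 xi)).
apply: le_trans (ler_norm _); rewrite /f mulrDl.
have [h|h] := lerP `|xi| M.
  apply: le_trans (hker_weight_near M xi M0 h) _.
  by rewrite lerDl mulr_ge0 // !addr_ge0.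
apply: le_trans (hker_weight_far xi (ltW h)) _.
rewrite -[leLHS]add0r; apply: lerD; first by rewrite mulr_ge0 // !addr_ge0.
by rewrite ler_wpM2l // -addrA lerDl addr_ge0.
Qed.

End Kernel.

Section Functional.
Variable R : realType.
Local Notation mu := (@lebesgue_measure R).
Implicit Types (t xi eps : R) (W : R -> R).
Variable x : R.
Hypotheses (x0 : x != 0) (x1 : x != 1).
Local Notation hker := (hker R x).
Local Notation weight := (weight R x).

(** Half the distance from x to the nearer of 0 and 1, so that the cutoff stays away from both
    poles. *)
Definition cut_radius : R := Num.min `|x| `|x - 1| / 2.
(* Its integral against [hker] over symmetric truncations is 0, because
   [hker xi * cutoff xi] is 1 / (xi - x) near x; hence subtracting a multiple of it
   makes the principal value at x an absolutely convergent integral. *)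
Definition cutoff xi : R := if `|xi - x| < cut_radius then xi * (xi - 1) / (x * (x - 1)) else 0.
Definition remainder W xi : R := W xi - W x * cutoff xi.
(** The class on which the principal value becomes an absolutely convergent integral; it is stable
    under sums, multiples and dominated limits. *)
Definition admissible W := measurable_fun setT W /\
  exists C, forall xi, `|remainder W xi| <= C * weight xi.
Definition hfun W : R := (\int[mu]_xi (hker xi * remainder W xi))%R.

Lemma cut_radius_gt0 : 0 < cut_radius.
Proof. by rewrite divr_gt0 // lt_min !normr_gt0 x0 subr_eq0. Qed.

Lemma cutoff_measurable : measurable_fun setT cutoff.
Proof.
have m : measurable_fun setT (fun xi : R => `|xi - x|).
  by apply: measurableT_comp => //; exact: measurable_funB.
apply: measurable_fun_ifT => //; first exact: measurable_fun_ltr.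
by apply: measurable_funM => //; apply: measurable_funM => //; exact: measurable_funB.
Qed.

Lemma remainder_measurable W : measurable_fun setT W -> measurable_fun setT (remainder W).
Proof.
move=> mW; apply: measurable_funB => //; apply: measurable_funM => //.
exact: cutoff_measurable.
Qed.

Lemma hker_remainder_measurable W : measurable_fun setT W ->
  measurable_fun setT (fun xi => hker xi * remainder W xi).
Proof.
by move=> mW; apply: measurable_funM; [exact: hker_measurable|exact: remainder_measurable].
Qed.

Lemma hker_dominated C y xi : `|y| <= C * weight xi ->
  `|hker xi * y| <= `|C * (hker xi * weight xi)|.
Proof.
move=> h; rewrite (normrM (hker xi)) (normrM C) (normrM (hker xi) (weight xi)).
rewrite (ger0_norm (weight_ge0 R x xi)) mulrCA; apply: ler_wpM2l => //.
by apply: le_trans h _; rewrite ler_wpM2r ?weight_ge0 // ler_norm.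
Qed.

Lemma hker_remainder_integrable W : admissible W ->
  mu.-integrable setT (EFin \o (fun xi => hker xi * remainder W xi)).
Proof.
move=> [mW [C hC]].
have := integrableZl (mu := mu) measurableT C (hker_weight_integrable R x).
apply: le_integrable => //; first by apply/measurable_EFinP; exact: hker_remainder_measurable.
by move=> xi _ /=; rewrite lee_fin; exact: hker_dominated.
Qed.

Lemma remainderD W1 W2 xi : remainder (fun t => W1 t + W2 t) xi = remainder W1 xi + remainder W2 xi.
Proof. by rewrite /remainder; ring. Qed.

Lemma remainderZ c W xi : remainder (fun t => c * W t) xi = c * remainder W xi.
Proof. by rewrite /remainder; ring. Qed.

Lemma admissibleD W1 W2 : admissible W1 -> admissible W2 ->
  admissible (fun t => W1 t + W2 t).
Proof.
move=> [m1 [C1 h1]] [m2 [C2 h2]]; split; first exact: measurable_funD.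
exists (C1 + C2) => xi; rewrite remainderD mulrDl.
by apply: le_trans (ler_normD _ _) _; exact: lerD.
Qed.

Lemma admissibleZ c W : admissible W -> admissible (fun t => c * W t).
Proof.
move=> [m1 [C1 h1]]; split; first exact: measurable_funM.
by exists (`|c| * C1) => xi; rewrite remainderZ normrM -mulrA ler_wpM2l.
Qed.

Lemma admissible0 : admissible (fun=> 0).
Proof.
split => //; exists 0 => xi; by rewrite /remainder mul0r subrr normr0 mul0r.
Qed.

Lemma hfunD W1 W2 : admissible W1 -> admissible W2 ->
  hfun (fun t => W1 t + W2 t) = hfun W1 + hfun W2.
Proof.
move=> h1 h2; rewrite /hfun -RintegralD //; try exact: hker_remainder_integrable.
by apply: eq_Rintegral => xi _; rewrite remainderD mulrDr.
Qed.

Lemma hfunZ c W : admissible W -> hfun (fun t => c * W t) = c * hfun W.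
Proof.
move=> h1; rewrite /hfun -RintegralZl //; last exact: hker_remainder_integrable.
by apply: eq_Rintegral => xi _; rewrite remainderZ mulrCA.
Qed.

Lemma hfun0 : hfun (fun=> 0) = 0.
Proof.
by have := hfunZ 0 _ admissible0; rewrite !mul0r.
Qed.

Lemma admissible_sum (I : Type) (r : seq I) (F : I -> R -> R) : (forall i, admissible (F i)) ->
  admissible (fun t => \sum_(i <- r) F i t).
Proof.
move=> h; elim: r => [|i r IH].
  by under eq_fun do rewrite big_nil; exact: admissible0.
by under eq_fun do rewrite big_cons; exact: admissibleD.
Qed.

Lemma hfun_sum (I : Type) (r : seq I) (F : I -> R -> R) : (forall i, admissible (F i)) ->
  hfun (fun t => \sum_(i <- r) F i t) = \sum_(i <- r) hfun (F i).
Proof.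
move=> h; elim: r => [|i r IH].
  by rewrite big_nil; under eq_fun do rewrite big_nil; exact: hfun0.
rewrite big_cons -IH -hfunD //; last exact: admissible_sum.
by congr hfun; apply/funext => t; rewrite big_cons.
Qed.

(** Serves both limits of the double series. The majorant is required of the remainders, as the
    fields need not vanish at x. *)
Lemma hfun_dominated (F : nat -> R -> R) W C : (forall n, measurable_fun setT (F n)) ->
  (forall n xi, `|remainder (F n) xi| <= C * weight xi) ->
  (forall xi, F ^~ xi @ \oo --> W xi) ->
  admissible W /\ (fun n => hfun (F n)) @ \oo --> hfun W.
Proof.
move=> mF hF cF.
have mW : measurable_fun setT W.
  apply/measurable_EFinP; apply: (@emeasurable_fun_cvg _ _ _ _ (fun n t => (F n t)%:E)).
    by move=> n; apply/measurable_EFinP.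
  by move=> t _; apply: cvg_EFin; [exact: nearW|exact: cF].
have cR xi : (fun n => remainder (F n) xi) @ \oo --> remainder W xi.
  by apply: cvgB => //; apply: cvgM => //; exact: cvg_cst.
have aW : admissible W.
  split=> //; exists C => xi.
  have cn : (fun n => `|remainder (F n) xi|) @ \oo --> `|remainder W xi| by apply: cvg_norm.
  rewrite -(cvg_lim _ cn) //; apply: limr_le; first by apply/cvg_ex; eexists; exact: cn.
  by apply: nearW => n.
split=> //.
have dom := integrableZl (mu := mu) measurableT C (hker_weight_integrable R x).
have dom' := integrable_abse dom.
have [] := @dominated_convergence _ _ R mu setT measurableT
  (fun n xi => (hker xi * remainder (F n) xi)%:E) (fun xi => (hker xi * remainder W xi)%:E) _ _ _ _ dom'.
- by move=> n; apply/measurable_EFinP; exact: hker_remainder_measurable.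
- by apply/measurable_EFinP; exact: hker_remainder_measurable.
- apply: aeW => xi _; apply: cvg_EFin; first exact: nearW.
  by apply: cvgM; [exact: cvg_cst|exact: cR].
- by apply: aeW => xi n _ /=; rewrite lee_fin; exact: hker_dominated.
move=> _ _ H; apply: fine_cvg.
rewrite fineK; first exact: H.
exact: (integrable_fin_num measurableT (hker_remainder_integrable _ aW)).
Qed.

End Functional.

Section Truncation.
Variable R : realType.
Local Notation mu := (@lebesgue_measure R).
Implicit Types (t xi eps : R) (W : R -> R).
Variable x : R.
Hypotheses (x0 : x != 0) (x1 : x != 1).
Local Notation hker := (hker R x).
Local Notation weight := (weight R x).
Local Notation cut_radius := (cut_radius R x).
Local Notation cutoff := (cutoff R x).
Local Notation remainder := (remainder R x).
Local Notation admissible := (admissible R x).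
Local Notation hfun := (hfun R x).

Definition trunc_set eps : set R :=
  [set xi : R | [/\ eps < `|xi|, eps < `|xi - 1| & eps < `|xi - x|]].

Lemma trunc_set_measurable eps : measurable (trunc_set eps).
Proof.
have m (a : R) : measurable [set xi : R | eps < `|xi - a|].
  have mf : measurable_fun setT (fun xi : R => `|xi - a|).
    by apply: measurableT_comp => //; exact: measurable_funB.
  have := mf measurableT `]eps, +oo[%classic (measurable_itv _).
  rewrite setTI; congr measurable; apply/seteqP; split => xi /=; rewrite in_itv /= andbT //.
rewrite (_ : trunc_set eps = [set xi : R | eps < `|xi - 0|] `&` [set xi : R | eps < `|xi - 1|]
   `&` [set xi : R | eps < `|xi - x|]); last first.
  by apply/seteqP; split => xi /=; rewrite subr0; [case=> *|case=> -[]].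
by apply: measurableI; [apply: measurableI|]; exact: m.
Qed.

Lemma integral_inv_right (a b : R) : 0 < a -> a < b ->
  (\int[mu]_(xi in `](x + a)%R, (x + b)%R[) ((xi - x)^-1)%:E = (ln b - ln a)%:E)%E.
Proof.
move=> a0 ab.
have c t : 0 < t - x -> is_derive t 1 (fun xi => ln (xi - x)) (t - x)^-1.
  move=> tx; have h0 : is_derive t 1 (fun xi : R => xi - x) 1.
    by apply: is_derive_eq; rewrite subr0.
  have := @is_derive1_comp _ (@ln R) (fun xi => xi - x) t _ _ (is_derive1_ln tx) h0.
  by rewrite mulr1.
have cF t : 0 < t - x -> {for t, continuous (fun xi => ln (xi - x))}.
  by move=> tx; apply: differentiable_continuous; apply/derivable1_diffP; have [] := c t tx.
have cf t : 0 < t - x -> {for t, continuous (fun xi => (xi - x)^-1)}.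
  move=> tx; apply: cvgV; first by rewrite gt_eqF.
  by apply: cvgB; [exact: cvg_id|exact: cvg_cst].
have mf (A : set R) : measurable_fun A (fun xi : R => ((xi - x)^-1)%:E).
  apply/measurable_EFinP; apply: measurable_funTS.
  by apply: (measurableT_comp (inv_measurable R)); exact: measurable_funB.
rewrite -(@integral_itv_bndoo _ _ _ _ true false) //.
rewrite (@continuous_FTC2 _ _ (fun xi => ln (xi - x))).
- by rewrite !(addrC x) !addrK EFinB.
- by rewrite ltrD2l.
- apply: continuous_in_subspaceT => t; rewrite inE /= in_itv /= => /andP[h _].
  by apply: cf; lra.
- split.
  + move=> t; rewrite in_itv /= => /andP[h _].
    by have [] := c t ltac:(lra).
  + by apply: cvg_at_right_filter; apply: cF; lra.
  + by apply: cvg_at_left_filter; apply: cF; lra.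
- move=> t; rewrite in_itv /= => /andP[h _]; rewrite derive1E.
  by have [_] := c t ltac:(lra).
Qed.

Lemma integral_inv_left (a b : R) : 0 < a -> a < b ->
  (\int[mu]_(xi in `](x - b)%R, (x - a)%R[) ((xi - x)^-1)%:E = (ln a - ln b)%:E)%E.
Proof.
move=> a0 ab.
have c t : 0 < x - t -> is_derive t 1 (fun xi => ln (x - xi)) (t - x)^-1.
  move=> tx; have h0 : is_derive t 1 (fun xi : R => x - xi) (-1).
    by apply: is_derive_eq; rewrite add0r mul1r.
  have := @is_derive1_comp _ (@ln R) (fun xi => x - xi) t _ _ (is_derive1_ln tx) h0.
  by rewrite mulrN1 -invrN opprB.
have cF t : 0 < x - t -> {for t, continuous (fun xi => ln (x - xi))}.
  by move=> tx; apply: differentiable_continuous; apply/derivable1_diffP; have [] := c t tx.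
have cf t : 0 < x - t -> {for t, continuous (fun xi => (xi - x)^-1)}.
  move=> tx; apply: cvgV; first by rewrite lt_eqF // -subr_gt0 opprB add0r; lra.
  by apply: cvgB; [exact: cvg_id|exact: cvg_cst].
have mf (A : set R) : measurable_fun A (fun xi : R => ((xi - x)^-1)%:E).
  apply/measurable_EFinP; apply: measurable_funTS.
  by apply: (measurableT_comp (inv_measurable R)); exact: measurable_funB.
rewrite -(@integral_itv_bndoo _ _ _ _ true false) //.
rewrite (@continuous_FTC2 _ _ (fun xi => ln (x - xi))).
- by rewrite !subKr EFinB.
- by rewrite ltrD2l ltrN2.
- apply: continuous_in_subspaceT => t; rewrite inE /= in_itv /= => /andP[_ h].
  by apply: cf; lra.
- split.
  + move=> t; rewrite in_itv /= => /andP[_ h].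
    by have [] := c t ltac:(lra).
  + by apply: cvg_at_right_filter; apply: cF; lra.
  + by apply: cvg_at_left_filter; apply: cF; lra.
- move=> t; rewrite in_itv /= => /andP[_ h]; rewrite derive1E.
  by have [_] := c t ltac:(lra).
Qed.

(** On the support of the cutoff |xi| and |xi - 1| exceed [cut_radius], so only the truncation at x
    is felt, and the factors at 0 and 1 cancel. *)
Lemma cutoff_kernel_restrict eps : 0 < eps -> eps < cut_radius ->
  (fun xi => hker xi * cutoff xi) \_ (trunc_set eps) =
  (fun xi => (xi - x)^-1) \_ (`]x - cut_radius, x - eps[ `|` `]x + eps, x + cut_radius[).
Proof.
move=> e0 er; apply/funext => xi; rewrite /patch.
have r1 : 2 * cut_radius <= `|x| by rewrite /cut_radius; have := ge_min `|x| `|x| `|x - 1|; rewrite lexx /=; lra.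
have r2 : 2 * cut_radius <= `|x - 1|.
  by rewrite /cut_radius; have := ge_min `|x - 1| `|x| `|x - 1|; rewrite lexx orbT /=; lra.
have r3 : `|xi| <= `|x| + `|xi - x| by have := ler_normD x (xi - x); rewrite subrKC.
have r4 : `|x| <= `|xi| + `|xi - x|.
  by have := ler_normB xi (xi - x); rewrite opprB subrKC.
have r5 : `|x - 1| <= `|xi - 1| + `|xi - x|.
  have := ler_normB (xi - 1) (xi - x); rewrite (_ : xi - 1 - (xi - x) = x - 1) //; ring.
have mem : (xi \in `]x - cut_radius, x - eps[ `|` `]x + eps, x + cut_radius[) =
    (eps < `|xi - x| < cut_radius).
  rewrite in_setU !mem_setE !in_itv /=.
  case: (lerP 0 (xi - x)) => s; [rewrite ger0_norm //|rewrite ltr0_norm //]; apply/idP/idP.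
  - by move=> /orP[/andP[a b]|/andP[a b]]; apply/andP; split; lra.
  - by move=> /andP[a b]; apply/orP; right; apply/andP; split; lra.
  - by move=> /orP[/andP[a b]|/andP[a b]]; apply/andP; split; lra.
  - by move=> /andP[a b]; apply/orP; left; apply/andP; split; lra.
rewrite mem /cutoff.
have [h1|h1] := boolP (eps < `|xi - x|); last first.
  rewrite andFb ifF //; apply/negbTE; rewrite notin_setE => -[_ _].
  by rewrite (negbTE h1).
have [h2|h2] := boolP (`|xi - x| < cut_radius); last by rewrite andbF mulr0; case: ifP.
rewrite andTb ifT; last first.
  by rewrite inE; split => //; lra.
have n0 : xi != 0 by rewrite -normr_gt0; lra.
have n1 : xi - 1 != 0 by rewrite -normr_gt0; lra.
have nx : xi - x != 0 by rewrite -normr_gt0; lra.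
have nx1 : x - 1 != 0 by rewrite subr_eq0.
by rewrite /hker; field; rewrite n0 n1 nx x0 nx1.
Qed.

End Truncation.

Section Truncation.
Variable R : realType.
Local Notation mu := (@lebesgue_measure R).
Implicit Types (t xi eps : R) (W : R -> R).
Variable x : R.
Hypotheses (x0 : x != 0) (x1 : x != 1).
Local Notation hker := (hker R x).
Local Notation weight := (weight R x).
Local Notation cut_radius := (cut_radius R x).
Local Notation cutoff := (cutoff R x).
Local Notation remainder := (remainder R x).
Local Notation admissible := (admissible R x).
Local Notation hfun := (hfun R x).

Local Notation trunc_set := (trunc_set R x).

(** With r = [cut_radius], the two symmetric intervals contribute ln eps - ln r and ln r - ln
    eps. *)
Lemma cutoff_kernel_integral eps : 0 < eps -> eps < cut_radius ->
  mu.-integrable (trunc_set eps) (EFin \o (fun xi => hker xi * cutoff xi)) /\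
  (\int[mu]_(xi in trunc_set eps) (hker xi * cutoff xi))%R = 0.
Proof.
move=> e0 er.
set A : set R := `]x - cut_radius, x - eps[%classic; set B : set R := `]x + eps, x + cut_radius[%classic.
set f := fun xi : R => (xi - x)^-1.
have mA : measurable A by exact: measurable_itv. have mB : measurable B by exact: measurable_itv.
have mf (D : set R) : measurable_fun D f.
  apply: measurable_funTS.
  by apply: (measurableT_comp (inv_measurable R)); exact: measurable_funB.
have iAB : mu.-integrable (A `|` B) (EFin \o f).
  apply: measurable_bounded_integrable => //; first exact: measurableU.
  - apply: le_lt_trans (measureU2 _ _ _) _ => //.
    by rewrite /= !lebesgue_measure_itv /= ; case: ifP => _; case: ifP => _; rewrite ?ltry // -?EFinD ltry.
  - exact: mf.
  - exists eps^-1; split; first exact: num_real.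
    move=> M eM xi /= h; apply: le_trans (ltW eM).
    have hx : eps < `|xi - x|.
      by case: h; rewrite /A /B /= in_itv /= => /andP[h1 h2]; [rewrite ltr0_norm|rewrite gtr0_norm]; lra.
    by rewrite /f normfV lef_pV2 ?posrE ?(ltW hx) // (lt_trans e0).
have E := cutoff_kernel_restrict R x x0 x1 eps e0 er.
have mT := trunc_set_measurable R x eps.
have mAB : measurable (A `|` B) by exact: measurableU.
have r0 := cut_radius_gt0 R x x0 x1.
split.
  have [_] := @integrable_mkcond _ _ R mu (trunc_set eps) (EFin \o (fun xi => hker xi * cutoff xi)) mT.
  apply; have [+ _] := @integrable_mkcond _ _ R mu (A `|` B) (EFin \o f) mAB.
  by move=> /(_ iAB); rewrite !restrict_EFin E.
rewrite Rintegral_mkcond E -Rintegral_mkcond Rintegral_setU //.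
  rewrite /Rintegral (integral_inv_left R x) // (integral_inv_right R x) //=.
  ring.
apply/disj_setPS => xi [/=]; rewrite !in_itv /= => /andP[a1 a2] /andP[b1 b2]; lra.
Qed.

(** For small eps the truncated integral of W is that of its remainder, by [cutoff_kernel_integral];
    dominated convergence then removes the truncation. *)
Lemma truncated_hilbert_cvg W : admissible W ->
  truncated_hilbert W x eps @[eps --> 0^'+] --> hfun W.
Proof.
move=> aW; apply/cvg_at_rightP => u [u0 cu].
have r0 := cut_radius_gt0 R x x0 x1.
have iG := hker_remainder_integrable R x W aW.
have [mW _] := aW.
set G := fun xi => hker xi * remainder W xi.
pose T n := (\int[mu]_(xi in trunc_set (u n)) (G xi))%R.
have TE : \forall n \near \oo, T n = truncated_hilbert W x (u n).
  have : \forall n \near \oo, u n < cut_radius.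
    by apply: (cvgr_lt 0).
  apply: filterS => n un; have [iB B0] := cutoff_kernel_integral (u n) (u0 n) un.
  have mT := trunc_set_measurable R x (u n).
  rewrite /truncated_hilbert.
  transitivity (T n + W x * (\int[mu]_(xi in trunc_set (u n)) (hker xi * cutoff xi))%R).
    by rewrite B0 mulr0 addr0.
  rewrite -RintegralZl // -RintegralD //; last 2 first.
  - exact: integrableS iG.
  - have := @integrableZl _ _ R mu (trunc_set (u n)) mT (W x) _ iB; apply: eq_integrable => //.
  apply: eq_Rintegral => xi _; rewrite /G /remainder -/(hker xi); ring.
apply: (cvg_trans (near_eq_cvg TE)).
(* At a pole the truncated integrand is always 0; so is G, by the convention for inverses, and the
   pointwise limit holds there too. *)
have G0 xi : (xi == 0) || (xi == 1) || (xi == x) -> G xi = 0.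
  by move=> /orP[/orP[]|] /eqP E; rewrite /G /hker E ?subrr ?(mul0r, mulr0) ?invr0 ?(mul0r, mulr0).
pose F n xi := ((G \_ (trunc_set (u n))) xi)%:E.
have mF n : measurable_fun setT (F n).
  apply/measurable_EFinP; apply: (measurable_restrictT _ (trunc_set_measurable R x (u n))).1.
  by apply: measurable_funTS; exact: hker_remainder_measurable.
have [] := @dominated_convergence _ _ R mu setT measurableT F (EFin \o G) _ mF _ _ (integrable_abse iG).
- by apply/measurable_EFinP; exact: hker_remainder_measurable.
- apply: aeW => xi _; apply: cvg_EFin; first exact: nearW.
  have [h|h] := boolP ((xi == 0) || (xi == 1) || (xi == x)).
    rewrite G0 //; apply: (@cvg_trans _ ((fun=> (0 : R)) @ \oo)); last exact: cvg_cst.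
    apply: near_eq_cvg; apply: nearW => n; rewrite /= /patch; case: ifP => // _.
    by rewrite G0.
  move: h; rewrite !negb_or => /andP[/andP[h0 h1] hx].
  have near_lt (t : R) : t != 0 -> \forall n \near \oo, u n < `|t|.
    by move=> t0; apply: (cvgr_lt 0) => //; rewrite normr_gt0.
  have n0 := near_lt xi h0.
  have n1 := near_lt (xi - 1); have n2 := near_lt (xi - x).
  rewrite !subr_eq0 in n1 n2; have {}n1 := n1 h1; have {}n2 := n2 hx.
  apply: (@cvg_trans _ ((fun=> G xi) @ \oo)); last exact: cvg_cst.
  apply: near_eq_cvg; near=> n.
  rewrite /= /patch mem_set //; split; near: n; [exact: n0|exact: n1|exact: n2].
- apply: aeW => xi n _ /=; rewrite lee_fin /patch; case: ifP => // _.
  by rewrite normr0.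
move=> _ _ H.
apply: fine_cvg; rewrite fineK; last first.
  exact: (integrable_fin_num measurableT (hker_remainder_integrable _ _ _ aW)).
rewrite (_ : (fun n => \int[mu]_(xi in trunc_set (u n)) (G xi)%:E)%E =
  (fun n => \int[mu]_xi F n xi)%E); first exact: H.
apply/funext => n; rewrite integral_mkcond; apply: eq_integral => xi _.
by rewrite /F restrict_EFin.
Unshelve. all: by end_near.
Qed.

Lemma hilbert_hfun W : admissible W -> hilbert W x = - pi^-1 * hfun W.
Proof.
move=> aW; rewrite /hilbert (negbTE x0) (negbTE x1) /=.
by rewrite (cvg_lim _ (truncated_hilbert_cvg W aW)).
Qed.

End Truncation.

(** * Convergence of the double series *)

Section Admissible.
Variable R : realType.
Implicit Types (t xi eps : R) (W V : R -> R) (e : edge).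
Local Notation sqrt := (@Num.sqrt R).
Local Notation growth := (growth R).

Lemma growth_ge1 xi : 1 <= growth xi.
Proof.
by rewrite -[leLHS]mulr1; apply: ler_pM => //; rewrite ?sqrt_ge1 ?lerDl.
Qed.

(** The minimum in [pole_dist] is one of its four entries, and a distance above 1 is covered by the
    plain growth bound. *)
Lemma le_weight x C D xi : 0 <= C -> D <= C * growth xi ->
  (`|xi| <= 1 -> D <= C * (growth xi * sqrt `|xi|)) ->
  (`|xi - 1| <= 1 -> D <= C * (growth xi * sqrt `|xi - 1|)) ->
  (`|xi - x| <= 1 -> D <= C * (growth xi * sqrt `|xi - x|)) ->
  D <= C * weight R x xi.
Proof.
move=> C0 h h0 h1 hx; rewrite /weight /pole_dist.
have key y : D <= C * (growth xi * sqrt y) -> forall z, D <= C * (growth xi * sqrt z) ->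
   D <= C * (growth xi * sqrt (Num.min y z)).
  by move=> hy z hz; rewrite /Num.min; case: ifP.
have g : D <= C * (growth xi * sqrt 1) by rewrite sqrtr1 mulr1.
have big y : (y <= 1 -> D <= C * (growth xi * sqrt y)) -> D <= C * (growth xi * sqrt y).
  move=> hy; have [/hy //|y1] := leP y 1.
  apply: le_trans h _; apply: ler_wpM2l => //; rewrite -[leLHS]mulr1.
  by apply: ler_wpM2l; [exact: growth_ge0|rewrite sqrt_ge1 // ltW].
apply: (key) => //; apply: (key); first exact: (big).
by apply: (key); exact: (big).
Qed.

Lemma id_le_sqrt y : 0 <= y -> y <= 1 -> y <= sqrt y.
Proof.
move=> y0 y1; rewrite -[leLHS](sqr_sqrtr y0) expr2.
by apply: ler_piMl; [exact: sqrtr_ge0|exact: sqrt_le1].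
Qed.

(** Near 0 and 1 both W and the cutoff vanish, the latter through its factor xi (xi - 1). Near x the
    remainder is (W xi - W x) + W x (1 - c), where the cutoff c is 1 at x. *)
Lemma tame_admissible x H W : x != 0 -> x != 1 -> measurable_fun setT W -> tame R H W ->
  W 0 = 0 -> W 1 = 0 -> admissible R x W.
Proof.
move=> x0 x1 mW [H0 hW gW] W0 W1; split=> //.
set r := cut_radius R x; have r0 : 0 < r by exact: cut_radius_gt0.
have nx0 : 0 < `|x| by rewrite normr_gt0.
have nx1 : 0 < `|x - 1| by rewrite normr_gt0 subr_eq0.
set P := `|x * (x - 1)|; have P0 : 0 < P by rewrite /P normrM mulr_gt0.
pose m := `|x| + r + 2.
have m0 : 0 < m by rewrite /m; lra.
(* H sqrt (1 + |x|) serves the pole x, and 2 H the poles 0 and 1. On its support the cutoff is at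
   most m^2 / P, since m bounds |xi| and |xi - 1| there; 1/r serves the points off the support,
   where 1 <= |xi - x| / r. *)
pose C := H * sqrt (1 + `|x|) + 2 * H + `|W x| * (m * m / P + r^-1).
have Wx0 : 0 <= `|W x| by [].
have s0 : 0 <= sqrt (1 + `|x|) by rewrite sqrtr_ge0.
have mP : 0 <= m * m / P by rewrite ltW // divr_gt0 // mulr_gt0.
have ri : 0 <= r^-1 by rewrite invr_ge0 ltW.
have C0 : 0 <= C by rewrite !addr_ge0 ?mulr_ge0 ?addr_ge0.
have cut xi : `|cutoff R x xi| * P <= `|xi| * `|xi - 1| /\ `|cutoff R x xi| <= m * m / P.
  rewrite /cutoff -/r; case: ifPn => h; last first.
    by rewrite normr0 mul0r mulr_ge0.
  rewrite normrM normfV -/P normrM divfK ?gt_eqF //; split => //.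
  rewrite ler_wpM2r ?invr_ge0 ?(ltW P0) //; apply: ler_pM => //.
    have := ler_normD x (xi - x); rewrite subrKC /m; lra.
  have := ler_normB (x + (xi - x)) 1; have := ler_normD x (xi - x).
  by rewrite subrKC normr1 /m; lra.
exists C => xi; set c := cutoff R x xi; have [c1 c2] := cut xi.
have g1 := growth_ge1 xi.
rewrite /remainder -/c.
have tri : `|W xi - W x * c| <= `|W xi| + `|W x| * `|c| by rewrite -normrM ler_normB.
have m2 : 4 <= m * m by rewrite (_ : 4 = 2 * 2); [apply: ler_pM; rewrite /m; clear -r0 nx0; lra|ring].
have B1 : 0 <= H * sqrt (1 + `|x|) by rewrite mulr_ge0.
have B2 : 0 <= `|W x| * r^-1 by rewrite mulr_ge0.
have B3 : 0 <= `|W x| * (m * m / P) by rewrite mulr_ge0.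
have CE : C = H * sqrt (1 + `|x|) + 2 * H + `|W x| * (m * m / P) + `|W x| * r^-1.
  by rewrite /C mulrDr addrA.
have up k t : k <= C -> 0 <= k -> k * sqrt t <= C * (growth xi * sqrt t).
  move=> kC k0; have st : 0 <= sqrt t by rewrite sqrtr_ge0.
  by apply: ler_pM => //; rewrite ler_peMl.
have root (a : R) : `|xi - a| <= 1 -> W a = 0 -> `|a| <= 1 -> `|c| <= m * m / P * `|xi - a| ->
    `|W xi| + `|W x| * `|c| <= C * (growth xi * sqrt `|xi - a|).
  move=> h Wa a1 ct.
  have st := sqrtr_ge0 `|xi - a|.
  have h1 : `|W xi| <= 2 * H * sqrt `|xi - a|.
    rewrite -[W xi]subr0 -Wa distrC; apply: le_trans (hW _ _ _) _; rewrite distrC // mulrA.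
    apply: ler_pM; rewrite ?mulr_ge0 ?sqrtr_ge0 ?pow34_ge0 ?pow34_le_sqrt //.
    rewrite mulrC ler_wpM2r // -(ler_pXn2r (n := 2)) ?nnegrE ?sqrtr_ge0 // sqr_sqrtr ?addr_ge0 //.
    by rewrite expr2; clear -a1; have := normr_ge0 a; nra.
  have h2 : `|W x| * `|c| <= `|W x| * (m * m / P) * sqrt `|xi - a|.
    rewrite -mulrA ler_wpM2l //; apply: le_trans ct _; rewrite ler_wpM2l //.
    by apply: id_le_sqrt.
  apply: le_trans (lerD h1 h2) _; rewrite -mulrDl; apply: up; first by rewrite CE; clear -B1 B2 B3 H0; lra.
  by apply: addr_ge0 => //; apply: mulr_ge0.
have cP u v : 0 <= u -> v <= 2 -> `|xi| * `|xi - 1| = u * v -> `|c| <= m * m / P * u.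
  move=> u0 v2 uv; rewrite mulrAC ler_pdivlMr //; apply: le_trans c1 _; rewrite uv mulrC.
  by apply: ler_wpM2r => //; clear -v2 m2; lra.
have root0 : `|xi| <= 1 -> `|W xi| + `|W x| * `|c| <= C * (growth xi * sqrt `|xi|).
  move=> h; have := root 0; rewrite subr0 normr0; apply=> //.
  apply: (cP _ `|xi - 1|) => //; apply: le_trans (ler_normB _ _) _; rewrite normr1; clear -h; lra.
have root1 : `|xi - 1| <= 1 -> `|W xi| + `|W x| * `|c| <= C * (growth xi * sqrt `|xi - 1|).
  move=> h; apply: root; rewrite ?normr1 //.
  apply: (cP _ `|xi|) => //; last by rewrite mulrC.
  have := ler_normD (xi - 1) 1; rewrite subrK normr1; clear -h; lra.
apply: le_weight => //.
- apply: le_trans tri _; apply: (@le_trans _ _ (H * growth xi + `|W x| * (m * m / P) * growth xi)).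
    apply: lerD => //; apply: (@le_trans _ _ (`|W x| * (m * m / P))); last by rewrite ler_peMr.
    by rewrite ler_wpM2l.
  rewrite -mulrDl; apply: ler_wpM2r; first exact: growth_ge0.
  by rewrite CE; clear -B1 B2 B3 H0; lra.
- by move=> h; apply: le_trans tri _; exact: root0.
- by move=> h; apply: le_trans tri _; exact: root1.
- move=> h; set y := `|xi - x| in h *.
  have y0 : 0 <= y by exact: normr_ge0.
  have ys : y <= sqrt y by exact: id_le_sqrt.
  have sy : 0 <= sqrt y by rewrite sqrtr_ge0.
  have -> : W xi - W x * c = (W xi - W x) + W x * (1 - c) by ring.
  have h1 : `|W xi - W x| <= H * sqrt (1 + `|x|) * sqrt y.
    rewrite distrC; apply: le_trans (hW _ _ _) _; rewrite distrC -/y // mulrA.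
    by apply: ler_wpM2l => //; exact: pow34_le_sqrt.
  have h2 : `|1 - c| <= (m * m / P + r^-1) * sqrt y.
    rewrite mulrDl /c /cutoff -/r -/y; case: ifPn => hy.
      have xx : x * (x - 1) != 0 by rewrite mulf_neq0 // subr_eq0.
      have -> : 1 - xi * (xi - 1) / (x * (x - 1)) = (x - xi) * (x + xi - 1) / (x * (x - 1)).
        by field; rewrite x0 subr_eq0 x1.
      rewrite [X in X <= _]normrM normfV -/P [`|(x - xi) * _|]normrM distrC -/y.
      rewrite -[leLHS]addr0; apply: lerD; last by rewrite mulr_ge0.
      rewrite [leRHS]mulrAC ler_wpM2r ?invr_ge0 ?(ltW P0) // mulrC; apply: ler_pM => //.
      apply: le_trans (ler_normB _ _) _; rewrite normr1.
      have h3 := ler_normD x xi; have h4 := ler_normD x (xi - x); rewrite subrKC -/y in h4.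
      have h5 : 2 * m <= m * m by apply: ler_wpM2r; rewrite /m; clear -r0 nx0; lra.
      by apply: le_trans h5; rewrite /m; clear -r0 h h3 h4; lra.
    rewrite subr0 normr1 -[leLHS]add0r; apply: lerD; first by rewrite mulr_ge0.
    rewrite mulrC ler_pdivlMr // mul1r; apply: le_trans ys.
    by rewrite leNgt.
  apply: le_trans (ler_normD _ _) _; rewrite [`|W x * _|]normrM.
  apply: (@le_trans _ _ (H * sqrt (1 + `|x|) * sqrt y + `|W x| * ((m * m / P + r^-1) * sqrt y))).
    by apply: lerD => //; rewrite ler_wpM2l.
  rewrite [`|W x| * _]mulrA -mulrDl; apply: up; first by rewrite CE mulrDr; clear -B1 B2 B3 H0; lra.
  by apply: addr_ge0 => //; apply: mulr_ge0 => //; apply: addr_ge0.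
Qed.

End Admissible.

Section Elementary.
Variable R : realType.
Implicit Types (t xi eta : R) (W V : R -> R) (e : edge).

(** Together with [gap1] it permits a = 0 and a = 1 in [key_estimate], which gives the majorant its
    zeros at these poles. *)
Lemma gap0 e : ~~ gap R e 0.
Proof.
rewrite /gap /al /be !mulr0 subr0 sub0r oppr_gt0 ltr0z ltrz0.
by have := edge_sign e; lia.
Qed.

Lemma gap1 e : ~~ gap R e 1.
Proof.
rewrite /gap /al /be !mulr1 !subr_gt0 !ltr_int.
have := edge_sign e; have := edge_det e; have := edge_oo_r e; have := eb_ge0 e; have := ed_ge0 e.
move: (ea e) (eb e) (ec e) (ed e) => a b c d d0 b0 h D sg.
apply/negP => /andP[h1 h2].
have a0 : 0 <= a by lia.
(* From a < b and d < c. With b c = a d + 1 it forces a = d = 0, but an edge ending at oo has a >=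
   1. *)
have : (a + 1) * (d + 1) <= b * c by nia.
move=> h3; have a1 : a = 0 by nia. have d1 : d = 0 by nia.
by have := h d1; lia.
Qed.

(** Inside the gap the difference quotient is [eb e * al e eta - ed e * be e xi], a difference of
    two numbers in [0, 1]. Towards a point outside, one factor is at most its slope times the
    distance, and this slope times the other factor is at most 1. *)
Lemma elementary_lipschitz e xi eta :
  `|elementary_field e xi - elementary_field e eta| <= `|xi - eta| :> R.
Proof.
have D := edge_detR R e.
have b0 : 0 <= (eb e)%:~R :> R by rewrite ler0z eb_ge0.
have d0 : 0 <= (ed e)%:~R :> R by rewrite ler0z ed_ge0.
have sum1 t : (eb e)%:~R * al R e t + (ed e)%:~R * be R e t = 1.
  by rewrite -[RHS]D /al /be; ring.
have ad t u : al R e t - al R e u = (ed e)%:~R * (u - t) by rewrite /al; ring.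
have bd t u : be R e t - be R e u = (eb e)%:~R * (t - u) by rewrite /be; ring.
have le1 t : gap R e t -> [/\ 0 < al R e t, 0 < be R e t,
    (eb e)%:~R * al R e t <= 1 & (ed e)%:~R * be R e t <= 1].
  move=> /andP[a1 b1]; have s := sum1 t.
  have ba : 0 <= (eb e)%:~R * al R e t by rewrite mulr_ge0 // ltW.
  have db : 0 <= (ed e)%:~R * be R e t by rewrite mulr_ge0 // ltW.
  by split => //; clear -s ba db; lra.
have out t u : gap R e t -> ~~ gap R e u -> `|al R e t * be R e t| <= `|t - u|.
  move=> /le1[a1 b1 ba db] hu; rewrite ger0_norm ?mulr_ge0 ?(ltW a1) ?(ltW b1) //.
  move: hu; rewrite /gap negb_and -!leNgt => /orP[h|h].
    have h1 : al R e t <= (ed e)%:~R * (u - t) by rewrite -ad; clear -h; lra.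
    apply: (@le_trans _ _ ((ed e)%:~R * (u - t) * be R e t)); first by rewrite ler_wpM2r // ltW.
    rewrite mulrAC; apply: le_trans (ler_norm _) _; rewrite normrM [`|t - u|]distrC.
    rewrite -[leRHS]mul1r; apply: ler_wpM2r => //.
    by rewrite ger0_norm // mulr_ge0 // ltW.
  have h1 : be R e t <= (eb e)%:~R * (t - u) by rewrite -bd; clear -h; lra.
  apply: (@le_trans _ _ (al R e t * ((eb e)%:~R * (t - u)))); first by rewrite ler_wpM2l // ltW.
  rewrite mulrA; apply: le_trans (ler_norm _) _; rewrite normrM.
  rewrite -[leRHS]mul1r; apply: ler_wpM2r => //.
  by rewrite ger0_norm mulrC // mulr_ge0 // ltW.
rewrite !elementary_fieldE; case: ifPn => h1; case: ifPn => h2.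
- have [a1 b1 ba1 db1] := le1 _ h1; have [a2 b2 ba2 db2] := le1 _ h2.
  have -> : al R e xi * be R e xi - al R e eta * be R e eta =
      ((eb e)%:~R * al R e eta - (ed e)%:~R * be R e xi) * (xi - eta).
    transitivity ((al R e xi - al R e eta) * be R e xi + al R e eta * (be R e xi - be R e eta)).
      by ring.
    by rewrite ad bd; ring.
  rewrite normrM -[leRHS]mul1r; apply: ler_wpM2r => //.
  have p1 : 0 <= (eb e)%:~R * al R e eta by rewrite mulr_ge0 // ltW.
  have p2 : 0 <= (ed e)%:~R * be R e xi by rewrite mulr_ge0 // ltW.
  by rewrite ler_norml; clear -p1 p2 ba2 db1; apply/andP; split; lra.
- by rewrite subr0; exact: out.
- by rewrite sub0r normrN distrC; exact: out.
- by rewrite subrr normr0.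
Qed.

Lemma elementary_field0 e : elementary_field e 0 = 0 :> R.
Proof. by rewrite elementary_fieldE (negbTE (gap0 e)). Qed.

Lemma elementary_field1 e : elementary_field e 1 = 0 :> R.
Proof. by rewrite elementary_fieldE (negbTE (gap1 e)). Qed.

Lemma elementary_continuous e : continuous (elementary_field e : R -> R).
Proof.
move=> x; apply/cvgrPdist_lt => eps eps0; near=> y.
apply: le_lt_trans (elementary_lipschitz e x y) _.
by near: y; apply: cvgr_dist_lt => //; exact: cvg_id.
Unshelve. all: by end_near. Qed.

Lemma elementary_tame e : tame R 1 (elementary_field e).
Proof.
split => // [x y xy|x]; rewrite mul1r.
  apply: le_trans (elementary_lipschitz e x y) _.
  have s1 : 1 <= Num.sqrt (1 + `|x|) by apply: sqrt_ge1; rewrite lerDl.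
  have p1 : `|x - y| <= pow34 R `|x - y| by apply: pow34_ge_id; rewrite normr_ge0 xy.
  by apply: le_trans p1 _; rewrite ler_peMl // pow34_ge0.
have := elementary_lipschitz e x 0; rewrite elementary_field0 !subr0 => h.
apply: le_trans h _; apply: (@le_trans _ _ (1 + `|x|)); first by rewrite lerDr.
by rewrite ler_peMr ?addr_ge0 // sqrt_ge1 // lerDl.
Qed.

Lemma elementary_admissible x e : x != 0 -> x != 1 -> admissible R x (elementary_field e).
Proof.
move=> x0 x1; apply: (tame_admissible R x 1 _ x0 x1).
- exact: continuous_measurable_fun (elementary_continuous e).
- exact: elementary_tame.
- exact: elementary_field0.
- exact: elementary_field1.
Qed.

Lemma key_weight H V x e xi : tame R H V -> gap R e xi -> ~~ gap R e x ->
  `|V xi - Qr R V e xi| <= 12 * H * weight R x xi.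
Proof.
move=> tV ge gx; have H0 : 0 <= H by case: tV.
have key a := key_estimate R H V tV e xi a ge.
have m1 (y : R) : y <= 1 -> Num.min 1 y = y by move=> h; rewrite min_r.
apply: le_weight.
- by rewrite mulr_ge0.
- apply: le_trans (key x gx) _; apply: ler_wpM2l; first by rewrite mulr_ge0.
  rewrite -[leRHS]mulr1; apply: ler_wpM2l; first exact: growth_ge0.
  by rewrite -[leRHS]sqrtr1; apply: ler_wsqrtr; rewrite ge_min lexx.
- by move=> h; have := key 0 (gap0 e); rewrite subr0 m1.
- by move=> h; have := key 1 (gap1 e); rewrite m1.
- by move=> h; have := key x gx; rewrite m1.
Qed.

End Elementary.

(** * The inner sums *)

Section Fans.
Variable R : realType.
Variables (V : R -> R) (s : edge -> R).
Hypothesis s_shear : shear_function V s.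
Variable (E : Qhat -> int -> edge).
Hypothesis E_enum : fan_enumeration E.
Variable H : R.
Hypothesis V_tame : tame R H V.
Variable x : R.
Hypotheses (x0 : x != 0) (x1 : x != 1).
Implicit Types (e f g : edge) (xi : R) (c : edge -> edge).
Local Notation bend := (bend R s).
Local Notation weight := (weight R x).
Local Notation remainder := (remainder R x).
Local Notation hfun := (hfun R x).
Local Notation fan_sum := (fan_sum R s E).

(** The sum telescopes to a difference of two interpolants, each within 12 H times the weight of V.
    Starting at [c e] makes the subtracted one [Qr e], with x outside the gap of e as [key_weight]
    requires. *)
Lemma tail_bound c e K xi : is_child c -> ~~ gap R e x ->
  `|\sum_(k < K) bend (iter k c (c e)) xi| <= 24 * H * weight xi.
Proof.
move=> hc ex; have H0 : 0 <= H by case: V_tame.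
have b0 : 0 <= 24 * H * weight xi by apply: mulr_ge0; [rewrite mulr_ge0|exact: weight_ge0].
case: (boolP (gap R (c e) xi)) => h; last first.
  by rewrite (chain_sum_out R V s s_shear) // normr0.
case: K => [|K]; first by rewrite big_ord0 normr0.
have [_ [j [-> h1 h2]]] := chain_last R c (c e) xi hc h.
rewrite (chain_sum_last R V s s_shear c (c e) xi j K hc h1 h2) Ql_child //.
set f := iter _ c (c e).
have gf : gap R f xi by exact: (gap_iter_sub R c (c e) xi (minn j K) j hc (geq_minl _ _)).
have nf : ~~ gap R f x.
  apply: contra ex; rewrite /f -iterSr => hh.
  exact: (gap_iter_sub R c e x 0 _ hc (leq0n _) hh).
have k1 := key_weight R H V x f xi V_tame gf nf.
have k2 := key_weight R H V x e xi V_tame (gap_child R c e xi hc h) ex.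
have -> : Qr R V f xi - Qr R V e xi = (V xi - Qr R V e xi) - (V xi - Qr R V f xi) by ring.
apply: le_trans (ler_normB _ _) _; apply: le_trans (lerD k2 k1) _.
by rewrite -mulrDl -mulrDl (_ : 12 + 12 = 24) //; ring.
Qed.

Definition dominated_chain c e := exists C, forall K xi,
  `|remainder (fun t => \sum_(k < K) bend (iter k c e) t) xi| <= C * weight xi.

Lemma dominated_chain_out c e : is_child c -> ~~ gap R e x -> dominated_chain c (c e).
Proof.
move=> hc ex; exists (24 * H) => K xi.
have z : \sum_(k < K) bend (iter k c (c e)) x = 0.
  by apply: (chain_sum_out R V s s_shear) => //; apply: contra ex; exact: gap_child.
by rewrite /remainder z mul0r subr0; exact: tail_bound.
Qed.

Lemma bend_admissible e : admissible R x (bend e).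
Proof. by apply: admissibleZ; exact: elementary_admissible. Qed.

Lemma dominated_chain_step c e : is_child c -> dominated_chain c (c e) -> dominated_chain c e.
Proof.
move=> hc [C hC]; have [_ [D hD]] := bend_admissible e.
exists (`|C| + `|D|) => -[|K] xi.
  rewrite /remainder !big_ord0 mul0r subrr normr0.
  by apply: mulr_ge0; [exact: addr_ge0|exact: weight_ge0].
rewrite (_ : (fun t => _) = fun t => bend e t + \sum_(k < K) bend (iter k c (c e)) t); last first.
  by apply/funext => t; rewrite big_ord_recl; congr (_ + _); apply: eq_bigr => k _; rewrite -iterSr.
rewrite remainderD addrC; apply: le_trans (ler_normD _ _) _; rewrite [leRHS]mulrDl.
by apply: lerD; [apply: le_trans (hC K xi) _|apply: le_trans (hD xi) _];
  apply: ler_wpM2r; rewrite ?weight_ge0 ?ler_norm.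
Qed.

(** Only finitely many edges of the chain have x in their gap; they are added one by one to a tail
    that is bounded uniformly. *)
Lemma dominated_chainP c e : is_child c -> dominated_chain c e.
Proof.
move=> hc; have [j] := chain_escape R c e x hc.
elim: j e => [|j IH] e h; first by apply: dominated_chain_step => //; exact: dominated_chain_out.
by apply: dominated_chain_step => //; apply: IH; rewrite -iterSr.
Qed.

Lemma fan_hfun p : admissible R x (fan_sum p) /\
  symmetric_sum (fun n => hfun (bend (E p n))) @ \oo --> hfun (fan_sum p).
Proof.
have [C hC] := dominated_chainP childR (E p 1) (or_intror erefl).
have [D hD] := dominated_chainP childL (E p 0) (or_introl erefl).
pose F M xi := symmetric_sum (fun n => bend (E p n) xi) M.
have -> : symmetric_sum (fun n => hfun (bend (E p n))) = fun M => hfun (F M).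
  apply/funext => M; rewrite /symmetric_sum -hfun_sum // => k; exact: bend_admissible.
apply: (@hfun_dominated R x F (fan_sum p) (C + D)).
- move=> M; rewrite /F /symmetric_sum; apply: (proj1 (admissible_sum R x _ _ (fun k t => bend (E p (k%:Z - M%:Z)) t) _)) => k.
  exact: bend_admissible.
- move=> M xi; rewrite (_ : F M = fun t => \sum_(k < M) bend (iter k childR (E p 1)) t
   + \sum_(k < M.+1) bend (iter k childL (E p 0)) t).
    rewrite remainderD; apply: le_trans (ler_normD _ _) _; rewrite [leRHS]mulrDl.
    exact: lerD.
  apply/funext => t; rewrite /F symmetric_sumE; congr (_ + _); apply: eq_bigr => k _.
    by rewrite (E_iterR _ E_enum).
  by rewrite (E_iterL _ E_enum).
- by move=> xi; exact: (fan_sum_cvg R V s s_shear E E_enum p xi).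
Qed.

Lemma fan_hilbert_cvg p :
  symmetric_sum (fun n => s (E p n) / 2 * hilbert (elementary_field (E p n)) x) @ \oo -->
  - pi^-1 / 2 * hfun (fan_sum p).
Proof.
have [_ h] := fan_hfun p.
rewrite (_ : symmetric_sum _ = fun M => - pi^-1 / 2 * symmetric_sum (fun n => hfun (bend (E p n))) M).
  by apply: cvgM => //; exact: cvg_cst.
apply/funext => M; rewrite /symmetric_sum big_distrr; apply: eq_bigr => k _ /=.
rewrite hfunZ //; last exact: elementary_admissible.
by rewrite hilbert_hfun //; [ring|exact: elementary_admissible].
Qed.

End Fans.

(** * The outer sum *)

Section Levels.
Variable R : realType.
Variables (V : R -> R) (s : edge -> R).
Hypothesis s_shear : shear_function V s.
Hypotheses (V0 : V 0 = 0) (V1 : V 1 = 0).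
Variable (E : Qhat -> int -> edge).
Hypothesis E_enum : fan_enumeration E.
Variable H : R.
Hypothesis V_tame : tame R H V.
Implicit Types (e f g : edge) (xi : R) (c : edge -> edge).
Local Notation fan_sum := (fan_sum R s E).
Local Notation level_sum := (level_sum R s E).

(** B is abstract because it is a small constant for the pointwise limit and a multiple of the
    weight for the domination. The interpolants belong to edges below a gap of the level, so q lies
    outside their gaps as well. *)
Lemma level_error n xi (q : rat) B : Some q \in farey_upto n.+2 -> 0 <= B ->
  (forall f, gap R f xi -> ~~ gap R f (ratr q) -> `|V xi - Qr R V f xi| <= B) ->
  `|2 * V xi - level_sum n.+2 xi| <= 2 * B.
Proof.
move=> hq B0 hB; case: (level_sumP R V s s_shear V0 V1 E E_enum n xi) => [[_ ->]|].
  by rewrite subrr normr0 mulr_ge0.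
move=> [e [he ge [f [g [hf hg ->]]]]].
have nq := level_gap_out R _ _ _ he hq.
have last c h : is_child c -> is_last R c e xi h -> `|V xi - Qr R V h xi| <= B.
  move=> hc [j [-> h1 _]]; apply: hB => //; apply: contra nq.
  exact: (gap_iter_sub R c e _ 0 j hc).
have := last childL f (or_introl erefl) hf; have := last childR g (or_intror erefl) hg.
rewrite !ler_norml => /andP[a1 a2] /andP[b1 b2]; apply/andP; clear -a1 a2 b1 b2; split; lra.
Qed.

Lemma level_sum_in n (q : rat) : Some q \in farey_upto n.+2 ->
  level_sum n.+2 (ratr q) = 2 * V (ratr q).
Proof.
move=> hq; case: (level_sumP R V s s_shear V0 V1 E E_enum n (ratr q)) => [[_ ->] //|].
by move=> [e [he ge _]]; have := level_gap_out R _ _ _ he hq; rewrite ge.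
Qed.

Lemma level_sum_cvg xi : (fun n => level_sum n xi) @ \oo --> 2 * V xi.
Proof.
have H0 : 0 <= H by case: V_tame.
apply/cvgrPdist_le => eps eps0.
pose K := 12 * H * growth R xi + 1.
have g0 := growth_ge0 R xi.
have K0 : 0 < K by rewrite ltr_pwDr // mulr_ge0 // mulr_ge0.
(* Chosen so that K sqrt d = eps / 2; the summand 1 keeps K positive. *)
pose d := (eps / (2 * K)) ^+ 2.
have ek0 : 0 < eps / (2 * K) by rewrite divr_gt0 // mulr_gt0.
have d0 : 0 < d by rewrite exprn_gt0.
have /rat_in_itvoo[q] : xi < xi + d by rewrite ltrDl.
rewrite in_itv /= => /andP[q1 q2].
have [k hk] := upto_rat R q.
have qd : `|xi - ratr q| <= d by rewrite distrC ger0_norm; lra.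
near=> m.
have hm : (k.+2 <= m)%N by near: m; exact: nbhs_infty_ge.
have hq : Some q \in farey_upto m.-2.+2 by apply: hk; lia.
have mE : m = m.-2.+2 by lia.
rewrite mE (_ : eps = 2 * (K * (eps / (2 * K)))); last by field; rewrite gt_eqF.
apply: (level_error _ _ q) => //; first by rewrite mulr_ge0 // ltW.
move=> f gf nf; apply: le_trans (key_estimate R H V V_tame f xi (ratr q) gf nf) _.
rewrite mulrA; apply: ler_pM; rewrite ?sqrtr_ge0 //.
- by rewrite mulr_ge0 // mulr_ge0.
- by rewrite /K lerDl.
- have -> : eps / (2 * K) = Num.sqrt d by rewrite sqrtr_sqr gtr0_norm.
  by apply: ler_wsqrtr; rewrite ge_min qd orbT.
Unshelve. all: by end_near. Qed.

Hypothesis V_cont : continuous V.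
Variable q : rat.
Let x : R := ratr q.
Hypotheses (x0 : x != 0) (x1 : x != 1).
Local Notation hfun := (hfun R x).

Lemma field_admissible : admissible R x V.
Proof.
by apply: (tame_admissible R x H V x0 x1) => //; exact: continuous_measurable_fun.
Qed.

Lemma level_admissible n : admissible R x (level_sum n).
Proof.
apply: admissible_sum => p.
by have [] := fan_hfun R V s s_shear E E_enum H V_tame x x0 x1 p.
Qed.

(** The sequence is shifted to the levels that contain q. From there on the partial sums equal 2 V
    at x, so the cutoff terms cancel and the remainder differs from twice that of V by the quantity
    in [level_error]. *)
Lemma level_hfun_cvg : (fun n => hfun (level_sum n)) @ \oo --> 2 * hfun V.
Proof.
have H0 : 0 <= H by case: V_tame.
have aV := field_admissible; have [_ [C hC]] := aV.
rewrite -hfunZ //.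
have [k hk] := upto_rat R q.
rewrite -(cvg_shiftn k.+2) /=.
have [||//|_] := @hfun_dominated R x (fun n => level_sum (n + k.+2)) (fun t => 2 * V t)
  (2 * C + 2 * (12 * H)).
- by move=> n; exact: (proj1 (level_admissible _)).
- move=> n xi; rewrite addnS addnS.
  rewrite (_ : remainder R x _ xi = 2 * remainder R x V xi - (2 * V xi - level_sum (n + k).+2 xi)).
    apply: le_trans (ler_normB _ _) _; rewrite [leRHS]mulrDl; apply: lerD.
      by rewrite normrM ger0_norm // -[leRHS]mulrA ler_wpM2l.
    rewrite -[leRHS]mulrA; apply: (level_error _ _ q); first by rewrite hk // leq_addl.
      by apply: mulr_ge0; [rewrite mulr_ge0|exact: weight_ge0].
    by move=> f; exact: key_weight.
  by rewrite /remainder level_sum_in ?hk ?leq_addl //; ring.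
- move=> xi; rewrite (cvg_shiftn k.+2 (fun n => level_sum n xi)); exact: level_sum_cvg.
- by [].
Qed.

Lemma hilbert_farey_cvg :
  farey_sum (fun p => limn (symmetric_sum (fun n =>
    s (E p n) / 2 * hilbert (elementary_field (E p n)) x))) @ \oo --> hilbert V x.
Proof.
rewrite hilbert_hfun //; last exact: field_admissible.
rewrite (_ : farey_sum _ = fun n => - pi^-1 / 2 * hfun (level_sum n)).
  rewrite (_ : _ * hfun V = - pi^-1 / 2 * (2 * hfun V)); last by move: pi^-1 (hfun V) => u v; field.
  by apply: cvgM; [exact: cvg_cst|exact: level_hfun_cvg].
have aF p : admissible R x (fan_sum p).
  by have [] := fan_hfun R V s s_shear E E_enum H V_tame x x0 x1 p.
apply/funext => n; rewrite /level_sum /farey_sum hfun_sum // big_distrr.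
apply: eq_bigr => p _ /=; apply: cvg_lim => //.
exact: (fan_hilbert_cvg R V s s_shear E E_enum H V_tame x x0 x1 p).
Qed.

End Levels.

(** * From values of the transform to its infinitesimal shear *)

Section Summation.
Variable R : realType.
Implicit Types (t u : Qhat -> int -> R) (k l : R).

(** Inner convergence is included because [limn] also assigns a value to divergent sequences; with
    it both limits pass to linear combinations. *)
Definition farey_summable t l :=
  (forall p, cvgn (symmetric_sum (t p))) /\
  farey_sum (fun p => limn (symmetric_sum (t p))) @ \oo --> l.

Lemma farey_summable_comb t u k l lt lu : farey_summable t lt -> farey_summable u lu ->
  farey_summable (fun p n => k * t p n + l * u p n) (k * lt + l * lu).
Proof.
move=> [ct ft] [cu fu].
have comb p : symmetric_sum (fun n => k * t p n + l * u p n) @ \oo -->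
    k * limn (symmetric_sum (t p)) + l * limn (symmetric_sum (u p)).
  rewrite (_ : symmetric_sum _ = fun M => k * symmetric_sum (t p) M + l * symmetric_sum (u p) M).
    apply: cvgD; (apply: cvgM; first exact: cvg_cst); [exact: ct|exact: cu].
  by apply/funext => M; rewrite /symmetric_sum big_split /= !big_distrr.
split=> [p|]; first by apply/cvg_ex; eexists; exact: (comb p).
rewrite (_ : farey_sum _ = fun N => k * farey_sum (fun p => limn (symmetric_sum (t p))) N
   + l * farey_sum (fun p => limn (symmetric_sum (u p))) N).
  by apply: cvgD; apply: cvgM => //; exact: cvg_cst.
apply/funext => N; rewrite /farey_sum !big_distrr /= -big_split /=.
by apply: eq_bigr => p _; apply: cvg_lim => //; exact: comb.
Qed.

Lemma farey_summable0 : farey_summable (fun=> fun=> 0) 0.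
Proof.
have c : symmetric_sum (fun=> 0) @ \oo --> (0 : R).
  rewrite (_ : symmetric_sum _ = fun=> 0); first exact: cvg_cst.
  by apply/funext => M; exact: big1.
split=> [p|]; first by apply/cvg_ex; exists 0.
rewrite (_ : farey_sum _ = fun=> 0); first exact: cvg_cst.
by apply/funext => N; apply: big1 => p _; apply: cvg_lim.
Qed.

Variables (V : R -> R) (s : edge -> R) (E : Qhat -> int -> edge).
Hypothesis hilbert_summable : forall q : rat,
  farey_summable (fun p n => s (E p n) / 2 * hilbert (elementary_field (E p n)) (ratr q))
    (hilbert V (ratr q)).

Lemma diff_quotient_summable (x y : Qhat) :
  farey_summable (fun p n => s (E p n) / 2 *
    diff_quotient (hilbert (elementary_field (E p n))) x y) (diff_quotient (hilbert V) x y).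
Proof.
case: x y => [x|] [y|] /=; try by under eq_fun do under eq_fun do rewrite mulr0; exact: farey_summable0.
set D := ratr x - ratr y.
have := farey_summable_comb _ _ D^-1 (- D^-1) _ _ (hilbert_summable x) (hilbert_summable y).
congr farey_summable; last by ring.
by apply/funext => p; apply/funext => n; ring.
Qed.

Lemma inf_shear_summable (a b c d : Qhat) :
  farey_summable (fun p n => s (E p n) / 2 *
    inf_shear (hilbert (elementary_field (E p n))) a b c d) (inf_shear (hilbert V) a b c d).
Proof.
have h := farey_summable_comb _ _ 1 1 _ _
  (farey_summable_comb _ _ 1 1 _ _ (diff_quotient_summable c b) (diff_quotient_summable d a))
  (farey_summable_comb _ _ (-1) (-1) _ _ (diff_quotient_summable b a) (diff_quotient_summable d c)).
move: h; congr farey_summable; rewrite /inf_shear; last by ring.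
by apply/funext => p; apply/funext => n; ring.
Qed.

End Summation.

Theorem corollary6p1 (R : realType) (V : R -> R)
    (V_field : vector_field V) (V_zyg : zygmund V)
    (V0 : V 0 = 0) (V1 : V 1 = 0) (Voo : vanishes_at_oo V)
    (s : edge -> R) (s_shear : shear_function V s)
    (Hs : edge -> R) (Hs_shear : shear_function (hilbert V) Hs)
    (E : Qhat -> int -> edge) (E_enum : fan_enumeration E)
    (e : edge) (a b c d : Qhat) (e_side : common_side e a b c d) :
  let term (p : Qhat) (n : int) : R :=
    s (E p n) / 2 * inf_shear (hilbert (elementary_field (E p n))) a b c d in
  (forall p : Qhat, cvgn (symmetric_sum (term p))) /\
  farey_sum (fun p => limn (symmetric_sum (term p))) @ \oo --> Hs e.
Proof.
have [H V_tame] := zygmund_tame R V V_field V_zyg Voo.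
move=> term; rewrite (Hs_shear _ _ _ _ _ e_side); apply: inf_shear_summable => q.
(* At 0 and 1 the transform is 0 by definition; the integral representation concerns the other
   points. *)
have [x01|] := boolP ((ratr q == 0 :> R) || (ratr q == 1 :> R)).
  have h0 W : hilbert W (ratr q : R) = 0 by rewrite /hilbert x01.
  by rewrite h0; under eq_fun do under eq_fun do rewrite h0 mulr0; exact: farey_summable0.
rewrite negb_or => /andP[x0 x1]; split=> [p|].
  have := fan_hilbert_cvg R V s s_shear E E_enum H V_tame (ratr q) x0 x1 p.
  by move=> h; apply/cvg_ex; eexists; exact: h.
have [V_cont _] := V_field.
exact: (hilbert_farey_cvg R V s s_shear V0 V1 E E_enum H V_tame V_cont q x0 x1).
Qed.
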